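(* The threshold problem lies in the complexity class $\exists\mathbb R$.
   Context: A game structure is $G=(\Sigma,S,(A_p)_{p\in\Sigma},(\mathsf{Av}_p)_{p\in\Sigma},\delta)$ with players $\Sigma$, finite state set $S$, finite action sets $A_p$, nonempty available-action sets $\mathsf{Av}_p(s)\subseteq A_p$, and transition function $\delta$ mapping a state and an available action profile to a probability distribution on $S$ (rational probabilities in the input). A game is $(G,\Pi,T,s_0)$ with team $\Pi\subseteq\Sigma$, absorbing target set $T$, initial state $s_0$, and $\Sigma\setminus\Pi=\{\mathsf O\}$ (opponent). Strategies map histories ending in $s$ to distributions over $\mathsf{Av}_p(s)$; a collective strategy is a tuple of strategies for the team players, who randomise independently (joint action probabilities are products of the individual ones); a complete profile induces a probability measure on plays from $s_0$. Threshold problem: given a game and $t\in\mathbb Q\cap[0,1]$, does there exist a collective strategy $\bar\sigma_\Pi$ such that for every opponent strategy $\sigma_{\mathsf O}$, $T$ is reached with probability strictly greater than $t$? An ETR formula is a sentence $\exists x_1\dots\exists x_k\,\phi(x_1,\dots,x_k)$ over the reals with $\phi$ quantifier-free built from $0,1,=,\le,<,+,-,\times$ and Boolean connectives; $\exists\mathbb R$ is the class of problems polynomial-time reducible to deciding truth of ETR formulas. *)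

(* Defs.v *)
From Stdlib Require Import Reals QArith Qreals List Arith ZArith.
From Coquelicot Require Import Coquelicot.
Import ListNotations.
Open Scope R_scope.

Inductive sym : Set := S0 | S1 | SL | SN | SE.

Definition sym_eqb (a b : sym) : bool :=
  match a, b with
  | S0, S0 | S1, S1 | SL, SL | SN, SN | SE, SE => true
  | _, _ => false
  end.

Inductive tree : Set := Leaf (n : nat) | Node (ts : list tree).

Fixpoint bits_pos (p : positive) : list sym :=
  match p with
  | xH => [S1]
  | xO q => bits_pos q ++ [S0]
  | xI q => bits_pos q ++ [S1]
  end.

Definition bin_nat (n : nat) : list sym :=
  match n with O => [] | S _ => bits_pos (Pos.of_nat n) end.

Fixpoint enc_tree (t : tree) : list sym :=
  match t with
  | Leaf n => SL :: bin_nat n ++ [SE]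
  | Node ts =>
      SN :: (fix encs (l : list tree) : list sym :=
               match l with [] => [] | u :: l' => enc_tree u ++ encs l' end) ts
         ++ [SE]
  end.

Definition tr_nats (l : list nat) : tree := Node (map Leaf l).

Definition tr_Z (z : Z) : tree :=
  match z with
  | Z0 => Node [Leaf 0; Leaf 0]
  | Zpos p => Node [Leaf 1; Leaf (Pos.to_nat p)]
  | Zneg p => Node [Leaf 2; Leaf (Pos.to_nat p)]
  end.

Definition tr_Q (q : Q) : tree := Node [tr_Z (Qnum q); Leaf (Pos.to_nat (Qden q))].

Inductive move : Set := MLeft | MRight | MStay.

Definition osym_eqb (a b : option sym) : bool :=
  match a, b with
  | None, None => true
  | Some x, Some y => sym_eqb x y
  | _, _ => false
  end.

(* A machine: start state and a finite transition table
   (state, read symbol) |-> (new state, written symbol, move);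
   None is the blank symbol.  Finitely many states (those in the table).
   The machine halts when no entry of the table applies (first match used). *)
Record TM : Set := mkTM {
  tm_start : nat;
  tm_table : list (nat * option sym * (nat * option sym * move))
}.

(* configuration: state, cells left of head (nearest first), head cell,
   cells right of head; missing cells are blank. *)
Record config : Set := mkConfig {
  c_state : nat; c_left : list (option sym); c_cur : option sym;
  c_right : list (option sym) }.

Definition tm_lookup (M : TM) (q : nat) (a : option sym) :
  option (nat * option sym * move) :=
  match find (fun e => Nat.eqb (fst (fst e)) q && osym_eqb (snd (fst e)) a)
             (tm_table M) with
  | Some e => Some (snd e)
  | None => None
  end.

Definition tm_apply (q' : nat) (b : option sym) (m : move) (c : config) : config :=
  match m with
  | MStay => mkConfig q' (c_left c) b (c_right c)
  | MLeft =>
      match c_left c with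
      | [] => mkConfig q' [] None (b :: c_right c)
      | x :: l => mkConfig q' l x (b :: c_right c)
      end
  | MRight =>
      match c_right c with
      | [] => mkConfig q' (b :: c_left c) None []
      | x :: r => mkConfig q' (b :: c_left c) x r
      end
  end.

Fixpoint tm_exec (M : TM) (n : nat) (c : config) : option config :=
  match tm_lookup M (c_state c) (c_cur c) with
  | None => Some c
  | Some (q', b, m) =>
      match n with O => None | S n' => tm_exec M n' (tm_apply q' b m c) end
  end.

Definition tm_init (M : TM) (w : list sym) : config :=
  match w with
  | [] => mkConfig (tm_start M) [] None []
  | x :: r => mkConfig (tm_start M) [] (Some x) (map Some r)
  end.

Fixpoint read_word (l : list (option sym)) : list sym :=
  match l with
  | Some x :: l' => x :: read_word l'
  | _ => []
  end.

Definition tm_output (c : config) : list sym := read_word (c_cur c :: c_right c).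

Definition poly_reducible (L1 L2 : list sym -> Prop) : Prop :=
  exists (M : TM) (k d : nat), forall w : list sym,
    exists c : config,
      tm_exec M (k * length w ^ d + k) (tm_init M w) = Some c /\
      (L1 w <-> L2 (tm_output c)).

Inductive eterm : Set :=
  | EVar (i : nat) | EZero | EOne
  | EAdd (a b : eterm) | ESub (a b : eterm) | EMul (a b : eterm).

Inductive eform : Set :=
  | FEq (a b : eterm) | FLe (a b : eterm) | FLt (a b : eterm)
  | FNot (f : eform) | FAnd (f g : eform) | FOr (f g : eform).

Fixpoint eterm_eval (x : nat -> R) (t : eterm) : R :=
  match t with
  | EVar i => x i | EZero => 0 | EOne => 1
  | EAdd a b => eterm_eval x a + eterm_eval x b
  | ESub a b => eterm_eval x a - eterm_eval x b
  | EMul a b => eterm_eval x a * eterm_eval x b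
  end.

Fixpoint eform_holds (x : nat -> R) (f : eform) : Prop :=
  match f with
  | FEq a b => eterm_eval x a = eterm_eval x b
  | FLe a b => eterm_eval x a <= eterm_eval x b
  | FLt a b => eterm_eval x a < eterm_eval x b
  | FNot g => ~ eform_holds x g
  | FAnd g h => eform_holds x g /\ eform_holds x h
  | FOr g h => eform_holds x g \/ eform_holds x h
  end.

Fixpoint eterm_vars_below (k : nat) (t : eterm) : Prop :=
  match t with
  | EVar i => (i < k)%nat | EZero | EOne => True
  | EAdd a b | ESub a b | EMul a b => eterm_vars_below k a /\ eterm_vars_below k b
  end.

Fixpoint eform_vars_below (k : nat) (f : eform) : Prop :=
  match f with
  | FEq a b | FLe a b | FLt a b => eterm_vars_below k a /\ eterm_vars_below k b
  | FNot g => eform_vars_below k g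
  | FAnd g h | FOr g h => eform_vars_below k g /\ eform_vars_below k h
  end.

Fixpoint tr_eterm (t : eterm) : tree :=
  match t with
  | EVar i => Node [Leaf 0; Leaf i]
  | EZero => Node [Leaf 1]
  | EOne => Node [Leaf 2]
  | EAdd a b => Node [Leaf 3; tr_eterm a; tr_eterm b]
  | ESub a b => Node [Leaf 4; tr_eterm a; tr_eterm b]
  | EMul a b => Node [Leaf 5; tr_eterm a; tr_eterm b]
  end.

Fixpoint tr_eform (f : eform) : tree :=
  match f with
  | FEq a b => Node [Leaf 0; tr_eterm a; tr_eterm b]
  | FLe a b => Node [Leaf 1; tr_eterm a; tr_eterm b]
  | FLt a b => Node [Leaf 2; tr_eterm a; tr_eterm b]
  | FNot g => Node [Leaf 3; tr_eform g]
  | FAnd g h => Node [Leaf 4; tr_eform g; tr_eform h]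
  | FOr g h => Node [Leaf 5; tr_eform g; tr_eform h]
  end.

(* The sentence  exists x_0 ... exists x_{k-1}, phi  (phi mentions only x_i, i<k) *)
Definition ETR_true (k : nat) (phi : eform) : Prop :=
  exists x : nat -> R, eform_holds x phi.

Definition ETR_lang (w : list sym) : Prop :=
  exists (k : nat) (phi : eform),
    enc_tree (Node [Leaf k; tr_eform phi]) = w /\
    eform_vars_below k phi /\ ETR_true k phi.

Definition in_ExistsR (L : list sym -> Prop) : Prop := poly_reducible L ETR_lang.

(* Explicit (rational) input description of a game (G, Pi, T, s0) and t.
   Players 0 .. gi_team-1 form the team Pi; player gi_team is the opponent O.
   States are 0 .. gi_nst-1.  Player p has actions 0 .. (nth p gi_nact 0)-1.
   nth s (nth p gi_av []) [] is the list Av_p(s).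
   gi_trans lists entries (s, action profile a, distribution delta(s,a)),
   a distribution being the list of probabilities of states 0..nst-1.   *)
Record game_inst : Set := mkGame {
  gi_team : nat;
  gi_nst : nat;
  gi_nact : list nat;
  gi_av : list (list (list nat));
  gi_trans : list (nat * list nat * list Q);
  gi_target : list nat;
  gi_init : nat;
  gi_thr : Q }.

Definition tr_game (g : game_inst) : tree :=
  Node [Leaf (gi_team g); Leaf (gi_nst g); tr_nats (gi_nact g);
        Node (map (fun l => Node (map tr_nats l)) (gi_av g));
        Node (map (fun e => Node [Leaf (fst (fst e)); tr_nats (snd (fst e));
                                  Node (map tr_Q (snd e))]) (gi_trans g));
        tr_nats (gi_target g); Leaf (gi_init g); tr_Q (gi_thr g)].

Definition av (g : game_inst) (p s : nat) : list nat := nth s (nth p (gi_av g) []) [].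

Fixpoint cart (ls : list (list nat)) : list (list nat) :=
  match ls with
  | [] => [[]]
  | l :: ls' => flat_map (fun x => map (cons x) (cart ls')) l
  end.

Definition profiles (g : game_inst) (s : nat) : list (list nat) :=
  cart (map (fun p => av g p s) (seq 0 (S (gi_team g)))).

Fixpoint nat_list_eqb (a b : list nat) : bool :=
  match a, b with
  | [], [] => true
  | x :: a', y :: b' => Nat.eqb x y && nat_list_eqb a' b'
  | _, _ => false
  end.

Definition trans_lookup (g : game_inst) (s : nat) (a : list nat) : option (list Q) :=
  match find (fun e => Nat.eqb (fst (fst e)) s && nat_list_eqb (snd (fst e)) a)
             (gi_trans g) with
  | Some e => Some (snd e)
  | None => None
  end.

Definition delta (g : game_inst) (s : nat) (a : list nat) (s' : nat) : R :=
  match trans_lookup g s a with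
  | Some d => Q2R (nth s' d 0%Q)
  | None => 0
  end.

Definition sumR (l : list R) : R := fold_right Rplus 0 l.
Definition prodR (l : list R) : R := fold_right Rmult 1 l.

Definition is_target (g : game_inst) (s : nat) : bool :=
  existsb (Nat.eqb s) (gi_target g).

Definition game_wf (g : game_inst) : Prop :=
  length (gi_nact g) = S (gi_team g) /\
  length (gi_av g) = S (gi_team g) /\
  (forall p, (p <= gi_team g)%nat -> length (nth p (gi_av g) []) = gi_nst g) /\
  (forall p s, (p <= gi_team g)%nat -> (s < gi_nst g)%nat ->
     av g p s <> [] /\ NoDup (av g p s) /\
     List.Forall (fun a => (a < nth p (gi_nact g) 0)%nat) (av g p s)) /\
  (forall s a, (s < gi_nst g)%nat -> In a (profiles g s) ->
     exists d, trans_lookup g s a = Some d /\ length d = gi_nst g /\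
       List.Forall (fun q => (0 <= q)%Q) d /\ Qeq (fold_right Qplus 0%Q d) 1%Q) /\
  List.Forall (fun t => (t < gi_nst g)%nat) (gi_target g) /\
  (forall s a s', (s < gi_nst g)%nat -> is_target g s = true ->
     In a (profiles g s) -> (s' < gi_nst g)%nat -> is_target g s' = false ->
     delta g s a s' = 0) /\
  (gi_init g < gi_nst g)%nat /\
  (0 <= gi_thr g)%Q /\ (gi_thr g <= 1)%Q.

(* A (behavioural) strategy: history (sequence of states, s0 first) |->
   distribution over actions (given as a function action |-> probability). *)
Definition strategy : Type := list nat -> nat -> R.

Definition valid_strategy (g : game_inst) (p : nat) (sigma : strategy) : Prop :=
  forall h : list nat, h <> [] -> List.Forall (fun s => (s < gi_nst g)%nat) h ->
    let s := last h 0%nat in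
    (forall a, 0 <= sigma h a) /\
    (forall a, ~ In a (av g p s) -> sigma h a = 0) /\
    sumR (map (sigma h) (av g p s)) = 1.

(* prob_{profile}(reach T within n more steps | current history h);
   [strat p] is the strategy of player p (p <= team). Players randomise
   independently: a joint profile has the product probability. *)
Fixpoint reach_within (g : game_inst) (strat : nat -> strategy) (n : nat)
    (h : list nat) : R :=
  let s := last h 0%nat in
  if is_target g s then 1 else
  match n with
  | O => 0
  | S n' =>
      sumR (map (fun a =>
        prodR (map (fun pa => strat (fst pa) h (snd pa)) (combine (seq 0 (length a)) a))
        * sumR (map (fun s' => delta g s a s' * reach_within g strat n' (h ++ [s']))
                    (seq 0 (gi_nst g))))
        (profiles g s))
  end.

(* probability that T is reached from s0 = limit of the (nondecreasing)
   probabilities of reaching T within n steps (continuity of the measure) *)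
Definition reach_prob (g : game_inst) (strat : nat -> strategy) : Rbar :=
  Lim_seq (fun n => reach_within g strat n [gi_init g]).

Definition profile_of (g : game_inst) (team : nat -> strategy) (opp : strategy) :
  nat -> strategy := fun p => if Nat.eqb p (gi_team g) then opp else team p.

Definition threshold_yes (g : game_inst) : Prop :=
  exists team : nat -> strategy,
    (forall p, (p < gi_team g)%nat -> valid_strategy g p (team p)) /\
    forall opp : strategy, valid_strategy g (gi_team g) opp ->
      Rbar_lt (Finite (Q2R (gi_thr g))) (reach_prob g (profile_of g team opp)).

Definition threshold_lang (w : list sym) : Prop :=
  exists g : game_inst, enc_tree (tr_game g) = w /\ game_wf g /\ threshold_yes g.

(* Main.v *)
(** The discounting idea.  Fix a factor lam in (0,1).  If nonnegative weights w
    satisfy w(s) <= lam * E[w(s')] at every nontarget state, for a memoryless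
    team choice x(s) and every opponent action, and w <= 1 on the target, then
    against every opponent w(s) - lam^n * sum(w) bounds from below the
    probability of reaching the target from s within n steps; so w(s0) > t
    certifies the threshold.  Conversely, against a winning team strategy the
    opponent can play greedily for the limit of the finite-horizon values (the
    minimum over its finitely many actions commutes with this monotone limit),
    so some finite-horizon value exceeds t, and still does when discounted by
    some lam < 1.  The supremum w(s) of the discounted values over all histories
    ending in s, together with the choice made at a nearly optimal such
    history, is a certificate (lam is replaced by (1+lam)/2 to absorb the slack
    of "nearly").  Certificates are solutions of a polynomial-size system.

    For the reduction, all arithmetic on the input (comparisons, lengths,
    lookups in the transition table, sums of rationals) is left to the
    formula: the machine checks that the input follows a regular tree grammar
    and prints the formula by nested loops over the input.  Completeness of the
    transition table, quantified over exponentially many profiles, is the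
    equation "product of the numbers of available actions = number of valid
    first entries".  A variable of the formula is named by the binary
    encoding of the input data it depends on. *)

Require Import Defs.
From Stdlib Require Import Reals QArith Qreals List Arith ZArith Lia Lra.
From Stdlib Require Import Permutation Cantor Classical IndefiniteDescription FunctionalExtensionality.
From Coquelicot Require Import Coquelicot.
Import ListNotations.

(** * A queue machine on one tape *)

Local Open Scope bool_scope.
Local Open Scope nat_scope.

(** Reachability is a least fixed point, but an undiscounted inequality [w s <= E[w]] has spurious
    solutions: on a set of nontarget states that play never leaves, every constant satisfies it. The
    factor [lam < 1] lets errors die out geometrically, so that every solution is a lower bound. The
    price is an underestimate, which is affordable because the threshold is strict.

    The other obstacle is the literal machine model: the reduction has to be a one-tape Turing
    machine with a proved polynomial time bound. The tape is organised as finitely many queues, and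
    programs over them are layered until the running time follows from syntax alone: the only loops
    run once per input symbol, and apart from the output the registers hold only pieces of the
    input. Such programs can parse and print but not calculate, so even the well-formedness of the
    game becomes part of the sentence, and the unknowns double as lookup tables. Variable numbers
    may be exponentially large, but their binary codes stay linear in the input. *)

Definition step (M : TM) (c : config) : option config :=
  match tm_lookup M (c_state c) (c_cur c) with
  | None => None
  | Some (q, b, m) => Some (tm_apply q b m c)
  end.

(* [runs M n c c']: c' is reached from c in at most n steps. *)
Inductive runs (M : TM) : nat -> config -> config -> Prop :=
| runs_refl n c : runs M n c c
| runs_step n c c1 c2 : step M c = Some c1 -> runs M n c1 c2 -> runs M (S n) c c2.

Lemma runs_weaken M n n' c c' : runs M n c c' -> n <= n' -> runs M n' c c'.
Proof.
  intros H; revert n'; induction H as [|n c c1 c2 H1 _ IH]; intros n' Hn.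
  - constructor.
  - destruct n'; [lia|]. eapply runs_step; [eassumption|]. apply IH; lia.
Qed.

Lemma runs_trans M a b c1 c2 c3 : runs M a c1 c2 -> runs M b c2 c3 -> runs M (a + b) c1 c3.
Proof.
  induction 1 as [n c|n c c1 c2 H1 _ IH]; intros H.
  - eapply runs_weaken; [eassumption|lia].
  - simpl. eapply runs_step; eauto.
Qed.

Lemma runs_trans_le M a b n c1 c2 c3 :
  runs M a c1 c2 -> runs M b c2 c3 -> a + b <= n -> runs M n c1 c3.
Proof. intros; eapply runs_weaken; [eapply runs_trans; eassumption|assumption]. Qed.

Lemma runs_exec M n c c' k :
  runs M n c c' -> tm_lookup M (c_state c') (c_cur c') = None -> n <= k ->
  tm_exec M k c = Some c'.
Proof.
  intros H; revert k; induction H as [n c|n c c1 c2 H1 _ IH]; intros k HN Hk.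
  - destruct k; simpl; rewrite HN; reflexivity.
  - destruct k; [lia|]. unfold step in H1. simpl.
    destruct (tm_lookup M (c_state c) (c_cur c)) as [[[q b] m]|]; [|discriminate].
    injection H1 as <-. apply IH; [assumption|lia].
Qed.

(* In [cfg q L T] the head reads the first cell of T and L lists the cells to
   its left, nearest first; in [bcfg q Z T] it reads the first cell of Z, Z
   going leftwards and T rightwards.  Missing cells are blank. *)
Definition cfg (q : nat) (L T : list (option sym)) : config :=
  match T with
  | [] => mkConfig q L None []
  | x :: r => mkConfig q L x r
  end.

Definition bcfg (q : nat) (Z T : list (option sym)) : config :=
  match Z with
  | [] => mkConfig q [] None T
  | z :: L => mkConfig q L z T
  end.

Ltac cfg_cases := unfold step, cfg, bcfg.

Lemma step_right M q q' b L T :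
  tm_lookup M q (hd None T) = Some (q', b, MRight) ->
  step M (cfg q L T) = Some (cfg q' (b :: L) (tl T)).
Proof.
  cfg_cases; destruct T as [|x r]; simpl; intros ->; [reflexivity|].
  unfold tm_apply; simpl. destruct r; reflexivity.
Qed.

Lemma step_turn M q q' b L T :
  tm_lookup M q (hd None T) = Some (q', b, MLeft) ->
  step M (cfg q L T) = Some (bcfg q' L (b :: tl T)).
Proof.
  cfg_cases; destruct T as [|x r]; simpl; intros ->;
    unfold tm_apply; simpl; destruct L; reflexivity.
Qed.

Lemma step_left M q q' b Z T :
  tm_lookup M q (hd None Z) = Some (q', b, MLeft) ->
  step M (bcfg q Z T) = Some (bcfg q' (tl Z) (b :: T)).
Proof.
  cfg_cases; destruct Z as [|x r]; simpl; intros ->;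
    unfold tm_apply; simpl; [reflexivity|]; destruct r; reflexivity.
Qed.

Lemma step_stay_b M q q' b Z T :
  tm_lookup M q (hd None Z) = Some (q', b, MStay) ->
  step M (bcfg q Z T) = Some (bcfg q' (b :: tl Z) T).
Proof. cfg_cases; destruct Z as [|x r]; simpl; intros ->; reflexivity. Qed.

Arguments cfg : simpl never.
Arguments bcfg : simpl never.

(** * Queue instructions and their execution by a transition table *)

Inductive instr : Set :=
| IPeek (i : nat) (f : option sym -> nat)
| IDel (i next : nat)
| IApp (i : nat) (a : sym) (next : nat)
| IFin (i : nat).

(* Micro-states (tag, program counter, separators still to pass, carried cell).
   Tags: 0 at home before an instruction, 1 seeking rightwards, 2 going home,
   3 shifting the tape left by one, 4 shifting it right by one, 5 initial. *)
Definition key : Set := (nat * nat * nat * option sym)%type.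

(** Registers are found by counting blanks, since each one is followed by a blank. [IDel] runs to
    the far end and shifts leftwards across the [m - i] blanks that end registers [i] to [m - 1];
    the front symbol of register [i] is the last cell picked up and is dropped at the blank before
    it. [IApp] overwrites the blank that ends register [i] and shifts the following [m - 1 - i]
    registers rightwards. [IFin] halts on the first cell of register [i], where the output is
    read. *)
Definition trans_of (m : nat) (code : list instr) (q : key) (a : option sym) :
  option (key * option sym * move) :=
  match q with (t, pc, k, c) =>
  match t with
  | 0 => match nth_error code pc with
         | Some (IPeek i _) => Some ((1, pc, i, None), a, MRight)
         | Some (IDel i _) => Some ((1, pc, m, None), a, MRight)
         | Some (IApp i _ _) => Some ((1, pc, i, None), a, MRight)
         | Some (IFin i) => Some ((1, pc, i, None), a, MRight)
         | None => None
         end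
  | 1 => match k with
         | S k' => match a with
                   | Some _ => Some ((1, pc, k, None), a, MRight)
                   | None => Some ((1, pc, k', None), a, MRight)
                   end
         | 0 => match nth_error code pc with
                | Some (IPeek i f) => Some ((2, f a, i, None), a, MLeft)
                | Some (IDel i _) => Some ((3, pc, m - i, None), a, MLeft)
                | Some (IApp i s _) =>
                    match a with
                    | Some _ => Some ((1, pc, 0, None), a, MRight)
                    | None => Some ((4, pc, m - 1 - i, None), Some s, MRight)
                    end
                | _ => None
                end
         end
  | 2 => match a with
         | Some _ => Some ((2, pc, k, None), a, MLeft)
         | None => match k with
                   | 0 => Some ((0, pc, 0, None), None, MStay)
                   | S k' => Some ((2, pc, k', None), None, MLeft)
                   end
         end
  | 3 => match a with
         | Some _ => Some ((3, pc, k, a), c, MLeft)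
         | None => match k with
                   | S k' => Some ((3, pc, k', None), c, MLeft)
                   | 0 => match nth_error code pc with
                          | Some (IDel i next) => Some ((2, next, i, None), None, MStay)
                          | _ => None
                          end
                   end
         end
  | 4 => match a with
         | Some _ => Some ((4, pc, k, a), c, MRight)
         | None => match k with
                   | S k' => Some ((4, pc, k', None), c, MRight)
                   | 0 => match nth_error code pc with
                          | Some (IApp i _ next) => Some ((2, next, m, None), c, MStay)
                          | _ => None
                          end
                   end
         end
  | 5 => Some ((0, 0, 0, None), a, MLeft)
  | _ => None
  end end.

Definition oc (c : option sym) : nat :=
  match c with None => 0 | Some S0 => 1 | Some S1 => 2 | Some SL => 3 | Some SN => 4 | Some SE => 5 end.

Definition key_nat (q : key) : nat :=
  match q with (t, pc, k, c) => to_nat (t, to_nat (pc, to_nat (k, oc c))) end.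

Lemma oc_inj a b : oc a = oc b -> a = b.
Proof. destruct a as [[]|], b as [[]|]; simpl; congruence. Qed.

Arguments key_nat : simpl never.

Lemma key_nat_inj q q' : key_nat q = key_nat q' -> q = q'.
Proof.
  destruct q as [[[t pc] k] c], q' as [[[t' pc'] k'] c']; unfold key_nat.
  intros H. apply to_nat_inj, pair_equal_spec in H as [-> H].
  apply to_nat_inj, pair_equal_spec in H as [-> H].
  apply to_nat_inj, pair_equal_spec in H as [-> H].
  apply oc_inj in H; congruence.
Qed.

Definition all_osym : list (option sym) :=
  [None; Some S0; Some S1; Some SL; Some SN; Some SE].

Lemma all_osym_in a : In a all_osym.
Proof. destruct a as [[]|]; simpl; tauto. Qed.

Lemma osym_eqb_eq a b : osym_eqb a b = true <-> a = b.
Proof. destruct a as [[]|], b as [[]|]; simpl; split; congruence. Qed.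

Definition all_keys (P m : nat) : list (key * option sym) :=
  list_prod (list_prod (list_prod (list_prod (seq 0 6) (seq 0 P)) (seq 0 (S m))) all_osym)
    all_osym.

Definition entry_of (m : nat) (code : list instr) (e : key * option sym) :=
  match trans_of m code (fst e) (snd e) with
  | Some (q', b, mv) => [((key_nat (fst e), snd e), (key_nat q', b, mv))]
  | None => []
  end.

Definition machine (m : nat) (code : list instr) : TM :=
  mkTM (key_nat (5, 0, 0, None))
    (flat_map (entry_of m code) (all_keys (length code) m)).

(** State numbers are injective, so all matching entries come from the pair itself and the first
    match is the right one. A pair without transition yields no entry at all, which is how the
    machine halts. *)
Lemma find_entry m code q a KS : In (q, a) KS ->
  find (fun e => Nat.eqb (fst (fst e)) (key_nat q) && osym_eqb (snd (fst e)) a)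
       (flat_map (entry_of m code) KS)
  = match trans_of m code q a with
    | Some (q', b, mv) => Some ((key_nat q, a), (key_nat q', b, mv))
    | None => None
    end.
Proof.
  assert (HN : forall KS, trans_of m code q a = None ->
    find (fun e => Nat.eqb (fst (fst e)) (key_nat q) && osym_eqb (snd (fst e)) a)
       (flat_map (entry_of m code) KS) = None).
  { clear KS; intros KS HN. induction KS as [|[q0 a0] KS IH]; [reflexivity|].
    simpl. unfold entry_of at 1; simpl.
    destruct (trans_of m code q0 a0) as [[[q' b] mv]|] eqn:E; simpl; [|exact IH].
    destruct (Nat.eqb_spec (key_nat q0) (key_nat q)) as [Hq|]; simpl; [|exact IH].
    destruct (osym_eqb a0 a) eqn:Ha; [|exact IH].
    apply osym_eqb_eq in Ha; apply key_nat_inj in Hq; congruence. }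
  intros HI. destruct (trans_of m code q a) as [[[q' b] mv]|] eqn:E; [|apply HN; reflexivity].
  induction KS as [|[q0 a0] KS IH]; [destruct HI|].
  simpl. unfold entry_of at 1; simpl.
  destruct (trans_of m code q0 a0) as [[[q0' b0] mv0]|] eqn:E0; simpl.
  - destruct (Nat.eqb_spec (key_nat q0) (key_nat q)) as [Hq|Hq]; simpl.
    + destruct (osym_eqb a0 a) eqn:Ha.
      * apply osym_eqb_eq in Ha; apply key_nat_inj in Hq; subst.
        rewrite E in E0; injection E0 as <- <- <-; reflexivity.
      * apply IH. destruct HI as [HI|HI]; [|exact HI]. injection HI as -> ->.
        rewrite (proj2 (osym_eqb_eq a a) eq_refl) in Ha; discriminate.
    + apply IH. destruct HI as [HI|HI]; [|exact HI]. injection HI as -> ->. now elim Hq.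
  - apply IH. destruct HI as [HI|HI]; [|exact HI]. injection HI as -> ->. congruence.
Qed.

Lemma lookup_machine m code t pc k c a :
  t < 6 -> pc < length code -> k <= m ->
  tm_lookup (machine m code) (key_nat (t, pc, k, c)) a =
  match trans_of m code (t, pc, k, c) a with
  | Some (q', b, mv) => Some (key_nat q', b, mv)
  | None => None
  end.
Proof.
  intros Ht Hpc Hk. unfold tm_lookup, machine; cbn [tm_table].
  rewrite find_entry.
  - destruct (trans_of m code (t, pc, k, c) a) as [[[? ?] ?]|]; reflexivity.
  - unfold all_keys. repeat apply in_prod; try apply all_osym_in; apply in_seq; lia.
Qed.

(** * Sweeps over the register tape *)

Definition blk (r : list sym) : list (option sym) := map Some r ++ [None].
Definition tape (rs : list (list sym)) : list (option sym) := concat (map blk rs).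

Lemma tape_app a b : tape (a ++ b) = tape a ++ tape b.
Proof. unfold tape. now rewrite map_app, concat_app. Qed.

Definition is_blank (a : option sym) : bool := match a with None => true | Some _ => false end.
Definition blanks (Z : list (option sym)) : nat := length (filter is_blank Z).

Lemma blanks_app a b : blanks (a ++ b) = blanks a + blanks b.
Proof. unfold blanks. now rewrite filter_app, length_app. Qed.

Lemma blanks_rev a : blanks (rev a) = blanks a.
Proof.
  induction a as [|x a IH]; [reflexivity|]. simpl. rewrite blanks_app, IH.
  unfold blanks; simpl; destruct (is_blank x); simpl; lia.
Qed.

Lemma blanks_word w : blanks (map Some w) = 0.
Proof. induction w; auto. Qed.

Lemma blanks_tape rs : blanks (tape rs) = length rs.
Proof.
  induction rs as [|r rs IH]; [reflexivity|].
  change (tape (r :: rs)) with (blk r ++ tape rs).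
  unfold blk. rewrite !blanks_app, blanks_word, IH. reflexivity.
Qed.

Lemma blanks_cons_none Z : blanks (None :: Z) = S (blanks Z).
Proof. reflexivity. Qed.
Lemma blanks_cons_some x Z : blanks (Some x :: Z) = blanks Z.
Proof. reflexivity. Qed.

Local Arguments nth_error : simpl nomatch.

Ltac lk := rewrite lookup_machine by (simpl in *; lia); simpl.

Arguments blanks : simpl never.

Lemma seek_word m code pc k w L T : pc < length code -> S k <= m ->
  runs (machine m code) (length w)
    (cfg (key_nat (1, pc, S k, None)) L (map Some w ++ T))
    (cfg (key_nat (1, pc, S k, None)) (rev (map Some w) ++ L) T).
Proof.
  intros Hpc Hk; revert L; induction w as [|a w IH]; intros L; simpl; [constructor|].
  eapply runs_step; [apply step_right; lk; reflexivity|].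
  simpl. rewrite <- app_assoc. apply IH.
Qed.

Lemma seek_blk m code pc k w L T : pc < length code -> S k <= m ->
  runs (machine m code) (length (blk w))
    (cfg (key_nat (1, pc, S k, None)) L (blk w ++ T))
    (cfg (key_nat (1, pc, k, None)) (rev (blk w) ++ L) T).
Proof.
  intros Hpc Hk. unfold blk. rewrite rev_app_distr, length_app, length_map, <- app_assoc.
  eapply runs_trans; [apply seek_word; assumption|].
  eapply runs_step; [apply step_right; lk; reflexivity|]. simpl. constructor.
Qed.

Lemma seek_tape m code pc k rs L T : pc < length code -> length rs + k <= m ->
  runs (machine m code) (length (tape rs))
    (cfg (key_nat (1, pc, length rs + k, None)) L (tape rs ++ T))
    (cfg (key_nat (1, pc, k, None)) (rev (tape rs) ++ L) T).
Proof.
  intros Hpc; revert L; induction rs as [|r rs IH]; intros L Hk; [constructor|].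
  change (tape (r :: rs)) with (blk r ++ tape rs). simpl in *.
  rewrite length_app, rev_app_distr, <- !app_assoc.
  eapply runs_trans; [apply seek_blk; lia|]. apply IH; lia.
Qed.

Lemma seek_blank m code pc k j L : pc < length code -> k + j <= m ->
  runs (machine m code) j
    (cfg (key_nat (1, pc, j + k, None)) L [])
    (cfg (key_nat (1, pc, k, None)) (repeat None j ++ L) []).
Proof.
  intros Hpc; revert L; induction j as [|j IH]; intros L Hk; [constructor|].
  simpl. eapply runs_step; [apply step_right; lk; reflexivity|]. simpl.
  replace (None :: repeat None j ++ L) with (repeat None j ++ None :: L :> list (option sym)).
  - apply IH; lia.
  - clear. induction j; simpl; congruence.
Qed.

Lemma back_cells m code pc k Z Z2 T : pc < length code -> blanks Z + k <= m ->
  runs (machine m code) (length Z)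
    (bcfg (key_nat (2, pc, blanks Z + k, None)) (Z ++ Z2) T)
    (bcfg (key_nat (2, pc, k, None)) Z2 (rev Z ++ T)).
Proof.
  intros Hpc; revert T; induction Z as [|[a|] Z IH]; intros T Hk; [constructor| |]; cbn [app length rev].
  - rewrite blanks_cons_some in *. eapply runs_step; [apply step_left; lk; reflexivity|].
    cbn [app length rev tl]. rewrite <- app_assoc. apply IH; lia.
  - rewrite blanks_cons_none in *. eapply runs_step; [apply step_left; lk; reflexivity|].
    cbn [app length rev tl]. rewrite <- app_assoc. apply IH; lia.
Qed.

(** The equation between [c :: Z] and [Y ++ [c']] says that the cells move by one place: the carried
    cell is written first, each cell read is written one step later, and the last one read, [c'],
    stays in the state. *)
Lemma shift_left m code pc k c Z Z2 Y c' T : pc < length code -> blanks Z + k <= m ->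
  c :: Z = Y ++ [c'] ->
  runs (machine m code) (length Z)
    (bcfg (key_nat (3, pc, blanks Z + k, c)) (Z ++ Z2) T)
    (bcfg (key_nat (3, pc, k, c')) Z2 (rev Y ++ T)).
Proof.
  intros Hpc; revert c Y T; induction Z as [|z Z IH]; intros c Y T Hk HY.
  - destruct Y as [|y [|? ?]]; simpl in HY; [|discriminate|discriminate].
    injection HY as <-. constructor.
  - destruct Y as [|y Y]; [discriminate|]. simpl in HY. injection HY as -> HY.
    cbn [app length rev]. rewrite <- app_assoc.
    destruct z as [a|].
    + rewrite blanks_cons_some in *. eapply runs_step; [apply step_left; lk; reflexivity|].
      apply IH; [lia|assumption].
    + rewrite blanks_cons_none in *. eapply runs_step; [apply step_left; lk; reflexivity|].
      apply IH; [lia|assumption].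
Qed.

Lemma shift_right m code pc k c Z L Y c' T : pc < length code -> blanks Z + k <= m ->
  c :: Z = Y ++ [c'] ->
  runs (machine m code) (length Z)
    (cfg (key_nat (4, pc, blanks Z + k, c)) L (Z ++ T))
    (cfg (key_nat (4, pc, k, c')) (rev Y ++ L) T).
Proof.
  intros Hpc; revert c Y L; induction Z as [|z Z IH]; intros c Y L Hk HY.
  - destruct Y as [|y [|? ?]]; simpl in HY; [|discriminate|discriminate].
    injection HY as <-. constructor.
  - destruct Y as [|y Y]; [discriminate|]. simpl in HY. injection HY as -> HY.
    cbn [app length rev]. rewrite <- app_assoc.
    destruct z as [a|].
    + rewrite blanks_cons_some in *. eapply runs_step; [apply step_right; lk; reflexivity|].
      apply IH; [lia|assumption].
    + rewrite blanks_cons_none in *. eapply runs_step; [apply step_right; lk; reflexivity|].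
      apply IH; [lia|assumption].
Qed.

Definition home (pc : nat) (T : list (option sym)) : config :=
  cfg (key_nat (0, pc, 0, None)) [] (None :: T).

Lemma back_home m code pc k Z T : pc < length code -> blanks Z = k -> k <= m ->
  runs (machine m code) (S (length Z))
    (bcfg (key_nat (2, pc, k, None)) (Z ++ [None]) T)
    (home pc (rev Z ++ T)).
Proof.
  intros Hpc HZ Hk. replace (S (length Z)) with (length Z + 1) by lia.
  eapply runs_trans; [replace k with (blanks Z + 0) by lia; apply back_cells; lia|].
  eapply runs_step; [apply step_stay_b; lk; reflexivity|]. simpl.
  constructor.
Qed.

Definition store : Type := nat -> list sym.
Definition upd (st : store) (i : nat) (v : list sym) : store :=
  fun j => if Nat.eqb j i then v else st j.

Lemma upd_eq st i v : upd st i v i = v.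
Proof. unfold upd. now rewrite Nat.eqb_refl. Qed.
Lemma upd_ne st i j v : j <> i -> upd st i v j = st j.
Proof. unfold upd. intros H. apply Nat.eqb_neq in H. now rewrite H. Qed.
Lemma upd_same st i : upd st i (st i) = st.
Proof.
  apply functional_extensionality; intros j. unfold upd.
  destruct (Nat.eqb_spec j i); congruence.
Qed.
Lemma upd_upd st i v v' : upd (upd st i v) i v' = upd st i v'.
Proof. apply functional_extensionality; intros j. unfold upd. destruct (Nat.eqb j i); auto. Qed.

Definition regs (m : nat) (st : store) : list (list sym) := map st (seq 0 m).

Lemma regs_length m st : length (regs m st) = m.
Proof. unfold regs. now rewrite length_map, length_seq. Qed.

Lemma regs_split m st i : i < m -> exists A B, length A = i /\ length B = m - 1 - i /\
  forall v, regs m (upd st i v) = A ++ v :: B.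
Proof.
  intros Hi. exists (map st (seq 0 i)), (map st (seq (S i) (m - 1 - i))).
  rewrite !length_map, !length_seq. repeat split.
  intros v. unfold regs. replace m with (i + S (m - 1 - i)) at 1 by lia.
  rewrite seq_app, map_app. simpl. rewrite upd_eq. f_equal; [|f_equal];
    apply map_ext_in; intros j Hj; apply in_seq in Hj; apply upd_ne; lia.
Qed.

Definition tlen (m : nat) (st : store) : nat := length (tape (regs m st)).

(* The tape holds registers 0..m-1, each followed by a blank, to the right of a home blank. *)
Definition at_pc (m pc : nat) (st : store) (c : config) : Prop :=
  exists j, c = home pc (tape (regs m st) ++ repeat None j).

Lemma repeat_tl j : tl (repeat None j) = repeat (A:=option sym) None (j - 1).
Proof. destruct j; simpl; [reflexivity|]. now rewrite Nat.sub_0_r. Qed.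

Lemma hd_repeat j : hd None (repeat (A:=option sym) None j) = None.
Proof. now destruct j. Qed.

Lemma peek_runs m code pc i f st c :
  nth_error code pc = Some (IPeek i f) -> i < m -> f (hd_error (st i)) < length code ->
  at_pc m pc st c ->
  exists c', runs (machine m code) (3 * (tlen m st + 2)) c c' /\ at_pc m (f (hd_error (st i))) st c'.
Proof.
  intros Hi Him Hf [j ->].
  assert (Hpc : pc < length code) by (apply nth_error_Some; congruence).
  destruct (regs_split m st i Him) as (A & B & HA & HB & HAB).
  specialize (HAB (st i)). rewrite upd_same in HAB.
  unfold tlen. rewrite HAB, tape_app.
  set (T := tape (st i :: B) ++ repeat None j).
  eexists; split.
  - rewrite <- app_assoc. fold T. unfold home. eapply runs_weaken.
    + eapply runs_step; [apply step_right; lk; rewrite Hi; reflexivity|]. simpl tl.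
      eapply runs_trans; [replace i with (length A + 0) at 1 by lia; apply seek_tape; lia|].
      eapply runs_step; [apply step_turn; lk; rewrite Hi; reflexivity|].
      replace (hd None T) with (hd_error (st i))
        by (unfold T, tape; simpl; unfold blk; destruct (st i); reflexivity).
      apply back_home with (Z := rev (tape A)); [lia| |lia].
      rewrite blanks_rev, blanks_tape; assumption.
    + rewrite length_rev, !length_app. lia.
  - exists j. rewrite rev_involutive, HAB, tape_app, <- app_assoc. fold T.
    assert (HT : hd_error (st i) :: tl T = T)
      by (unfold T, tape; simpl; unfold blk; destruct (st i); reflexivity).
    rewrite HT. reflexivity.
Qed.

Lemma del_runs m code pc i next st c a l :
  nth_error code pc = Some (IDel i next) -> i < m -> next < length code ->
  st i = a :: l -> at_pc m pc st c ->
  exists c', runs (machine m code) (3 * (tlen m st + 2)) c c' /\ at_pc m next (upd st i l) c'.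
Proof.
  intros Hi Him Hn Ha [j ->].
  assert (Hpc : pc < length code) by (apply nth_error_Some; congruence).
  destruct (regs_split m st i Him) as (A & B & HA & HB & HAB).
  pose proof (HAB (st i)) as HR. rewrite upd_same in HR.
  assert (Hm : length (regs m st) = m) by apply regs_length.
  set (X := map Some l ++ None :: tape B).
  assert (HX : tape (regs m st) = tape A ++ Some a :: X).
  { rewrite HR, tape_app. unfold X. f_equal. rewrite Ha. unfold tape, blk; simpl.
    now rewrite <- app_assoc. }
  assert (HbX : blanks X = m - i).
  { unfold X. rewrite blanks_app, blanks_word, blanks_cons_none, blanks_tape. lia. }
  unfold home. eexists; split.
  - eapply runs_weaken.
    + eapply runs_step; [apply step_right; lk; rewrite Hi; reflexivity|]. simpl tl.
      eapply runs_trans; [replace m with (length (regs m st) + 0) at 2 by lia; apply seek_tape; lia|].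
      eapply runs_step; [apply step_turn; lk; rewrite Hi; reflexivity|].
      rewrite hd_repeat, repeat_tl.
      replace (rev (tape (regs m st)) ++ [None]) with
        ((rev X ++ [Some a]) ++ rev (tape A) ++ [None])
        by (rewrite HX, rev_app_distr; simpl; now rewrite <- !app_assoc).
      eapply runs_trans.
      { replace (m - i) with (blanks (rev X ++ [Some a]) + 0)
          by (rewrite blanks_app, blanks_rev; unfold blanks at 2; simpl; lia).
        apply shift_left with (Y := None :: rev X) (c' := Some a); [lia| |reflexivity].
        rewrite blanks_app, blanks_rev; unfold blanks at 2; simpl; lia. }
      (* The cell before register [i] is blank in every case: the end of the preceding register, or
         the home cell if [i] is 0. *)
      assert (HZ : exists Z', rev (tape A) ++ [None] = None :: Z').
      { destruct A as [|A0 A1] using rev_ind; [exists []; reflexivity|].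
        rewrite tape_app, rev_app_distr. unfold tape at 1, blk; simpl.
        rewrite app_nil_r, rev_app_distr. simpl. eexists; reflexivity. }
      destruct HZ as [Z' HZ].
      eapply runs_step.
      { apply step_stay_b. rewrite HZ. simpl. lk. rewrite Hi. reflexivity. }
      rewrite HZ. simpl tl. rewrite <- HZ.
      apply back_home with (Z := rev (tape A)); [lia| |lia].
      rewrite blanks_rev, blanks_tape; assumption.
    + unfold tlen. rewrite HX, length_app, length_rev, length_app. simpl.
      rewrite length_rev. lia.
  (* After the registers come the cell vacated by the shift, the cell on which the head turned, and
     the [j - 1] blanks beyond it; for [j = 0] the turning cell had not been listed before. *)
  - exists (S (S (j - 1))). rewrite HAB, tape_app, rev_involutive. simpl.
    rewrite rev_involutive, <- !app_assoc. unfold X, home. do 2 f_equal.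
    f_equal. unfold tape at 2; simpl. unfold blk. fold (tape B).
    now rewrite <- !app_assoc.
Qed.

Lemma step_stay M q q' b L T :
  tm_lookup M q (hd None T) = Some (q', b, MStay) ->
  step M (cfg q L T) = Some (bcfg q' (b :: L) (tl T)).
Proof. cfg_cases; destruct T as [|x r]; simpl; intros ->; reflexivity. Qed.

Lemma seek_end m code pc i s next w L T : pc < length code ->
  nth_error code pc = Some (IApp i s next) ->
  runs (machine m code) (length w)
    (cfg (key_nat (1, pc, 0, None)) L (map Some w ++ T))
    (cfg (key_nat (1, pc, 0, None)) (rev (map Some w) ++ L) T).
Proof.
  intros Hpc Hi; revert L; induction w as [|a w IH]; intros L; simpl; [constructor|].
  eapply runs_step; [apply step_right; lk; rewrite Hi; reflexivity|].
  simpl. rewrite <- app_assoc. apply IH.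
Qed.

(** The cells shifted by an append start with the overwritten blank. The last cell carried is again
    a blank, so the final register stays terminated. *)
Lemma tape_ends B : exists Y, None :: tape B = Y ++ [None].
Proof.
  destruct B as [|r B] using rev_ind; [exists []; reflexivity|].
  exists (None :: tape B ++ map Some r). rewrite tape_app. unfold tape at 2, blk; simpl.
  now rewrite app_nil_r, app_assoc.
Qed.

Lemma tape_cons r B : tape (r :: B) = map Some r ++ None :: tape B.
Proof. unfold tape, blk; simpl. now rewrite <- app_assoc. Qed.

Lemma app_runs m code pc i s next st c :
  nth_error code pc = Some (IApp i s next) -> i < m -> next < length code ->
  at_pc m pc st c ->
  exists c', runs (machine m code) (3 * (tlen m st + 2)) c c' /\ at_pc m next (upd st i (st i ++ [s])) c'.
Proof.
  intros Hi Him Hn [j ->].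
  assert (Hpc : pc < length code) by (apply nth_error_Some; congruence).
  destruct (regs_split m st i Him) as (A & B & HA & HB & HAB).
  pose proof (HAB (st i)) as HR. rewrite upd_same in HR.
  destruct (tape_ends B) as [Y HY].
  set (Z := None :: rev Y ++ Some s :: rev (map Some (st i)) ++ rev (tape A)).
  assert (HZ : rev Z = tape (A ++ (st i ++ [s]) :: B)).
  { unfold Z. simpl. rewrite !rev_app_distr. simpl. rewrite !rev_app_distr, !rev_involutive.
    rewrite tape_app, tape_cons, HY, map_app, <- !app_assoc. reflexivity. }
  unfold home. eexists; split.
  - eapply runs_weaken.
    + eapply runs_step; [apply step_right; lk; rewrite Hi; reflexivity|]. simpl tl.
      rewrite HR, tape_app, <- app_assoc.
      eapply runs_trans; [replace i with (length A + 0) at 1 by lia; apply seek_tape; lia|].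
      rewrite tape_cons, <- app_assoc.
      eapply runs_trans; [eapply seek_end; eassumption|]. simpl app.
      eapply runs_step; [apply step_right; lk; rewrite Hi; reflexivity|]. simpl tl.
      eapply runs_trans.
      { replace (m - 1 - i) with (blanks (tape B) + 0) by (rewrite blanks_tape; lia).
        eapply shift_right; [lia|rewrite blanks_tape; lia|exact HY]. }
      eapply runs_step; [apply step_stay; lk; rewrite hd_repeat, Hi; reflexivity|].
      rewrite repeat_tl.
      replace (None :: rev Y ++ Some s :: rev (map Some (st i)) ++ rev (tape A) ++ [None])
        with (Z ++ [None]) by (unfold Z; simpl; rewrite <- app_assoc; simpl; now rewrite <- app_assoc).
      apply back_home; [lia| |lia].
      rewrite <- blanks_rev, HZ, blanks_tape, length_app. simpl. lia.
    + assert (HL : length Z = length (rev Z)) by now rewrite length_rev.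
      rewrite HL, HZ. unfold tlen. rewrite HR, !tape_app, !tape_cons, !length_app.
      simpl. rewrite !length_map, length_app. simpl. lia.
  - exists (j - 1). rewrite HAB, HZ. reflexivity.
Qed.

Lemma fin_runs m code pc i st c :
  nth_error code pc = Some (IFin i) -> i < m -> at_pc m pc st c ->
  exists c', runs (machine m code) (3 * (tlen m st + 2)) c c' /\
    tm_lookup (machine m code) (c_state c') (c_cur c') = None /\ tm_output c' = st i.
Proof.
  intros Hi Him [j ->].
  assert (Hpc : pc < length code) by (apply nth_error_Some; congruence).
  destruct (regs_split m st i Him) as (A & B & HA & HB & HAB).
  specialize (HAB (st i)). rewrite upd_same in HAB.
  unfold tlen. rewrite HAB, tape_app.
  set (T := tape (st i :: B) ++ repeat None j).
  exists (cfg (key_nat (1, pc, 0, None)) (rev (tape A) ++ [None]) T). repeat split.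
  - rewrite <- app_assoc. fold T. unfold home. eapply runs_weaken.
    + eapply runs_step; [apply step_right; lk; rewrite Hi; reflexivity|]. simpl tl.
      replace i with (length A + 0) at 1 by lia. apply seek_tape; lia.
    + rewrite !length_app. lia.
  - assert (HL : forall L, c_state (cfg (key_nat (1, pc, 0, None)) L T) = key_nat (1, pc, 0, None))
      by (intros L; destruct T; reflexivity).
    rewrite HL. lk. now rewrite Hi.
  - unfold T. rewrite tape_cons, <- app_assoc. clear.
    induction (st i) as [|a w IH]; [reflexivity|].
    destruct w; unfold tm_output in *; simpl in *; f_equal; exact IH.
Qed.

Definition init_store (w : list sym) : store := fun i => match i with 0 => w | _ => [] end.

Lemma tape_init m w : 0 < m -> tape (regs m (init_store w)) = map Some w ++ repeat None m.
Proof.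
  destruct m as [|m]; [lia|]. intros _. unfold regs. simpl seq. simpl map at 1.
  rewrite tape_cons. simpl. do 2 f_equal.
  assert (H : forall n k, 0 < k -> tape (map (init_store w) (seq k n)) = repeat None n).
  { induction n as [|n IH]; intros k Hk; [reflexivity|]. simpl. rewrite tape_cons.
    destruct k; [lia|]. simpl. now rewrite IH by lia. }
  apply H; lia.
Qed.

(** The input followed by blanks is already a register tape, with the word in register 0. The first
    instruction peeks at position [m], beyond the last register: this sweep turns the blanks of the
    empty registers into explicit cells and lists one further cell. *)
Lemma init_runs m code f w : 0 < m ->
  nth_error code 0 = Some (IPeek m f) -> f None < length code ->
  exists c', runs (machine m code) (3 * (length w + m + 2)) (tm_init (machine m code) w) c' /\
    at_pc m (f None) (init_store w) c'.
Proof.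
  intros Hm Hi Hf.
  assert (Hpc : 0 < length code) by (apply nth_error_Some; congruence).
  assert (HI : tm_init (machine m code) w = cfg (key_nat (5, 0, 0, None)) [] (map Some w))
    by (destruct w; reflexivity).
  rewrite HI. eexists; split.
  - eapply runs_weaken.
    + eapply runs_step; [apply step_turn; lk; reflexivity|].
      change (bcfg ?q [] ?T) with (cfg q [] (None :: T)).
      eapply runs_step; [apply step_right; lk; rewrite Hi; reflexivity|]. simpl tl.
      assert (HS : runs (machine m code) (length w + m)
        (cfg (key_nat (1, 0, m, None)) [None] (hd None (map Some w) :: tl (map Some w)))
        (cfg (key_nat (1, 0, 0, None)) (repeat None m ++ rev (map Some w) ++ [None]) [])).
      { destruct m as [|m]; [lia|]. destruct w as [|a w].
        - simpl. eapply runs_step; [apply step_right; lk; reflexivity|]. simpl.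
          replace (None :: repeat None m ++ [None]) with (repeat None m ++ None :: [None] :> list (option sym)).
          + replace m with (m + 0) at 3 by lia. apply seek_blank; lia.
          + clear. induction m; simpl; congruence.
        - change (hd None (map Some (a :: w)) :: tl (map Some (a :: w))) with (map Some (a :: w)).
          eapply runs_trans.
          + rewrite <- (app_nil_r (map Some (a :: w))). apply seek_word; lia.
          + replace (S m) with (S m + 0) at 3 by lia. apply seek_blank; lia. }
      eapply runs_trans; [exact HS|].
      eapply runs_step; [apply step_turn; lk; rewrite Hi; reflexivity|]. simpl.
      rewrite app_assoc. apply back_home; [assumption| |lia].
      rewrite blanks_app, blanks_rev, blanks_word.
      clear. induction m as [|m IH]; [reflexivity|].
      change (blanks (repeat None (S m))) with (S (blanks (repeat None m))). lia.
    + rewrite !length_app, repeat_length, length_rev, length_map. lia.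
  - exists 1. rewrite rev_app_distr, rev_involutive, rev_repeat, tape_init by assumption.
    reflexivity.
Qed.

(** * Structured programs *)

Inductive scmd : Set :=
| SSkip
| SApp (i : nat) (a : sym)
| SDel (i : nat)
| SSeq (c d : scmd)
| SCase (i : nat) (f : option sym -> scmd)
| SLoop (i : nat) (f : sym -> scmd).

Inductive ev : scmd -> store -> nat -> store -> Prop :=
| ev_skip st : ev SSkip st 1 st
| ev_app i a st : ev (SApp i a) st 1 (upd st i (st i ++ [a]))
| ev_del i a l st : st i = a :: l -> ev (SDel i) st 1 (upd st i l)
| ev_seq c d st n st1 n' st' : ev c st n st1 -> ev d st1 n' st' -> ev (SSeq c d) st (n + n') st'
| ev_case i f st n st' : ev (f (hd_error (st i))) st n st' -> ev (SCase i f) st (S n) st'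
| ev_loop_nil i f st : st i = [] -> ev (SLoop i f) st 1 st
| ev_loop_cons i f st a l n st1 n' st' : st i = a :: l -> ev (f a) (upd st i l) n st1 ->
    ev (SLoop i f) st1 n' st' -> ev (SLoop i f) st (2 + n + n') st'.

Fixpoint size (c : scmd) : nat :=
  match c with
  | SSkip | SApp _ _ | SDel _ => 1
  | SSeq c d => size c + size d
  | SCase _ f => 1 + (size (f None) + (size (f (Some S0)) + (size (f (Some S1)) +
      (size (f (Some SL)) + (size (f (Some SN)) + size (f (Some SE)))))))
  | SLoop _ f => 1 + ((1 + size (f S0)) + ((1 + size (f S1)) + ((1 + size (f SL)) +
      ((1 + size (f SN)) + (1 + size (f SE))))))
  end.

(* Code placed at address [pc], continuing at address [ex]. *)
Fixpoint comp (c : scmd) (pc ex : nat) : list instr :=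
  match c with
  | SSkip => [IPeek 0 (fun _ => ex)]
  | SApp i a => [IApp i a ex]
  | SDel i => [IDel i ex]
  | SSeq c d => comp c pc (pc + size c) ++ comp d (pc + size c) ex
  | SCase i f =>
      let p0 := S pc in
      let p1 := p0 + size (f None) in
      let p2 := p1 + size (f (Some S0)) in
      let p3 := p2 + size (f (Some S1)) in
      let p4 := p3 + size (f (Some SL)) in
      let p5 := p4 + size (f (Some SN)) in
      IPeek i (fun o => match o with
                        | None => p0 | Some S0 => p1 | Some S1 => p2
                        | Some SL => p3 | Some SN => p4 | Some SE => p5 end)
      :: comp (f None) p0 ex ++ comp (f (Some S0)) p1 ex ++ comp (f (Some S1)) p2 ex ++
         comp (f (Some SL)) p3 ex ++ comp (f (Some SN)) p4 ex ++ comp (f (Some SE)) p5 ex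
  | SLoop i f =>
      let p1 := S pc in
      let p2 := p1 + S (size (f S0)) in
      let p3 := p2 + S (size (f S1)) in
      let p4 := p3 + S (size (f SL)) in
      let p5 := p4 + S (size (f SN)) in
      IPeek i (fun o => match o with
                        | None => ex | Some S0 => p1 | Some S1 => p2
                        | Some SL => p3 | Some SN => p4 | Some SE => p5 end)
      :: (IDel i (S p1) :: comp (f S0) (S p1) pc) ++ (IDel i (S p2) :: comp (f S1) (S p2) pc) ++
         (IDel i (S p3) :: comp (f SL) (S p3) pc) ++ (IDel i (S p4) :: comp (f SN) (S p4) pc) ++
         (IDel i (S p5) :: comp (f SE) (S p5) pc)
  end.

Lemma comp_length c : forall pc ex, length (comp c pc ex) = size c.
Proof.
  induction c as [| | |c IHc d IHd|i f IH|i f IH]; intros pc ex; try reflexivity.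
  - simpl. now rewrite length_app, IHc, IHd.
  - simpl. rewrite !length_app, !IH. reflexivity.
  - simpl. rewrite !length_app. simpl. rewrite !length_app. simpl.
    rewrite !length_app. simpl. rewrite !length_app. simpl. rewrite !IH. reflexivity.
Qed.

Lemma size_pos c : 0 < size c.
Proof. induction c; simpl; lia. Qed.

Definition placed (C : list instr) (pc : nat) (F : list instr) : Prop :=
  exists A B, C = A ++ F ++ B /\ length A = pc.

Lemma placed_app C pc F G : placed C pc (F ++ G) ->
  placed C pc F /\ placed C (pc + length F) G.
Proof.
  intros (A & B & -> & HA). split.
  - exists A, (G ++ B). now rewrite <- app_assoc.
  - exists (A ++ F), B. rewrite length_app, <- !app_assoc. split; [reflexivity|lia].
Qed.

Lemma placed_cons C pc i F : placed C pc (i :: F) ->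
  nth_error C pc = Some i /\ placed C (S pc) F.
Proof.
  intros H. split.
  - destruct H as (A & B & -> & <-). rewrite nth_error_app2, Nat.sub_diag by lia. reflexivity.
  - apply (placed_app C pc [i] F) in H as [_ H]. rewrite Nat.add_1_r in H. exact H.
Qed.

Lemma placed_comp_lt C pc c q ex : placed C pc (comp c q ex) -> pc < length C.
Proof.
  intros (A & B & -> & <-). rewrite !length_app, comp_length. pose proof (size_pos c). lia.
Qed.

Fixpoint regs_ok (m : nat) (c : scmd) : Prop :=
  match c with
  | SSkip => True
  | SApp i _ | SDel i => i < m
  | SSeq c d => regs_ok m c /\ regs_ok m d
  | SCase i f => i < m /\ forall o, regs_ok m (f o)
  | SLoop i f => i < m /\ forall a, regs_ok m (f a)
  end.

Lemma tlen_upd m st i v : i < m -> tlen m (upd st i v) + length (st i) = tlen m st + length v.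
Proof.
  intros Hi. destruct (regs_split m st i Hi) as (A & B & _ & _ & H).
  pose proof (H (st i)) as H0. rewrite upd_same in H0.
  unfold tlen. rewrite H, H0, !tape_app, !tape_cons, !length_app. simpl.
  rewrite !length_map. simpl. lia.
Qed.

Lemma placed_case C pc i f ex : placed C pc (comp (SCase i f) pc ex) ->
  exists g, nth_error C pc = Some (IPeek i g) /\ forall o, placed C (g o) (comp (f o) (g o) ex).
Proof.
  intros H. simpl in H. apply placed_cons in H as [H1 H].
  eexists; split; [exact H1|].
  repeat (apply placed_app in H as [? H]; rewrite comp_length in H).
  intros [[]|]; assumption.
Qed.

Lemma placed_loop C pc i f ex : placed C pc (comp (SLoop i f) pc ex) ->
  exists g, nth_error C pc = Some (IPeek i g) /\ g None = ex /\
    forall a, nth_error C (g (Some a)) = Some (IDel i (S (g (Some a)))) /\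
      placed C (S (g (Some a))) (comp (f a) (S (g (Some a))) pc).
Proof.
  intros H. cbn [comp] in H. apply placed_cons in H as [H1 H].
  eexists; split; [exact H1|]. split; [reflexivity|].
  repeat (apply placed_app in H as [? H]; cbn [length] in H; rewrite comp_length in H).
  intros []; apply placed_cons; assumption.
Qed.

(** Cost and tape growth are bounded together: a program of cost [n] adds at most [n] cells, so each
    of its instructions sweeps a tape of at most [tlen m st + n] cells, and the simulation is
    quadratic. A loop round costs 2 for its peek and its deletion. *)
Lemma ev_runs m C c st n st' : ev c st n st' ->
  forall pc ex cf, 0 < m -> regs_ok m c -> placed C pc (comp c pc ex) -> ex < length C ->
  at_pc m pc st cf ->
  tlen m st' <= tlen m st + n /\
  exists cf', runs (machine m C) (n * (3 * (tlen m st + n + 2))) cf cf' /\ at_pc m ex st' cf'.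
Proof.
  induction 1 as [st|i a st|i a l st Ha|c d st n st1 n' st' _ IHc _ IHd
    |i f st n st' _ IH|i f st Hn|i f st a l n st1 n' st' Ha _ IH1 _ IH2];
    intros pc ex cf Hm Hok Hp Hex Hcf.
  - simpl in Hp. apply placed_cons in Hp as [Hp _]. split; [lia|].
    destruct (peek_runs m C pc 0 (fun _ => ex) st cf Hp Hm Hex Hcf) as (cf' & H1 & H2).
    exists cf'; split; [eapply runs_weaken; [exact H1|lia]|exact H2].
  - simpl in Hp. apply placed_cons in Hp as [Hp _]. simpl in Hok. split.
    + pose proof (tlen_upd m st i (st i ++ [a]) Hok) as H. rewrite length_app in H. simpl in H. lia.
    + destruct (app_runs m C pc i a ex st cf Hp Hok Hex Hcf) as (cf' & H1 & H2).
      exists cf'; split; [eapply runs_weaken; [exact H1|lia]|exact H2].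
  - simpl in Hp. apply placed_cons in Hp as [Hp _]. simpl in Hok. split.
    + pose proof (tlen_upd m st i l Hok) as H. rewrite Ha in H. simpl in H. lia.
    + destruct (del_runs m C pc i ex st cf a l Hp Hok Hex Ha Hcf) as (cf' & H1 & H2).
      exists cf'; split; [eapply runs_weaken; [exact H1|lia]|exact H2].
  - simpl in Hp, Hok. apply placed_app in Hp as [Hp1 Hp2]. rewrite comp_length in Hp2.
    destruct Hok as [Hok1 Hok2].
    destruct (IHc pc (pc + size c) cf Hm Hok1 Hp1 (placed_comp_lt _ _ _ _ _ Hp2) Hcf)
      as (L1 & cf1 & R1 & A1).
    destruct (IHd _ ex cf1 Hm Hok2 Hp2 Hex A1) as (L2 & cf2 & R2 & A2).
    split; [lia|]. exists cf2; split; [|exact A2].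
    eapply runs_trans_le; [exact R1|exact R2|nia].
  - destruct (placed_case _ _ _ _ _ Hp) as (g & H1 & H2). simpl in Hok. destruct Hok as [Hi Hok].
    specialize (H2 (hd_error (st i))).
    destruct (peek_runs m C pc i g st cf H1 Hi (placed_comp_lt _ _ _ _ _ H2) Hcf) as (cf1 & R1 & A1).
    destruct (IH _ ex cf1 Hm (Hok _) H2 Hex A1) as (L2 & cf2 & R2 & A2).
    split; [lia|]. exists cf2; split; [|exact A2].
    eapply runs_trans_le; [exact R1|exact R2|nia].
  - destruct (placed_loop _ _ _ _ _ Hp) as (g & H1 & H2 & _). destruct Hok as [Hi _].
    split; [lia|].
    assert (Hg : g (hd_error (st i)) = ex) by (rewrite Hn; exact H2).
    destruct (peek_runs m C pc i g st cf H1 Hi) as (cf1 & R1 & A1);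
      [rewrite Hg; assumption|assumption|].
    rewrite Hg in A1.
    exists cf1; split; [eapply runs_weaken; [exact R1|lia]|exact A1].
  - destruct (placed_loop _ _ _ _ _ Hp) as (g & H1 & H2 & H3). destruct Hok as [Hi Hok].
    destruct (H3 a) as [H4 H5].
    assert (Hg : g (hd_error (st i)) = g (Some a)) by (now rewrite Ha).
    destruct (peek_runs m C pc i g st cf H1 Hi) as (cf1 & R1 & A1);
      [rewrite Hg; apply nth_error_Some; congruence|assumption|].
    rewrite Hg in A1.
    assert (Hpc : pc < length C) by (apply nth_error_Some; congruence).
    destruct (del_runs m C _ i _ st cf1 a l H4 Hi (placed_comp_lt _ _ _ _ _ H5) Ha A1)
      as (cf2 & R2 & A2).
    pose proof (tlen_upd m st i l Hi) as HL. rewrite Ha in HL. simpl in HL.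
    destruct (IH1 _ pc cf2 Hm (Hok a) H5 Hpc A2) as (L3 & cf3 & R3 & A3).
    destruct (IH2 pc ex cf3 Hm (conj Hi Hok) Hp Hex A3) as (L4 & cf4 & R4 & A4).
    split; [lia|]. exists cf4; split; [|exact A4].
    eapply runs_trans_le; [exact R1|eapply runs_trans; [exact R2|eapply runs_trans; [exact R3|exact R4]]|].
    nia.
Qed.

(** In [n + 2] the two extra sweeps are the initial one and the final search for the output
    register. *)
Lemma scmd_machine (c : scmd) (m r : nat) : 0 < m -> r < m -> regs_ok m c ->
  exists M, forall w n st', ev c (init_store w) n st' ->
    forall k, (n + 2) * (6 * (length w + m + n + 2)) <= k ->
    exists cf, tm_exec M k (tm_init M w) = Some cf /\ tm_output cf = st' r.
Proof.
  intros Hm Hr Hok.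
  set (C := IPeek m (fun _ => 1) :: comp c 1 (1 + size c) ++ [IFin r]).
  exists (machine m C). intros w n st' Hev k Hk.
  assert (HL : length C = 2 + size c)
    by (unfold C; simpl; rewrite length_app, comp_length; simpl; lia).
  pose proof (size_pos c).
  assert (HP : placed C 1 (comp c 1 (1 + size c))).
  { exists [IPeek m (fun _ => 1)], [IFin r]. split; reflexivity. }
  assert (HF : nth_error C (1 + size c) = Some (IFin r)).
  { unfold C. simpl. rewrite nth_error_app2; rewrite comp_length; [|lia].
    now rewrite Nat.sub_diag. }
  assert (H1 : 1 < length C) by lia.
  destruct (init_runs m C (fun _ => 1) w Hm eq_refl H1) as (c1 & R1 & A1).
  destruct (ev_runs m C c _ _ _ Hev 1 (1 + size c) c1 Hm Hok HP ltac:(lia) A1) as (L2 & c2 & R2 & A2).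
  destruct (fin_runs m C _ r st' c2 HF Hr A2) as (c3 & R3 & H3 & H4).
  exists c3; split; [|exact H4].
  assert (HT : tlen m (init_store w) = length w + m)
    by (unfold tlen; rewrite tape_init, length_app, length_map, repeat_length by assumption; lia).
  eapply runs_exec; [eapply runs_trans; [exact R1|eapply runs_trans; [exact R2|exact R3]]|exact H3|].
  rewrite HT in *. nia.
Qed.

(** * Polynomial-time register programs *)

(* Register 0 holds the input and is never written, register 1 collects the
   output, register 2 is scratch space for copying.  The other registers never
   get longer than the input, which keeps every program polynomial. *)
Inductive rcmd : Set :=
| RSkip
| ROut (l : list sym)
| RPop (r : nat)
| RClear (r : nat)
| RCopy (r s : nat)
| RCase (r : nat) (f : option sym -> rcmd)
| RSeq (c d : rcmd)
| RRep (k : nat) (c : rcmd).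

(** A repetition runs once per symbol of the input: [k] is loaded with register 0 and loses a symbol
    before each round, so a body that keeps [k] cannot prolong the loop. *)
Fixpoint rep (F : store -> store) (k : nat) (l : list sym) (st : store) : store :=
  match l with
  | [] => upd st k []
  | _ :: l' => rep F k l' (F (upd st k l'))
  end.

Fixpoint run (c : rcmd) (st : store) : store :=
  match c with
  | RSkip => st
  | ROut l => upd st 1 (st 1 ++ l)
  | RPop r => upd st r (tl (st r))
  | RClear r => upd st r []
  | RCopy r s => upd st r (st s)
  | RCase r f => run (f (hd_error (st r))) st
  | RSeq c d => run d (run c st)
  | RRep k c => rep (run c) k (st 0) st
  end.

Fixpoint keeps (k : nat) (c : rcmd) : Prop :=
  match c with
  | RSkip => True
  | ROut _ => k <> 1
  | RPop r | RClear r | RCopy r _ => r <> k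
  | RCase r f => forall o, keeps k (f o)
  | RSeq c d => keeps k c /\ keeps k d
  | RRep k' c => k' <> k /\ keeps k c
  end.

Fixpoint rok (m : nat) (c : rcmd) : Prop :=
  match c with
  | RSkip | ROut _ => True
  | RPop r | RClear r => 2 < r < m
  | RCopy r s => 2 < r < m /\ s < m /\ s <> 1 /\ s <> 2 /\ s <> r
  | RCase r f => r < m /\ forall o, rok m (f o)
  | RSeq c d => rok m c /\ rok m d
  | RRep k c => 2 < k < m /\ keeps k c /\ rok m c
  end.

Definition out_cmd (l : list sym) : scmd := fold_right (fun a c => SSeq (SApp 1 a) c) SSkip l.

Definition clear_cmd (r : nat) : scmd := SLoop r (fun _ => SSkip).

(** A queue is read by emptying it. The source is therefore moved into the target and the scratch
    register at once and then restored from the latter. *)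
Definition copy_cmd (r s : nat) : scmd :=
  SSeq (clear_cmd r)
    (SSeq (SLoop s (fun a => SSeq (SApp r a) (SApp 2 a))) (SLoop 2 (fun a => SApp s a))).

Fixpoint to_scmd (c : rcmd) : scmd :=
  match c with
  | RSkip => SSkip
  | ROut l => out_cmd l
  | RPop r => SCase r (fun o => match o with None => SSkip | Some _ => SDel r end)
  | RClear r => clear_cmd r
  | RCopy r s => copy_cmd r s
  | RCase r f => SCase r (fun o => to_scmd (f o))
  | RSeq c d => SSeq (to_scmd c) (to_scmd d)
  | RRep k c => SSeq (copy_cmd k 0) (SLoop k (fun _ => to_scmd c))
  end.

(** [N] bounds every register but the output. A copy costs 3 per symbol cleared, 4 per symbol moved
    and 3 per symbol restored. Branches are added up rather than maximised, which keeps the bound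
    visibly polynomial. *)
Fixpoint cost (c : rcmd) (N : nat) : nat :=
  match c with
  | RSkip => 1
  | ROut l => length l + 1
  | RPop _ => 2
  | RClear _ => 3 * N + 1
  | RCopy _ _ => 10 * N + 3
  | RCase _ f => 1 + (cost (f None) N + cost (f (Some S0)) N + cost (f (Some S1)) N +
      cost (f (Some SL)) N + cost (f (Some SN)) N + cost (f (Some SE)) N)
  | RSeq c d => cost c N + cost d N
  | RRep _ c => (10 * N + 3) + (N * (2 + cost c N) + 1)
  end.

Ltac store_eq :=
  apply functional_extensionality; let j := fresh "j" in intros j; unfold upd;
  repeat match goal with |- context [Nat.eqb ?a ?b] => destruct (Nat.eqb_spec a b) end;
  subst; simpl; try congruence; try lia.

Ltac upd_simpl :=
  repeat match goal with
  | |- context [upd ?st ?i ?v ?i] => rewrite (upd_eq st i v)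
  | |- context [upd ?st ?i ?v ?j] => rewrite (upd_ne st i j v) by (congruence || lia)
  end.

Lemma ev_out l : forall st, ev (out_cmd l) st (length l + 1) (upd st 1 (st 1 ++ l)).
Proof.
  induction l as [|a l IH]; intros st; simpl.
  - rewrite app_nil_r, upd_same. constructor.
  - change (S (length l + 1)) with (1 + (length l + 1)).
    eapply ev_seq; [constructor|].
    specialize (IH (upd st 1 (st 1 ++ [a]))).
    rewrite upd_upd, upd_eq, <- app_assoc in IH. exact IH.
Qed.

Lemma ev_clear r : forall st, ev (clear_cmd r) st (3 * length (st r) + 1) (upd st r []).
Proof.
  intros st. remember (st r) as l eqn:Hl. revert st Hl.
  induction l as [|a l IH]; intros st Hl; simpl length.
  - replace (upd st r []) with st by (rewrite Hl; symmetry; apply upd_same).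
    apply ev_loop_nil; auto.
  - replace (3 * S (length l) + 1) with (2 + 1 + (3 * length l + 1)) by lia.
    eapply ev_loop_cons; [symmetry; exact Hl|constructor|].
    specialize (IH (upd st r l)). rewrite upd_upd, upd_eq in IH. now apply IH.
Qed.

Lemma ev_dup r s : r <> s -> r <> 2 -> s <> 2 -> forall st,
  ev (SLoop s (fun a => SSeq (SApp r a) (SApp 2 a))) st (4 * length (st s) + 1)
    (upd (upd (upd st s []) r (st r ++ st s)) 2 (st 2 ++ st s)).
Proof.
  intros H1 H2 H3 st. remember (st s) as l eqn:Hl. revert st Hl.
  induction l as [|a l IH]; intros st Hl; simpl length.
  - replace (upd (upd (upd st s []) r (st r ++ [])) 2 (st 2 ++ [])) with st.
    + apply ev_loop_nil; auto.
    + rewrite !app_nil_r. store_eq.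
  - replace (4 * S (length l) + 1) with (2 + (1 + 1) + (4 * length l + 1)) by lia.
    eapply ev_loop_cons; [symmetry; exact Hl|eapply ev_seq; constructor|].
    set (st1 := upd _ 2 _).
    assert (Hs : st1 s = l).
    { unfold st1. rewrite upd_ne, upd_ne, upd_eq by congruence. reflexivity. }
    specialize (IH st1 (eq_sym Hs)).
    replace (upd (upd (upd st s []) r (st r ++ a :: l)) 2 (st 2 ++ a :: l))
      with (upd (upd (upd st1 s []) r (st1 r ++ l)) 2 (st1 2 ++ l)); [exact IH|].
    unfold st1. upd_simpl.
    clear IH Hs st1. rewrite <- !app_assoc. store_eq.
Qed.

Lemma ev_unload s : s <> 2 -> forall st,
  ev (SLoop 2 (fun a => SApp s a)) st (3 * length (st 2) + 1)
    (upd (upd st 2 []) s (st s ++ st 2)).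
Proof.
  intros H1 st. remember (st 2) as l eqn:Hl. revert st Hl.
  induction l as [|a l IH]; intros st Hl; simpl length.
  - replace (upd (upd st 2 []) s (st s ++ [])) with st.
    + apply ev_loop_nil; auto.
    + rewrite app_nil_r. store_eq.
  - replace (3 * S (length l) + 1) with (2 + 1 + (3 * length l + 1)) by lia.
    eapply ev_loop_cons; [symmetry; exact Hl|constructor|].
    set (st1 := upd _ s _).
    assert (Hs : st1 2 = l).
    { unfold st1. rewrite upd_ne, upd_eq by congruence. reflexivity. }
    specialize (IH st1 (eq_sym Hs)).
    replace (upd (upd st 2 []) s (st s ++ a :: l))
      with (upd (upd st1 2 []) s (st1 s ++ l)); [exact IH|].
    unfold st1. upd_simpl.
    clear IH Hs st1. rewrite <- !app_assoc. store_eq.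
Qed.

Lemma ev_copy r s st : r <> s -> r <> 2 -> s <> 2 -> st 2 = [] ->
  ev (copy_cmd r s) st (3 * length (st r) + 7 * length (st s) + 3) (upd st r (st s)).
Proof.
  intros H1 H2 H3 H4.
  replace (3 * length (st r) + 7 * length (st s) + 3) with
    ((3 * length (st r) + 1) + ((4 * length (st s) + 1) + (3 * length (st s) + 1))) by lia.
  eapply ev_seq; [apply ev_clear|].
  pose proof (ev_dup r s H1 H2 H3 (upd st r [])) as HD.
  rewrite upd_eq, (upd_ne st r s), (upd_ne st r 2) in HD by congruence.
  eapply ev_seq; [exact HD|]. rewrite H4. simpl app.
  set (st1 := upd _ 2 _).
  pose proof (ev_unload s H3 st1) as HU.
  assert (Hs2 : st1 2 = st s) by (unfold st1; apply upd_eq).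
  assert (Hss : st1 s = []).
  { unfold st1. upd_simpl. reflexivity. }
  rewrite Hs2, Hss in HU. simpl app in HU.
  replace (upd st r (st s)) with (upd (upd st1 2 []) s (st s)); [exact HU|].
  unfold st1. clear HU Hs2 Hss st1 HD. store_eq.
Qed.

Lemma run_keeps k c : keeps k c -> forall st, run c st k = st k.
Proof.
  induction c as [| | | | |r f IH|c IHc d IHd|k' c IH]; simpl; intros H st;
    try (rewrite upd_ne by congruence); auto.
  - destruct H. now rewrite IHd, IHc.
  - destruct H as [H1 H2]. generalize (st 0). intros l; revert st.
    induction l as [|a l IHl]; intros st; simpl.
    + now rewrite upd_ne by congruence.
    + rewrite IHl, IH by assumption. now rewrite upd_ne by congruence.
Qed.

(** Register 1 is exempt: the output may outgrow the input, but [rok] forbids copying it, so no cost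
    depends on its length. *)
Definition bounded (N : nat) (st : store) : Prop :=
  st 2 = [] /\ forall r, r <> 1 -> length (st r) <= N.

Lemma bounded_upd N st r v : bounded N st -> 2 < r -> length v <= N -> bounded N (upd st r v).
Proof.
  intros [H1 H2] Hr Hv. split.
  - rewrite upd_ne by lia. exact H1.
  - intros j Hj. unfold upd. destruct (Nat.eqb_spec j r); auto.
Qed.

Lemma length_tl (A : Type) (l : list A) : length (tl l) <= length l.
Proof. destruct l; simpl; lia. Qed.

Lemma cost_case f o N : cost (f o) N < cost (RCase 0 f) N.
Proof. simpl. destruct o as [[]|]; lia. Qed.

Lemma run_ev m N c : rok m c -> forall st, bounded N st ->
  bounded N (run c st) /\ exists n, n <= cost c N /\ ev (to_scmd c) st n (run c st).
Proof.
  induction c as [|l|r|r|r s|r f IH|c IHc d IHd|k c IH]; intros Hok st HB.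
  - split; [exact HB|]. exists 1. split; [simpl; lia|constructor].
  - split.
    + destruct HB as [H1 H2]. split.
      * simpl. rewrite upd_ne by lia. exact H1.
      * intros j Hj. simpl. rewrite upd_ne by lia. now apply H2.
    + exists (length l + 1). split; [simpl; lia|apply ev_out].
  - simpl in Hok. split.
    + apply bounded_upd; [assumption|lia|]. etransitivity; [apply length_tl|].
      apply HB. lia.
    + simpl. destruct (st r) as [|a l] eqn:E.
      * exists 2. split; [lia|]. replace (upd st r (tl [])) with st by (simpl; rewrite <- E; symmetry; apply upd_same).
        apply ev_case. rewrite E. constructor.
      * exists 2. split; [lia|]. apply ev_case. rewrite E. simpl. now apply ev_del with (a := a).
  - simpl in Hok. split.
    + apply bounded_upd; [assumption|lia|simpl; lia].
    + eexists. split; [|apply ev_clear]. pose proof (proj2 HB r ltac:(lia)). simpl. lia.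
  - simpl in Hok. split.
    + apply bounded_upd; [assumption|lia|]. apply HB. lia.
    + eexists. split; [|apply ev_copy; try lia; apply HB].
      pose proof (proj2 HB r ltac:(lia)). pose proof (proj2 HB s ltac:(lia)). simpl. lia.
  - destruct Hok as [Hr Hok]. simpl run. destruct (IH (hd_error (st r)) (Hok _) st HB) as [H1 (n & Hn & H2)].
    split; [exact H1|]. exists (S n). split; [|now apply ev_case].
    pose proof (cost_case f (hd_error (st r)) N). simpl in *. lia.
  - destruct Hok as [Hc Hd]. destruct (IHc Hc st HB) as [B1 (n1 & L1 & E1)].
    destruct (IHd Hd _ B1) as [B2 (n2 & L2 & E2)].
    split; [exact B2|]. exists (n1 + n2). split; [simpl; lia|]. eapply ev_seq; eassumption.
  - destruct Hok as (Hk & HK & Hok).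
    assert (HL : forall l st, bounded N st -> length l <= N ->
      bounded N (rep (run c) k l st) /\
      exists n, n <= length l * (2 + cost c N) + 1 /\
        ev (SLoop k (fun _ => to_scmd c)) (upd st k l) n (rep (run c) k l st)).
    { clear st HB. induction l as [|a l IHl]; intros st HB Hl; simpl in Hl.
      - simpl. split; [apply bounded_upd; [assumption|lia|simpl; lia]|].
        exists 1. split; [lia|]. apply ev_loop_nil, upd_eq.
      - simpl. assert (B0 : bounded N (upd st k l)) by (apply bounded_upd; [assumption|lia|lia]).
        destruct (IH Hok _ B0) as [B1 (n1 & L1 & E1)].
        destruct (IHl _ B1 ltac:(lia)) as [B2 (n2 & L2 & E2)].
        split; [exact B2|]. exists (2 + n1 + n2). split; [lia|].
        eapply ev_loop_cons; [apply upd_eq|rewrite upd_upd; exact E1|].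
        (* The body keeps [k], so after the round the counter still holds [l], and the induction
           hypothesis speaks of the actual store. *)
        assert (HE : upd (run c (upd st k l)) k l = run c (upd st k l)).
        { rewrite <- (upd_same (run c (upd st k l)) k) at 2. f_equal.
          rewrite run_keeps by assumption. symmetry; apply upd_eq. }
        rewrite HE in E2. exact E2. }
    destruct (HL (st 0) st HB) as [B1 (n1 & L1 & E1)]; [apply HB; lia|].
    split; [exact B1|].
    exists ((3 * length (st k) + 7 * length (st 0) + 3) + n1). split.
    + pose proof (proj2 HB k ltac:(lia)). pose proof (proj2 HB 0 ltac:(lia)).
      simpl cost. nia.
    + simpl. eapply ev_seq; [apply ev_copy; try lia; apply HB|exact E1].
Qed.

Lemma rok_regs m c : 2 < m -> rok m c -> regs_ok m (to_scmd c).
Proof.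
  intros Hm. induction c as [|l|r|r|r s|r f IH|c IHc d IHd|k c IH]; simpl; intros H.
  - exact I.
  - induction l; simpl; [exact I|]. split; [lia|assumption].
  - split; [lia|]. intros [a|]; simpl; lia.
  - split; [lia|]. intros; exact I.
  - repeat split; try lia; intros; simpl; lia.
  - destruct H as [H1 H2]. split; [assumption|]. auto.
  - destruct H; auto.
  - destruct H as (H1 & H2 & H3). repeat split; try lia; intros; simpl; try lia; auto.
Qed.

Lemma pow_le_mono N a b : a <= b -> (N + 1) ^ a <= (N + 1) ^ b.
Proof. intros; apply Nat.pow_le_mono_r; lia. Qed.

Lemma poly_add (f g : nat -> nat) :
  (exists K d, forall N, f N <= K * (N + 1) ^ d) -> (exists K d, forall N, g N <= K * (N + 1) ^ d) ->
  exists K d, forall N, f N + g N <= K * (N + 1) ^ d.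
Proof.
  intros (K1 & d1 & H1) (K2 & d2 & H2). exists (K1 + K2), (max d1 d2). intros N.
  specialize (H1 N); specialize (H2 N).
  pose proof (pow_le_mono N d1 (max d1 d2) ltac:(lia)).
  pose proof (pow_le_mono N d2 (max d1 d2) ltac:(lia)). nia.
Qed.

Lemma poly_mul (f g : nat -> nat) :
  (exists K d, forall N, f N <= K * (N + 1) ^ d) -> (exists K d, forall N, g N <= K * (N + 1) ^ d) ->
  exists K d, forall N, f N * g N <= K * (N + 1) ^ d.
Proof.
  intros (K1 & d1 & H1) (K2 & d2 & H2). exists (K1 * K2), (d1 + d2). intros N.
  specialize (H1 N); specialize (H2 N). rewrite Nat.pow_add_r.
  pose proof (Nat.mul_le_mono _ _ _ _ H1 H2). nia.
Qed.

Lemma poly_const k : exists K d, forall N, k <= K * (N + 1) ^ d.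
Proof. exists k, 0. intros; simpl; lia. Qed.

Lemma poly_id : exists K d, forall N, N <= K * (N + 1) ^ d.
Proof. exists 1, 1. intros; simpl; lia. Qed.

Lemma cost_poly c : exists K d, forall N, cost c N <= K * (N + 1) ^ d.
Proof.
  induction c as [|l|r|r|r s|r f IH|c IHc d IHd|k c IH]; cbn [cost];
    repeat (apply poly_add || apply poly_mul || apply poly_id || apply poly_const);
    auto using poly_const, poly_id.
Qed.

(** [N + 1] is at most twice [N] when [N] is positive, whence the factor [2 ^ d]; for the empty
    input the additive constant takes over. *)
Lemma poly_monomial (f : nat -> nat) : (exists K d, forall N, f N <= K * (N + 1) ^ d) ->
  exists k d, forall N, f N <= k * N ^ d + k.
Proof.
  intros (K & d & H). exists (K * 2 ^ d), d. intros N. etransitivity; [apply H|].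
  destruct N as [|N].
  - simpl. rewrite Nat.pow_1_l. pose proof (Nat.pow_nonzero 2 d). nia.
  - assert (HP : (S N + 1) ^ d <= (2 * S N) ^ d) by (apply Nat.pow_le_mono_l; lia).
    rewrite Nat.pow_mul_l in HP. nia.
Qed.

Lemma rcmd_machine (c : rcmd) (m : nat) : 2 < m -> rok m c ->
  exists (M : TM) (k d : nat), forall w, exists cf,
    tm_exec M (k * length w ^ d + k) (tm_init M w) = Some cf /\
    tm_output cf = run c (init_store w) 1.
Proof.
  intros Hm Hok.
  destruct (scmd_machine (to_scmd c) m 1 ltac:(lia) ltac:(lia) (rok_regs m c Hm Hok)) as [M HM].
  destruct (poly_monomial (fun N => (cost c N + 2) * (6 * (N + m + cost c N + 2)))) as (k & d & Hkd).
  { repeat (apply poly_add || apply poly_mul || apply poly_id || apply poly_const || apply cost_poly). }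
  exists M, k, d. intros w.
  assert (HB : bounded (length w) (init_store w)).
  { split; [reflexivity|]. intros [|r] _; simpl; lia. }
  destruct (run_ev m (length w) c Hok _ HB) as [_ (n & Hn & He)].
  apply (HM w n _ He). specialize (Hkd (length w)). cbv beta in Hkd. nia.
Qed.

(** * Tree grammars *)

Fixpoint pbits (p : positive) : list bool :=
  match p with
  | xH => [true]
  | xO q => pbits q ++ [false]
  | xI q => pbits q ++ [true]
  end.

Definition bits (n : nat) : list bool := match n with 0 => [] | _ => pbits (Pos.of_nat n) end.

Definition b2s (b : bool) : sym := if b then S1 else S0.

Definition bval (l : list bool) : nat := fold_left (fun n b => 2 * n + Nat.b2n b) l 0.

Lemma bval_snoc l b : bval (l ++ [b]) = 2 * bval l + Nat.b2n b.
Proof. unfold bval. now rewrite fold_left_app. Qed.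

Lemma bin_nat_bits n : bin_nat n = map b2s (bits n).
Proof.
  destruct n as [|n]; [reflexivity|]. unfold bin_nat, bits.
  induction (Pos.of_nat (S n)) as [p IH|p IH|]; simpl; rewrite ?map_app, ?IH; reflexivity.
Qed.

Lemma bval_pbits p : bval (pbits p) = Pos.to_nat p.
Proof.
  induction p as [p IH|p IH|]; simpl pbits; rewrite ?bval_snoc, ?IH; simpl Nat.b2n; [lia|lia|reflexivity].
Qed.

Lemma bval_bits n : bval (bits n) = n.
Proof. destruct n as [|n]; [reflexivity|]. unfold bits. rewrite bval_pbits. lia. Qed.

(** Every word with leading digit 1 is a binary numeral, and zero is the empty word. Hence the
    parser can accept a leaf after inspecting only its first digit. *)
Lemma pbits_of l : exists p, pbits p = true :: l.
Proof.
  induction l as [|[] l [p IH]] using rev_ind.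
  - now exists xH.
  - exists (xI p). simpl. now rewrite IH.
  - exists (xO p). simpl. now rewrite IH.
Qed.

Lemma bits_bval l : bits (bval (true :: l)) = true :: l.
Proof.
  destruct (pbits_of l) as [p <-]. rewrite bval_pbits. unfold bits.
  destruct (Pos.to_nat p) eqn:E; [lia|]. rewrite <- E, Pos2Nat.id. reflexivity.
Qed.

Lemma bits_shape n : bits n = [] \/ exists l, bits n = true :: l.
Proof.
  destruct n as [|n]; [now left|right]. unfold bits.
  induction (Pos.of_nat (S n)) as [p [l IH]|p [l IH]|]; simpl; [| |now exists []];
    rewrite IH; simpl; eexists; reflexivity.
Qed.

Definition encs (ts : list tree) : list sym := concat (map enc_tree ts).

Lemma enc_node ts : enc_tree (Node ts) = SN :: encs ts ++ [SE].
Proof. simpl. do 2 f_equal. induction ts; simpl; [reflexivity|]. now rewrite IHts. Qed.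

Lemma enc_leaf n : enc_tree (Leaf n) = SL :: map b2s (bits n) ++ [SE].
Proof. simpl. now rewrite bin_nat_bits. Qed.

Lemma encs_app a b : encs (a ++ b) = encs a ++ encs b.
Proof. unfold encs. now rewrite map_app, concat_app. Qed.

Lemma encs_cons t ts : encs (t :: ts) = enc_tree t ++ encs ts.
Proof. reflexivity. Qed.

Lemma encs_one t : encs [t] = enc_tree t.
Proof. apply app_nil_r. Qed.

Arguments enc_tree : simpl never.
Arguments encs : simpl never.

(* A grammar describes sequences of sibling trees; an item is a single tree. *)
Inductive sch : Set :=
| SLf
| SNd (s : sch)
| SStar (s : sch)
| SCons (s c : sch).

Fixpoint den (s : sch) : Set :=
  match s with
  | SLf => nat
  | SNd s => den s
  | SStar s => list (den s)
  | SCons s c => (den s * den c)%type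
  end.

Fixpoint to_trees (s : sch) : den s -> list tree :=
  match s with
  | SLf => fun n => [Leaf n]
  | SNd s => fun x => [Node (to_trees s x)]
  | SStar s => fun l => flat_map (to_trees s) l
  | SCons s c => fun x => to_trees s (fst x) ++ to_trees c (snd x)
  end.

Definition is_item (s : sch) : bool := match s with SLf | SNd _ => true | _ => false end.

(** Only single trees may be repeated or stand before another component. One symbol then decides
    whether a repetition goes on: every item opens with [SL] or [SN], and the end shows as [SE]. *)
Fixpoint sch_ok (s : sch) : bool :=
  match s with
  | SLf => true
  | SNd s => sch_ok s
  | SStar s => is_item s && sch_ok s
  | SCons s c => is_item s && sch_ok s && sch_ok c
  end%bool.

(** Number of loop counters in use at once: one for skipping the digits of a leaf and one per nested
    repetition. *)
Fixpoint depth (s : sch) : nat :=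
  match s with
  | SLf => 1
  | SNd s => depth s
  | SStar s => S (depth s)
  | SCons s c => max (depth s) (depth c)
  end.

(* Register 3 is a validity flag: it is emptied when parsing fails. *)
Definition expect (a : sym) (p : nat) : rcmd :=
  RCase p (fun o => if osym_eqb o (Some a) then RPop p else RClear 3).

Definition skip_bits (p b : nat) : rcmd :=
  RRep b (RCase p (fun o => match o with Some S0 | Some S1 => RPop p | _ => RSkip end)).

(** Loops run once per input symbol, which is enough because every item or digit takes at least one;
    the surplus rounds find [SE] and do nothing. Nested loops use the counters [b], [S b] and so
    on. *)
Fixpoint chk (s : sch) (p b : nat) : rcmd :=
  match s with
  | SLf => RSeq (expect SL p) (RSeq
      (RCase p (fun o => match o with
        | Some SE => RSkip | Some S1 => skip_bits p b | _ => RClear 3 end)) (expect SE p))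
  | SNd s => RSeq (expect SN p) (RSeq (chk s p b) (expect SE p))
  | SStar s => RRep b (RCase p (fun o => match o with
      | None | Some SE => RSkip | _ => chk s p (S b) end))
  | SCons s c => RSeq (chk s p b) (chk c p b)
  end.

Lemma chk_keeps s p r : r <> p -> r <> 3 -> forall b, r < b -> keeps r (chk s p b).
Proof.
  intros Hp H3. induction s as [|s IH|s IH|s IHs c IHc]; intros b Hb; simpl.
  - repeat split; intros o; try destruct (osym_eqb o _); simpl; try lia;
      destruct o as [[]|]; simpl; repeat split; try lia; intros [[]|]; simpl; lia.
  - repeat split; try (intros o; destruct (osym_eqb o _); simpl; lia). auto.
  - split; [lia|]. intros [[]|]; simpl; auto.
  - auto.
Qed.

Lemma chk_rok m s p : 3 < p -> forall b, p < b -> b + depth s <= m -> rok m (chk s p b).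
Proof.
  intros H3. induction s as [|s IH|s IH|s IHs c IHc]; intros b Hb Hm; simpl in *.
  - repeat split; try lia; intros o; try destruct (osym_eqb o _); simpl; try lia;
      destruct o as [[]|]; simpl; repeat split; try lia; intros [[]|]; simpl; lia.
  - repeat split; try lia; try (intros o; destruct (osym_eqb o _); simpl; lia). apply IH; lia.
  - split; [lia|]. split.
    + intros [[]|]; simpl; trivial; apply chk_keeps; lia.
    + split; [lia|]. intros [[]|]; simpl; trivial; apply IH; lia.
  - split; [apply IHs; lia|apply IHc; lia].
Qed.

(** Rule for loops that overshoot: [R] carries the list of items still to be treated, each round
    removes one, and the rounds after the list is exhausted must preserve [R []]. *)
Lemma rep_consume {X : Type} (R : list X -> store -> Prop) F k :
  (forall x xs st l, R (x :: xs) st -> R xs (F (upd st k l))) ->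
  (forall st l, R [] st -> R [] (F (upd st k l))) ->
  (forall st, R [] st -> R [] (upd st k [])) ->
  forall l xs st, length xs <= length l -> R xs st -> R [] (rep F k l st).
Proof.
  intros H1 H2 H3. induction l as [|a l IH]; intros xs st Hl HR; simpl in *.
  - destruct xs; simpl in Hl; [auto|lia].
  - destruct xs as [|x xs]; simpl in Hl.
    + apply (IH []); simpl; [lia|auto].
    + apply (IH xs); [lia|]. eapply H1, HR.
Qed.

Lemma rep_inv (I : store -> Prop) F k :
  (forall st l, I st -> I (F (upd st k l))) -> (forall st, I st -> I (upd st k [])) ->
  forall l st, I st -> I (rep F k l st).
Proof. intros H1 H2. induction l as [|a l IH]; intros st H; simpl; auto. Qed.

Lemma run_expect a p st rest : st p = a :: rest -> run (expect a p) st = upd st p rest.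
Proof. intros H. simpl. rewrite H. simpl. destruct a; simpl; now rewrite H. Qed.

Lemma run_skip_bits p b st bs rest : p <> b -> st p = map b2s bs ++ SE :: rest ->
  length bs <= length (st 0) -> run (skip_bits p b) st p = SE :: rest.
Proof.
  intros Hpb Hp HN. simpl.
  apply (rep_consume (fun bs st => st p = map b2s bs ++ SE :: rest)) with (xs := bs);
    [| | |assumption|assumption].
  - intros x xs st' l H. simpl. rewrite (upd_ne st' b p l Hpb), H. destruct x; simpl;
      now rewrite upd_eq, (upd_ne st' b p l Hpb), H.
  - intros st' l H. simpl. rewrite (upd_ne st' b p l Hpb), H. simpl.
    now rewrite (upd_ne st' b p l Hpb).
  - intros st' H. now rewrite upd_ne.
Qed.

(** A repetition ends at [SE], so what is not a single tree is parsed only up to the point where its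
    enclosing node closes; a single tree delimits itself. *)
Definition follows (s : sch) (rest : list sym) : Prop :=
  is_item s = true \/ exists r, rest = SE :: r.

Lemma item_head s x : is_item s = true ->
  exists a l, encs (to_trees s x) = a :: l /\ (a = SL \/ a = SN).
Proof.
  destruct s; try discriminate; intros _; cbn [to_trees]; rewrite encs_one.
  - rewrite enc_leaf. eauto 6.
  - rewrite enc_node. eauto 6.
Qed.

Lemma chk_complete s p : 3 < p -> sch_ok s = true ->
  forall b x st rest, p < b -> st p = encs (to_trees s x) ++ rest -> follows s rest ->
  length (st p) <= length (st 0) ->
  run (chk s p b) st p = rest /\ run (chk s p b) st 3 = st 3.
Proof.
  intros H3. induction s as [|s IH|s IH|s IHs c IHc]; intros Hok b x st rest Hb Hp Hf HN.
  - cbn [to_trees] in Hp. rewrite encs_one, enc_leaf in Hp. simpl in Hp. rewrite <- app_assoc in Hp. simpl in Hp.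
    cbn [chk run]. rewrite (run_expect _ _ _ _ Hp).
    set (st1 := upd st p _).
    assert (H1 : st1 p = map b2s (bits x) ++ SE :: rest) by apply upd_eq.
    match goal with |- context [run (match hd_error (st1 p) with _ => _ end) st1] =>
      set (st2 := run (match hd_error (st1 p) with Some SE => RSkip
        | Some S1 => skip_bits p b | _ => RClear 3 end) st1) end.
    assert (H2 : st2 p = SE :: rest /\ st2 3 = st 3).
    { unfold st2. destruct (bits_shape x) as [E|[l E]]; rewrite E in H1; rewrite H1.
      - simpl. rewrite H1. split; [reflexivity|]. unfold st1. apply upd_ne. lia.
      - cbn [map hd_error app b2s].
        split.
        + apply run_skip_bits with (bs := true :: l); [lia|exact H1|].
          unfold st1. rewrite upd_ne by lia. rewrite Hp in HN. simpl in HN.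
          rewrite length_app, length_map, E in HN. simpl in *. lia.
        + rewrite run_keeps; [unfold st1; apply upd_ne; lia|].
          split; [lia|]. intros [[]|]; simpl; trivial; lia. }
    destruct H2 as [H2 H2']. fold st2. rewrite (run_expect _ _ _ _ H2).
    split; [apply upd_eq|]. now rewrite upd_ne by lia.
  - cbn [to_trees] in Hp. rewrite encs_one, enc_node in Hp. cbn [app] in Hp. rewrite <- app_assoc in Hp. cbn [app] in Hp.
    cbn [chk run]. rewrite (run_expect _ _ _ _ Hp).
    set (st1 := upd st p _).
    assert (H1 : st1 p = encs (to_trees s x) ++ SE :: rest) by apply upd_eq.
    assert (HN1 : length (st1 p) <= length (st1 0)).
    { rewrite H1. unfold st1. rewrite upd_ne by lia. rewrite Hp in HN. simpl in HN. lia. }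
    destruct (IH Hok b x st1 _ Hb H1 (or_intror (ex_intro _ _ eq_refl)) HN1) as [H4 H5].
    rewrite (run_expect _ _ _ _ H4).
    split; [apply upd_eq|]. rewrite upd_ne by lia. rewrite H5. unfold st1. now rewrite upd_ne by lia.
  - simpl in Hok. apply andb_prop in Hok as [Hit Hok].
    destruct Hf as [Hf|[r0 ->]]; [discriminate|]. cbn [chk run].
    cbn [to_trees] in Hp.
    set (R := fun xs st' => st' p = encs (flat_map (to_trees s) xs) ++ SE :: r0 /\
      length (st' p) <= length (st' 0) /\ st' 3 = st 3).
    enough (HR : R [] (rep (run (RCase p (fun o => match o with
      | None | Some SE => RSkip | _ => chk s p (S b) end))) b (st 0) st))
      by (split; apply HR).
    apply (rep_consume R) with (xs := x); unfold R; [clear x Hp HN|clear x Hp HN|clear x Hp HN| |].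
    + intros x xs st' l (E1 & E2 & E3). cbn [flat_map] in E1. rewrite encs_app, <- app_assoc in E1.
      set (st1 := upd st' b l).
      assert (E1' : st1 p = st' p) by (unfold st1; apply upd_ne; lia).
      assert (E0' : st1 0 = st' 0) by (unfold st1; apply upd_ne; lia).
      assert (E3' : st1 3 = st' 3) by (unfold st1; apply upd_ne; lia).
      assert (HC : run (RCase p (fun o => match o with
        | None | Some SE => RSkip | _ => chk s p (S b) end)) st1 = run (chk s p (S b)) st1).
      { cbn [run]. rewrite E1', E1.
        destruct (item_head s x Hit) as (a & l' & -> & [-> | ->]); reflexivity. }
      rewrite HC.
      destruct (IH Hok (S b) x st1 (encs (flat_map (to_trees s) xs) ++ SE :: r0)) as [F1 F2];
        [lia|congruence|now left|congruence|].
      rewrite F1, F2, E3'. split; [reflexivity|]. split; [|assumption].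
      rewrite run_keeps by (apply chk_keeps; lia). rewrite E0'.
      rewrite E1, length_app in E2. lia.
    + intros st' l (E1 & E2 & E3). simpl in E1.
      assert (E1' : upd st' b l p = SE :: r0) by (rewrite upd_ne by lia; exact E1).
      cbn [run]. rewrite E1'. cbn [hd_error run]. rewrite E1'.
      rewrite !upd_ne by lia. rewrite E1 in E2. auto.
    + intros st' (E1 & E2 & E3). rewrite !upd_ne by lia. auto.
    + rewrite Hp, length_app in HN.
      assert (HL : length x <= length (encs (flat_map (to_trees s) x))).
      { clear - Hit. induction x as [|y x IHx]; [simpl; lia|]. cbn [flat_map].
        rewrite encs_app, length_app. destruct (item_head s y Hit) as (a & l & -> & _). simpl. lia. }
      exact (Nat.le_trans _ _ _ HL (Nat.le_trans _ _ _ (Nat.le_add_r _ _) HN)).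
    + auto.
  - simpl in Hok. apply andb_prop in Hok as [Hok Hok2]. apply andb_prop in Hok as [Hit Hok1].
    cbn [to_trees] in Hp. rewrite encs_app, <- app_assoc in Hp. cbn [chk run].
    destruct (IHs Hok1 b (fst x) st _ Hb Hp (or_introl Hit) HN) as [H1 H2].
    destruct (IHc Hok2 b (snd x) _ rest Hb H1) as [H4 H5].
    + destruct Hf as [Hf|Hf]; [discriminate|now right].
    + rewrite H1. rewrite run_keeps by (apply chk_keeps; lia).
      rewrite Hp, length_app in HN. lia.
    + split; [exact H4|]. now rewrite H5, H2.
Qed.

Lemma expect_sound a p st : p <> 3 -> run (expect a p) st 3 <> [] ->
  run (expect a p) st 3 = st 3 /\ st p = a :: run (expect a p) st p.
Proof.
  intros Hp. simpl. destruct (osym_eqb (hd_error (st p)) (Some a)) eqn:E; simpl.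
  - apply osym_eqb_eq in E. intros _. rewrite upd_ne by congruence. split; [reflexivity|].
    rewrite upd_eq. destruct (st p); simpl in *; congruence.
  - rewrite upd_eq. congruence.
Qed.

(** Whatever is consumed without failure is derived from the grammar. A loop that stops too early
    only leaves symbols over, and these make the caller fail. *)
Lemma chk_sound s p : 3 < p -> forall b st, p < b ->
  run (chk s p b) st 3 <> [] -> run (chk s p b) st 3 = st 3 /\
  exists x, st p = encs (to_trees s x) ++ run (chk s p b) st p.
Proof.
  intros H3. induction s as [|s IH|s IH|s IHs c IHc]; intros b st Hb.
  - cbn [chk run].
    set (st1 := run (expect SL p) st).
    match goal with |- context [run (expect SE p) ?S] => set (st2 := S) end.
    intros H. pose proof H as H0. apply expect_sound in H as [H1 H2]; [|lia].
    rewrite H1 in *.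
    assert (HS : st2 3 <> [] -> st2 3 = st1 3 /\
      exists x, st1 p = map b2s (bits x) ++ st2 p).
    { unfold st2. destruct (st1 p) as [|[] l] eqn:E; cbn [hd_error run];
        try (rewrite upd_eq; congruence).
      - intros _. split.
        { rewrite run_keeps; [reflexivity|]. split; [lia|]. intros [[]|]; simpl; trivial; lia. }
        (* The second alternative is the state before the first round, when the leading 1 is still
           there. If it persisted, the leaf would count as 0 with its digits left unread. *)
        assert (HI : exists bs, S1 :: l = map b2s (true :: bs) ++ run (skip_bits p b) st1 p \/
                     (bs = [] /\ run (skip_bits p b) st1 p = S1 :: l)).
        { unfold skip_bits. cbn [run].
          apply (rep_inv (fun st' => exists bs, S1 :: l = map b2s (true :: bs) ++ st' p \/
                     (bs = [] /\ st' p = S1 :: l))).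
          - intros st' l' (bs & HI). cbn [run]. rewrite upd_ne by lia.
            destruct (st' p) as [|a l2] eqn:E'; [|destruct a]; cbn [hd_error run];
              rewrite ?upd_eq, ?upd_ne by lia; try (exists bs; rewrite ?E'; exact HI).
            + exists (bs ++ [false]). left. rewrite E'. simpl tl.
              destruct HI as [HI|[_ HI]]; [|discriminate].
              rewrite HI. simpl. rewrite map_app, <- app_assoc. reflexivity.
            + rewrite E'. simpl tl. destruct HI as [HI|[-> HI]].
              * exists (bs ++ [true]). left. rewrite HI. simpl. rewrite map_app, <- app_assoc. reflexivity.
              * exists []. left. simpl. injection HI as ->. reflexivity.
          - intros st' HI. rewrite upd_ne by lia. exact HI.
          - exists []. now right. }
        destruct HI as (bs & [HI|[_ HI]]).
        + exists (bval (true :: bs)). now rewrite bits_bval.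
        + exists 0. exact (eq_sym HI).
      - intros _. split; [reflexivity|]. exists 0. exact (eq_sym E). }
    destruct (HS H0) as [H4 [x Hx]]. rewrite H4 in *.
    unfold st1 in H0. apply expect_sound in H0 as [H5 H6]; [|lia].
    split; [exact H5|]. exists x. cbn [to_trees]. rewrite encs_one, enc_leaf. cbn [app].
    rewrite H6. fold st1. rewrite Hx, H2, <- app_assoc. reflexivity.
  - cbn [chk run]. set (st1 := run (expect SN p) st). set (st2 := run (chk s p b) st1).
    intros H. pose proof H as H0. apply expect_sound in H as [H1 H2]; [|lia].
    rewrite H1 in *. destruct (IH b st1 Hb H0) as [H4 [x Hx]]. fold st2 in H4, Hx.
    rewrite H4 in *. unfold st1 in H0. apply expect_sound in H0 as [H5 H6]; [|lia].
    split; [exact H5|]. exists x. cbn [to_trees]. rewrite encs_one, enc_node. cbn [app].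
    rewrite H6. fold st1. rewrite Hx, H2, <- app_assoc. reflexivity.
  - cbn [chk run].
    apply (rep_inv (fun st' => st' 3 <> [] -> st' 3 = st 3 /\
      exists x, st p = encs (to_trees (SStar s) x) ++ st' p)).
    + intros st' l HI. cbn [run]. set (st1 := upd st' b l).
      assert (E3 : st1 3 = st' 3) by (unfold st1; apply upd_ne; lia).
      assert (Ep : st1 p = st' p) by (unfold st1; apply upd_ne; lia).
      assert (HC : forall st2, run (match hd_error (st1 p) with
        | None | Some SE => RSkip | _ => chk s p (S b) end) st1 = st2 ->
        st2 = st1 \/ st2 = run (chk s p (S b)) st1)
        by (intros st2 <-; destruct (hd_error (st1 p)) as [[]|]; auto).
      destruct (HC _ eq_refl) as [-> | ->].
      * rewrite E3, Ep. exact HI.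
      * intros H. destruct (IH (S b) st1 ltac:(lia) H) as [H1 [y Hy]].
        rewrite H1, E3 in *. destruct (HI H) as [H2 [x Hx]]. split; [exact H2|].
        exists (x ++ [y]). cbn [to_trees]. rewrite flat_map_app, encs_app, <- app_assoc.
        cbn [flat_map]. rewrite app_nil_r. rewrite Ep in Hy. rewrite <- Hy. exact Hx.
    + intros st' HI. rewrite !upd_ne by lia. exact HI.
    + intros _. split; [reflexivity|]. exists []. reflexivity.
  - cbn [chk run]. set (st1 := run (chk s p b) st). intros H.
    destruct (IHc b st1 Hb H) as [H1 [y Hy]]. rewrite H1 in *.
    destruct (IHs b st Hb H) as [H4 [x Hx]]. split; [exact H4|].
    exists (x, y). cbn [to_trees fst snd]. fold st1 in Hx. rewrite encs_app, Hx, Hy, <- app_assoc. reflexivity.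
Qed.

(** * Print templates *)

(* Variables are de Bruijn levels into an environment of
   subtrees of the input, each with its position in the enclosing node. *)
Inductive tmpl : Set :=
| POut (l : list sym)
| PSeq (a b : tmpl)
| PFor (v : nat) (b : tmpl)
| PProj (v k : nat) (b : tmpl)
| PBits (v : nat) (f : bool -> list sym)
| PUn (v : nat) (l : list sym)
| PAll (l : list sym).

Definition env : Set := list (nat * tree).
Definition get (e : env) (v : nat) : nat * tree := nth v e (0, Leaf 0).
Definition kids (t : tree) : list tree := match t with Node ts => ts | Leaf _ => [] end.
Definition leafv (t : tree) : nat := match t with Leaf n => n | Node _ => 0 end.
Definition zipi {A} (k : nat) (l : list A) : list (nat * A) := combine (seq k (length l)) l.

(* An index i is printed in unary as N - i marks, N being the input length. *)
Fixpoint sem (N : nat) (e : env) (t : tmpl) : list sym :=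
  match t with
  | POut l => l
  | PSeq a b => sem N e a ++ sem N e b
  | PFor v b => flat_map (fun it => sem N (e ++ [it]) b) (zipi 0 (kids (snd (get e v))))
  | PProj v k b => sem N (e ++ [(0, nth k (kids (snd (get e v))) (Leaf 0))]) b
  | PBits v f => flat_map f (bits (leafv (snd (get e v))))
  | PUn v l => concat (repeat l (N - fst (get e v)))
  | PAll l => concat (repeat l N)
  end.

Fixpoint comp_at (c : sch) (k : nat) : option sch :=
  match c, k with
  | SCons a _, 0 => Some a
  | SCons _ c', S k' => comp_at c' k'
  | SStar _, _ => None
  | _, 0 => Some c
  | _, S _ => None
  end.

Fixpoint skip (c : sch) (k p b : nat) : rcmd :=
  match c, k with
  | SCons a c', S k' => RSeq (chk a p b) (skip c' k' p b)
  | _, _ => RSkip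
  end.

(** Each level owns three registers: the suffix of the input that starts at the bound subtree, a
    word whose length encodes its position, and a loop counter. Registers 0 to 3 are reserved for
    input, output, scratch space and validity flag. *)
Definition ptr (v : nat) : nat := 4 + 3 * v.
Definition idx (v : nat) : nat := 5 + 3 * v.
Definition cnt (v : nat) : nat := 6 + 3 * v.

Definition for_body (p i : nat) (c d : rcmd) : rcmd :=
  RCase p (fun o => match o with
    | None | Some SE => RSkip
    | _ => RSeq c (RSeq d (RPop i)) end).

Definition bit_body (p : nat) (f : bool -> list sym) : rcmd :=
  RCase p (fun o => match o with
    | Some S0 => RSeq (ROut (f false)) (RPop p)
    | Some S1 => RSeq (ROut (f true)) (RPop p)
    | _ => RSkip end).

Definition un_body (p : nat) (l : list sym) : rcmd :=
  RCase p (fun o => match o with None => RSkip | Some _ => RSeq (ROut l) (RPop p) end).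

(** The parser doubles as an iterator: running [chk a] on the pointer of a loop moves it past the
    current child. The position register starts as a copy of the input and loses a symbol per child,
    which is why a position [i] is available as [N - i]. *)
Fixpoint tcomp (G : list sch) (t : tmpl) : rcmd :=
  let n := length G in
  match t with
  | POut l => ROut l
  | PSeq a b => RSeq (tcomp G a) (tcomp G b)
  | PFor v b =>
      match nth_error G v with
      | Some (SNd (SStar a)) =>
          RSeq (RCopy (ptr n) (ptr v)) (RSeq (RPop (ptr n)) (RSeq (RCopy (idx n) 0)
            (RRep (cnt n) (for_body (ptr n) (idx n) (tcomp (G ++ [a]) b) (chk a (ptr n) (ptr (S n)))))))
      | _ => RSkip
      end
  | PProj v k b =>
      match nth_error G v with
      | Some (SNd c) =>
          match comp_at c k with
          | Some a =>
              RSeq (RCopy (ptr n) (ptr v)) (RSeq (RPop (ptr n))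
                (RSeq (skip c k (ptr n) (ptr (S n))) (RSeq (RCopy (idx n) 0) (tcomp (G ++ [a]) b))))
          | None => RSkip
          end
      | _ => RSkip
      end
  | PBits v f =>
      RSeq (RCopy (ptr n) (ptr v)) (RSeq (RPop (ptr n)) (RRep (cnt n) (bit_body (ptr n) f)))
  | PUn v l => RSeq (RCopy (ptr n) (idx v)) (RRep (cnt n) (un_body (ptr n) l))
  | PAll l => RRep (cnt n) (ROut l)
  end.

Fixpoint wt (G : list sch) (t : tmpl) : bool :=
  match t with
  | POut _ | PAll _ => true
  | PSeq a b => wt G a && wt G b
  | PFor v b =>
      match nth_error G v with
      | Some (SNd (SStar a)) => wt (G ++ [a]) b
      | _ => false
      end
  | PProj v k b =>
      match nth_error G v with
      | Some (SNd c) => match comp_at c k with Some a => wt (G ++ [a]) b | None => false end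
      | _ => false
      end
  | PBits v _ => match nth_error G v with Some SLf => true | _ => false end
  | PUn v _ => match nth_error G v with Some _ => true | None => false end
  end%bool.

Lemma keeps_skip r p b c : forall k, r <> p -> r <> 3 -> r < b -> keeps r (skip c k p b).
Proof.
  induction c as [|s _|s _|s _ c IH]; intros k H1 H2 H3; destruct k; simpl; trivial.
  split; [now apply chk_keeps|now apply IH].
Qed.

(** Compiled code writes, besides output and flag, only registers of its own level and deeper ones.
    The pointers and counters of enclosing loops therefore survive their bodies. *)
Lemma keeps_tcomp r t : r <> 1 -> r <> 3 -> forall G, r < ptr (length G) -> keeps r (tcomp G t).
Proof.
  intros H1 H3. induction t as [l|a IHa b IHb|v b IH|v k b IH|v f|v l|l]; intros G Hr; simpl.
  - congruence.
  - auto.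
  - destruct (nth_error G v) as [[|[| |a|]| |]|]; try exact I.
    assert (Hb : r < ptr (length (G ++ [a]))) by (rewrite length_app; unfold ptr in *; simpl; lia).
    unfold ptr, idx, cnt in *. simpl. repeat split; try lia.
    intros [[]|]; simpl; trivial; repeat split; try lia; try (apply chk_keeps; lia);
      apply IH; exact Hb.
  - destruct (nth_error G v) as [[|c| |]|]; try exact I.
    destruct (comp_at c k) as [a|]; [|exact I].
    assert (Hb : r < ptr (length (G ++ [a]))) by (rewrite length_app; unfold ptr in *; simpl; lia).
    unfold ptr, idx, cnt in *. simpl. repeat split; try lia; [apply keeps_skip; lia|].
    apply IH; exact Hb.
  - unfold ptr, idx, cnt in *. repeat split; try lia.
    intros [[]|]; simpl; trivial; repeat split; lia.
  - unfold ptr, idx, cnt in *. repeat split; try lia.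
    intros [[]|]; simpl; trivial; repeat split; lia.
  - unfold ptr, idx, cnt in *. simpl. lia.
Qed.

Lemma rok_mono m m' c : m <= m' -> rok m c -> rok m' c.
Proof.
  intros Hm. induction c as [| | | | |r f IH|c IHc d IHd|k c IH]; simpl; try lia.
  - intros [H1 H2]. split; [lia|auto].
  - intros [H1 H2]. auto.
  - intros (H1 & H2 & H3). repeat split; try lia; auto.
Qed.

Lemma rok_skip m p b c : 3 < p -> p < b -> b + depth c <= m -> forall k, rok m (skip c k p b).
Proof.
  intros Hp Hb. induction c as [|s _|s _|s _ c IH]; simpl; intros Hm k; destruct k; simpl; trivial.
  split; [apply chk_rok; lia|apply IH; lia].
Qed.

Lemma nth_error_lt {A} (l : list A) v x : nth_error l v = Some x -> v < length l.
Proof. intros H. apply nth_error_Some. congruence. Qed.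

Lemma rok_tcomp t : forall G, wt G t = true -> exists m, rok m (tcomp G t).
Proof.
  induction t as [l|a IHa b IHb|v b IH|v k b IH|v f|v l|l]; intros G Hw; simpl in Hw.
  - exists 0. exact I.
  - apply andb_prop in Hw as [Ha Hb]. destruct (IHa G Ha) as [m1 H1], (IHb G Hb) as [m2 H2].
    exists (m1 + m2). split; [apply (rok_mono m1)|apply (rok_mono m2)]; trivial; lia.
  - simpl. destruct (nth_error G v) as [[|[| |a|]| |]|] eqn:E; try discriminate.
    apply nth_error_lt in E.
    destruct (IH _ Hw) as [m1 H1]. exists (m1 + ptr (S (length G)) + depth a).
    assert (Hb : keeps (cnt (length G)) (tcomp (G ++ [a]) b)).
    { apply keeps_tcomp; unfold cnt, ptr; rewrite ?length_app; simpl; lia. }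
    assert (H2 : rok (m1 + ptr (S (length G)) + depth a) (tcomp (G ++ [a]) b))
      by (apply (rok_mono m1); trivial; lia).
    set (m := m1 + _ + _) in *. assert (ptr (S (length G)) + depth a <= m) by (unfold m; lia).
    clearbody m. unfold for_body, ptr, idx, cnt in *.
    cbn [rok keeps]. repeat match goal with |- _ /\ _ => split end; try lia.
    + intros [[]|]; cbn [keeps]; trivial; repeat split; try lia; trivial; apply chk_keeps; lia.
    + intros [[]|]; cbn [rok]; trivial; repeat split; try lia; trivial; apply chk_rok; lia.
  - simpl. destruct (nth_error G v) as [[|c| |]|] eqn:E; try discriminate.
    destruct (comp_at c k) as [a|]; [|discriminate]. apply nth_error_lt in E.
    destruct (IH _ Hw) as [m1 H1]. exists (m1 + ptr (S (length G)) + depth c).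
    assert (H2 : rok (m1 + ptr (S (length G)) + depth c) (tcomp (G ++ [a]) b))
      by (apply (rok_mono m1); trivial; lia).
    set (m := m1 + _ + _) in *. assert (ptr (S (length G)) + depth c <= m) by (unfold m; lia).
    clearbody m. unfold ptr, idx, cnt in *.
    cbn [rok keeps]. repeat match goal with |- _ /\ _ => split end; try lia; trivial.
    apply rok_skip; lia.
  - exists (ptr (S (length G))). destruct (nth_error G v) as [[| | |]|] eqn:E; try discriminate.
    apply nth_error_lt in E. unfold bit_body, ptr, idx, cnt in *.
    cbn [tcomp rok keeps]. repeat match goal with |- _ /\ _ => split end; unfold ptr, cnt, idx, bit_body, un_body; cbn [keeps rok]; try lia; try (split; [lia|]);
      intros [[]|]; simpl; repeat split; trivial; lia.
  - exists (ptr (S (length G))). destruct (nth_error G v) as [s|] eqn:E; try discriminate.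
    apply nth_error_lt in E. unfold un_body, ptr, idx, cnt in *.
    cbn [tcomp rok keeps]. repeat match goal with |- _ /\ _ => split end; unfold ptr, cnt, idx, bit_body, un_body; cbn [keeps rok]; try lia; try (split; [lia|]);
      intros [[]|]; simpl; repeat split; trivial; lia.
  - exists (ptr (S (length G))). cbn [tcomp rok keeps]. unfold ptr, cnt. lia.
Qed.

Lemma skip_sem c p : 3 < p -> sch_ok c = true -> forall k a, comp_at c k = Some a ->
  forall b x st rest, p < b -> st p = encs (to_trees c x) ++ rest -> length (st p) <= length (st 0) ->
  exists y t rest', is_item a = true /\ sch_ok a = true /\
    nth_error (to_trees c x) k = Some t /\ to_trees a y = [t] /\
    run (skip c k p b) st p = enc_tree t ++ rest' /\
    length (run (skip c k p b) st p) <= length (st p).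
Proof.
  intros H3. induction c as [|s _|s _|s _ c IH]; intros Hok k a Hk b x st rest Hb Hp HN.
  - destruct k; [|discriminate]. injection Hk as <-. cbn [skip run].
    exists x, (Leaf x), rest. rewrite Hp. cbn [to_trees]. rewrite encs_one. repeat split; auto.
  - destruct k; [|discriminate]. injection Hk as <-. cbn [skip run].
    exists x, (Node (to_trees s x)), rest. rewrite Hp. cbn [to_trees]. rewrite encs_one. repeat split; auto.
  - destruct k; discriminate.
  - simpl in Hok. apply andb_prop in Hok as [Hok Hok2]. apply andb_prop in Hok as [Hit Hok1].
    assert (Hone : exists t, to_trees s (fst x) = [t])
      by (destruct s; try discriminate; simpl; eauto).
    destruct Hone as [t Ht]. cbn [to_trees] in Hp. rewrite encs_app, <- app_assoc in Hp.
    destruct k as [|k]; simpl in Hk.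
    + injection Hk as <-. exists (fst x), t, (encs (to_trees c (snd x)) ++ rest). cbn [skip run].
      rewrite Hp, Ht, encs_one. cbn [to_trees]. rewrite Ht. repeat split; auto.
    + cbn [skip run to_trees]. rewrite Ht. simpl nth_error.
      destruct (chk_complete s p H3 Hok1 b (fst x) st _ Hb Hp (or_introl Hit) HN) as [H1 _].
      destruct (IH Hok2 k a Hk b (snd x) _ rest Hb H1) as (y & t' & r' & A1 & A2 & A3 & A4 & A5 & A6).
      * rewrite H1. rewrite run_keeps by (apply chk_keeps; lia).
        rewrite Hp, length_app in HN. lia.
      * exists y, t', r'. repeat split; auto. etransitivity; [exact A6|].
        rewrite H1, Hp, (length_app (encs (to_trees s _))). lia.
Qed.

(** Lengths belong to the invariant because a loop of [N] rounds must suffice for whatever a pointer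
    still has to traverse. *)
Definition inv (N : nat) (G : list sch) (e : env) (st : store) : Prop :=
  length (st 0) = N /\ length e = length G /\
  forall v s, nth_error G v = Some s -> is_item s = true /\ sch_ok s = true /\
    exists x rest, to_trees s x = [snd (get e v)] /\
      st (ptr v) = enc_tree (snd (get e v)) ++ rest /\ length (st (ptr v)) <= N /\
      length (st (idx v)) = N - fst (get e v).

Lemma get_snoc_lt (e : env) it v : v < length e -> get (e ++ [it]) v = get e v.
Proof. intros H. unfold get. now rewrite app_nth1. Qed.

Lemma get_snoc_eq (e : env) it : get (e ++ [it]) (length e) = it.
Proof. unfold get. now rewrite app_nth2, Nat.sub_diag by lia. Qed.

Lemma inv_frame N G e st st' : inv N G e st ->
  (forall r, r < ptr (length G) -> r <> 1 -> r <> 3 -> st' r = st r) -> inv N G e st'.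
Proof.
  intros (H0 & He & H) HF. split; [|split; [exact He|]].
  - rewrite HF; [exact H0|unfold ptr; lia|lia|lia].
  - intros v s Hv. pose proof (nth_error_lt _ _ _ Hv) as Hlt.
    rewrite !HF by (unfold ptr, idx in *; lia). now apply H.
Qed.

Lemma inv_snoc N G e st a i t y rest : inv N G e st -> is_item a = true -> sch_ok a = true ->
  to_trees a y = [t] -> st (ptr (length G)) = enc_tree t ++ rest ->
  length (st (ptr (length G))) <= N -> length (st (idx (length G))) = N - i ->
  inv N (G ++ [a]) (e ++ [(i, t)]) st.
Proof.
  intros (H0 & He & H) Hi Hok Ht Hp Hl Hx.
  split; [exact H0|]. split; [now rewrite !length_app, He|].
  intros v s Hv. pose proof (nth_error_lt _ _ _ Hv) as Hlt. rewrite length_app in Hlt. simpl in Hlt.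
  destruct (Nat.eq_dec v (length G)) as [->|Hne].
  - rewrite nth_error_app2, Nat.sub_diag in Hv by lia. injection Hv as <-.
    rewrite <- He, get_snoc_eq, He. split; [assumption|]. split; [assumption|].
    exists y, rest. auto.
  - rewrite nth_error_app1 in Hv by lia. rewrite get_snoc_lt by lia. now apply H.
Qed.

Lemma item_tree a x : is_item a = true -> exists t, to_trees a x = [t].
Proof. destruct a; try discriminate; simpl; eauto. Qed.

Lemma tcomp_sem N t : forall G e st, wt G t = true -> inv N G e st ->
  run (tcomp G t) st 1 = st 1 ++ sem N e t.
Proof.
  induction t as [l|a IHa b IHb|v b IH|v k b IH|v f|v l|l]; intros G e st Hw HI; simpl in Hw.
  - apply upd_eq.
  - apply andb_prop in Hw as [Ha Hb]. simpl.
    rewrite (IHb G e); [|assumption|].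
    + rewrite (IHa G e) by assumption. now rewrite app_assoc.
    + apply (inv_frame N G e st); [assumption|]. intros r H1 H2 H3.
      apply run_keeps, keeps_tcomp; assumption.
  - cbn [tcomp]. destruct (nth_error G v) as [[|[| |a|]| |]|] eqn:Ev; try discriminate.
    pose proof HI as (H0 & He & Hg). destruct (Hg v _ Ev) as (_ & Hok & x & rest & Ht & Hp & Hl & _).
    cbn [to_trees] in Ht. injection Ht as Ht. cbn [sch_ok] in Hok.
    apply andb_prop in Hok as [Hit Hok]. cbn [sem]. rewrite <- Ht in Hp |- *. cbn [kids].
    rewrite enc_node in Hp. cbn [app] in Hp. rewrite <- app_assoc in Hp. cbn [app] in Hp.
    pose proof (nth_error_lt _ _ _ Ev) as Hlt. set (n := length G) in *.
    cbn [run]. set (st1 := upd (upd _ _ _) _ _).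
    assert (E1 : st1 (ptr n) = encs (flat_map (to_trees a) x) ++ SE :: rest).
    { unfold st1. rewrite upd_ne by (unfold ptr, idx; lia). rewrite !upd_eq, Hp. reflexivity. }
    assert (E2 : st1 (idx n) = st 0).
    { unfold st1. rewrite upd_eq, !upd_ne by (unfold ptr; lia). reflexivity. }
    assert (E3 : forall r, r < ptr n -> st1 r = st r).
    { intros r Hr. unfold st1. rewrite !upd_ne by (unfold ptr, idx in *; lia). reflexivity. }
    (* [k] counts the children treated and [xs] are the remaining ones: the output so far followed
       by what the remaining children will print is always the full result. *)
    set (R := fun (xs : list (den a)) st' => exists k,
      st' (ptr n) = encs (flat_map (to_trees a) xs) ++ SE :: rest /\
      length (st' (ptr n)) <= N /\ length (st' (idx n)) = N - k /\
      st' 1 ++ flat_map (fun it => sem N (e ++ [it]) b) (zipi k (flat_map (to_trees a) xs))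
      = st 1 ++ flat_map (fun it => sem N (e ++ [it]) b) (zipi 0 (flat_map (to_trees a) x)) /\
      forall r, r < ptr n -> r <> 1 -> r <> 3 -> st' r = st r).
    enough (HR : R [] (rep (run (for_body (ptr n) (idx n) (tcomp (G ++ [a]) b) (chk a (ptr n) (ptr (S n)))))
      (cnt n) (st1 0) st1)).
    { destruct HR as (k & _ & _ & _ & HR & _). cbn [flat_map zipi] in HR.
      unfold zipi in HR at 1. simpl combine in HR. cbn [flat_map] in HR. now rewrite app_nil_r in HR. }
    apply (rep_consume R) with (xs := x); unfold R.
    + intros y ys st' l (k & F1 & F2 & F3 & F4 & F5).
      cbn [flat_map] in F1, F4. destruct (item_tree a y Hit) as [t Hty]. rewrite Hty in F1, F4.
      cbn [app] in F1, F4. rewrite encs_cons, <- app_assoc in F1.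
      set (st2 := upd st' (cnt n) l).
      assert (G1 : forall r, r <> cnt n -> st2 r = st' r) by (intros r Hr; apply upd_ne; exact Hr).
      assert (HI2 : inv N G e st2).
      { apply (inv_frame N G e st); [assumption|]. intros r H1 H2 H3.
        rewrite G1 by (unfold ptr, cnt, n in *; lia). now apply F5. }
      assert (HI3 : inv N (G ++ [a]) (e ++ [(k, t)]) st2).
      { eapply inv_snoc; try eassumption; fold n; rewrite G1 by (unfold ptr, idx, cnt; lia);
          [exact F1|exact F2|exact F3]. }
      set (st3 := run (tcomp (G ++ [a]) b) st2).
      assert (K3 : forall r, r < ptr (S n) -> r <> 1 -> r <> 3 -> st3 r = st2 r).
      { intros r H1 H2 H3. apply run_keeps, keeps_tcomp; trivial.
        rewrite length_app. fold n. unfold ptr in *. simpl. lia. }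
      assert (P3 : st3 (ptr n) = encs (to_trees a y) ++ encs (flat_map (to_trees a) ys) ++ SE :: rest).
      { rewrite K3 by (unfold ptr; lia). rewrite G1 by (unfold ptr, cnt; lia).
        rewrite Hty, encs_one. exact F1. }
      assert (L3 : length (st3 (ptr n)) <= length (st3 0)).
      { rewrite !K3 by (unfold ptr; lia). rewrite !G1 by (unfold ptr, cnt; lia).
        rewrite (F5 0) by (unfold ptr; lia). lia. }
      destruct (chk_complete a (ptr n) ltac:(unfold ptr; lia) Hok (ptr (S n)) y st3 _
        ltac:(unfold ptr; lia) P3 (or_introl Hit) L3) as [Q1 _].
      set (st4 := run (chk a (ptr n) (ptr (S n))) st3) in *.
      assert (K4 : forall r, r < ptr (S n) -> r <> ptr n -> r <> 3 -> st4 r = st3 r).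
      { intros r H1 H2 H3. apply run_keeps, chk_keeps; trivial. }
      assert (HC : run (for_body (ptr n) (idx n) (tcomp (G ++ [a]) b) (chk a (ptr n) (ptr (S n)))) st2
                   = upd st4 (idx n) (tl (st4 (idx n)))).
      { unfold for_body. cbn [run]. rewrite (G1 (ptr n)) by (unfold ptr, cnt; lia). rewrite F1.
        rewrite <- encs_one, <- Hty.
        destruct (item_head a y Hit) as (s0 & l' & -> & [-> | ->]); reflexivity. }
      rewrite HC. exists (S k). repeat split.
      * rewrite upd_ne by (unfold ptr, idx; lia). exact Q1.
      * rewrite upd_ne by (unfold ptr, idx; lia). rewrite Q1.
        rewrite F1, length_app in F2. lia.
      * rewrite upd_eq. rewrite K4 by (unfold ptr, idx; lia). rewrite K3 by (unfold ptr, idx; lia).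
        rewrite G1 by (unfold cnt, idx; lia).
        destruct (st' (idx n)); simpl in *; lia.
      * rewrite upd_ne by (unfold idx; lia). rewrite K4 by (unfold ptr; lia).
        unfold st3. rewrite (IH _ _ _ Hw HI3). rewrite <- F4.
        unfold zipi. cbn [length seq combine flat_map]. rewrite <- app_assoc.
        rewrite G1 by (unfold cnt; lia). reflexivity.
      * intros r H1 H2 H3. rewrite upd_ne by (unfold ptr, idx in *; lia).
        rewrite K4 by (unfold ptr in *; lia). rewrite K3 by (unfold ptr in *; lia).
        rewrite G1 by (unfold ptr, cnt in *; lia). auto.
    + intros st' l (k & F1 & F2 & F3 & F4 & F5). simpl in F1.
      assert (E1' : upd st' (cnt n) l (ptr n) = SE :: rest) by (rewrite upd_ne by (unfold ptr, cnt; lia); exact F1).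
      unfold for_body. cbn [run]. rewrite E1'. cbn [hd_error run].
      exists k. rewrite !upd_ne by (unfold ptr, cnt, idx; lia). repeat split; try assumption.
      intros r H1 H2 H3. rewrite upd_ne by (unfold ptr, cnt in *; lia). auto.
    + intros st' (k & F1 & F2 & F3 & F4 & F5). exists k.
      rewrite !upd_ne by (unfold ptr, cnt, idx; lia). repeat split; try assumption.
      intros r H1 H2 H3. rewrite upd_ne by (unfold ptr, cnt in *; lia). auto.
    + rewrite E3 by (unfold ptr; lia). rewrite H0.
      assert (HL : length x <= length (encs (flat_map (to_trees a) x))).
      { clear - Hit. induction x as [|y x IHx]; [simpl; lia|]. cbn [flat_map].
        rewrite encs_app, length_app. destruct (item_head a y Hit) as (s & l & -> & _). simpl. lia. }
      rewrite Hp in Hl. simpl in Hl. rewrite length_app in Hl. clear - HL Hl. unfold den in *. fold den in *. lia.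
    + exists 0. rewrite E1, E2. rewrite (E3 1) by (unfold ptr; lia). repeat split.
      * rewrite Hp in Hl. simpl in Hl. lia.
      * lia.
      * intros r H1 _ _. auto.
  - cbn [tcomp]. destruct (nth_error G v) as [[|c| |]|] eqn:Ev; try discriminate.
    destruct (comp_at c k) as [a|] eqn:Ek; [|discriminate].
    pose proof HI as (H0 & He & Hg). destruct (Hg v _ Ev) as (_ & Hok & x & rest & Ht & Hp & Hl & _).
    cbn [to_trees] in Ht. injection Ht as Ht. cbn [sch_ok] in Hok.
    cbn [sem]. rewrite <- Ht in Hp |- *. cbn [kids].
    rewrite enc_node in Hp. cbn [app] in Hp. rewrite <- app_assoc in Hp. cbn [app] in Hp.
    pose proof (nth_error_lt _ _ _ Ev) as Hlt. set (n := length G) in *.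
    cbn [run]. set (st1 := upd (upd st _ _) _ _).
    assert (E1 : st1 (ptr n) = encs (to_trees c x) ++ SE :: rest).
    { unfold st1. rewrite !upd_eq, Hp. reflexivity. }
    assert (E3 : forall r, r < ptr n -> st1 r = st r).
    { intros r Hr. unfold st1. rewrite !upd_ne by (unfold ptr, idx in *; lia). reflexivity. }
    assert (L1 : length (st1 (ptr n)) <= length (st1 0)).
    { rewrite E1, E3 by (unfold ptr; lia). rewrite Hp in Hl. simpl in Hl. lia. }
    destruct (skip_sem c (ptr n) ltac:(unfold ptr; lia) Hok k a Ek (ptr (S n)) x st1 _
      ltac:(unfold ptr; lia) E1 L1) as (y & t & r' & A1 & A2 & A3 & A4 & A5 & A6).
    set (st2 := run (skip c k (ptr n) (ptr (S n))) st1) in *.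
    assert (K2 : forall r, r < ptr (S n) -> r <> ptr n -> r <> 3 -> st2 r = st1 r).
    { intros r H1 H2 H3. apply run_keeps, keeps_skip; trivial. }
    rewrite (nth_error_nth _ _ _ A3).
    set (st3 := upd st2 (idx n) (st2 0)).
    rewrite (IH (G ++ [a]) (e ++ [(0, t)]) st3 Hw).
    + f_equal. unfold st3. rewrite upd_ne by (unfold idx; lia). rewrite K2 by (unfold ptr; lia).
      apply E3. unfold ptr; lia.
    + assert (HE : forall r, r < ptr n -> r <> 1 -> r <> 3 -> st3 r = st r).
      { intros r H1 H2 H3. unfold st3. rewrite upd_ne by (unfold ptr, idx in *; lia).
        rewrite K2 by (unfold ptr in *; lia). auto. }
      eapply inv_snoc; try eassumption; fold n.
      * eapply inv_frame; [exact HI|exact HE].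
      * unfold st3. rewrite upd_ne by (unfold ptr, idx; lia). exact A5.
      * unfold st3. rewrite upd_ne by (unfold ptr, idx; lia). etransitivity; [exact A6|].
        etransitivity; [exact L1|]. rewrite E3 by (unfold ptr; lia). lia.
      * unfold st3. rewrite upd_eq. rewrite K2 by (unfold ptr; lia). rewrite E3 by (unfold ptr; lia). lia.
  - destruct (nth_error G v) as [[| | |]|] eqn:Ev; try discriminate.
    pose proof HI as (H0 & He & Hg). destruct (Hg v _ Ev) as (_ & _ & x & rest & Ht & Hp & Hl & _).
    cbn [to_trees] in Ht. injection Ht as Ht. cbn [sem]. rewrite <- Ht in Hp |- *. cbn [leafv].
    rewrite enc_leaf in Hp. cbn [app] in Hp. rewrite <- app_assoc in Hp. cbn [app] in Hp.
    pose proof (nth_error_lt _ _ _ Ev) as Hlt. set (n := length G) in *.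
    cbn [tcomp run]. fold n. set (st1 := upd (upd st _ _) _ _).
    assert (E1 : st1 (ptr n) = map b2s (bits x) ++ SE :: rest).
    { unfold st1. rewrite !upd_eq, Hp. reflexivity. }
    assert (E3 : forall r, r < ptr n -> st1 r = st r).
    { intros r Hr. unfold st1. rewrite !upd_ne by (unfold ptr, idx in *; lia). reflexivity. }
    set (R := fun (xs : list bool) st' => st' (ptr n) = map b2s xs ++ SE :: rest /\
      st' 1 ++ flat_map f xs = st 1 ++ flat_map f (bits x)).
    enough (HR : R [] (rep (run (bit_body (ptr n) f)) (cnt n) (st1 0) st1)).
    { destruct HR as (_ & HR). cbn [flat_map] in HR. now rewrite app_nil_r in HR. }
    assert (Hpc : ptr n <> cnt n) by (unfold ptr, cnt; lia).
    assert (H1p : 1 <> ptr n) by (unfold ptr; lia).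
    assert (H1c : 1 <> cnt n) by (unfold cnt; lia).
    apply (rep_consume R) with (xs := bits x); unfold R.
    + intros y ys st' l (F1 & F2). unfold bit_body. cbn [run].
      rewrite (upd_ne st' (cnt n) (ptr n) l Hpc), F1.
      destruct y; cbn [map b2s app hd_error run]; rewrite !upd_eq, !upd_ne by auto;
        rewrite upd_eq, !upd_ne by auto; rewrite ?F1; cbn [map b2s app tl]; (split; [reflexivity|]);
        rewrite <- F2; cbn [flat_map]; now rewrite app_assoc.
    + intros st' l (F1 & F2). unfold bit_body. cbn [run].
      rewrite (upd_ne st' (cnt n) (ptr n) l Hpc), F1. cbn [map app hd_error run].
      rewrite !upd_ne by auto. auto.
    + intros st' (F1 & F2). rewrite !upd_ne by auto. auto.
    + rewrite E3 by (unfold ptr; lia). rewrite H0. rewrite Hp in Hl. simpl in Hl.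
      rewrite length_app, length_map in Hl. lia.
    + split; [exact E1|]. rewrite E3 by (unfold ptr; lia). reflexivity.
  - destruct (nth_error G v) as [s|] eqn:Ev; try discriminate.
    pose proof HI as (H0 & He & Hg). destruct (Hg v _ Ev) as (_ & _ & x & rest & _ & _ & _ & Hl).
    pose proof (nth_error_lt _ _ _ Ev) as Hlt. set (n := length G) in *.
    cbn [tcomp run sem]. fold n. set (st1 := upd st _ _).
    assert (Hpc : ptr n <> cnt n) by (unfold ptr, cnt; lia).
    assert (H1p : 1 <> ptr n) by (unfold ptr; lia).
    assert (H1c : 1 <> cnt n) by (unfold cnt; lia).
    set (R := fun (xs : list sym) st' => st' (ptr n) = xs /\
      st' 1 ++ concat (repeat l (length xs)) = st 1 ++ concat (repeat l (N - fst (get e v)))).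
    enough (HR : R [] (rep (run (un_body (ptr n) l)) (cnt n) (st1 0) st1)).
    { destruct HR as (_ & HR). cbn in HR. now rewrite app_nil_r in HR. }
    apply (rep_consume R) with (xs := st (idx v)); unfold R.
    + intros y ys st' l' (F1 & F2). unfold un_body. cbn [run].
      rewrite (upd_ne st' (cnt n) (ptr n) l' Hpc), F1. cbn [hd_error run].
      rewrite !upd_eq, !upd_ne by auto. rewrite upd_eq, !upd_ne by auto.
      rewrite F1. cbn [tl]. split; [reflexivity|]. rewrite <- F2. cbn [length repeat concat].
      now rewrite app_assoc.
    + intros st' l' (F1 & F2). unfold un_body. cbn [run].
      rewrite (upd_ne st' (cnt n) (ptr n) l' Hpc), F1. cbn [hd_error run].
      rewrite !upd_ne by auto. auto.
    + intros st' (F1 & F2). rewrite !upd_ne by auto. auto.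
    + unfold st1. rewrite upd_ne by (unfold ptr; lia). lia.
    + unfold st1. rewrite upd_eq, upd_ne by auto. rewrite Hl. auto.
  - pose proof HI as (H0 & _). cbn [tcomp run sem]. set (n := length G).
    assert (H1c : 1 <> cnt n) by (unfold cnt; lia).
    rewrite <- H0. clear - H1c. generalize (st 0). intros w. revert st.
    induction w as [|a w IH]; intros st; cbn [rep length repeat concat].
    + rewrite upd_ne by auto. now rewrite app_nil_r.
    + rewrite IH. cbn [run]. rewrite upd_eq, upd_ne by auto. now rewrite app_assoc.
Qed.

(** * Formula templates *)

Inductive ncomp : Set := NLeaf (v : nat) | NIdx (v : nat).

(* Sums, products and quantifiers range over the children of an input node;
   [TLet v k b] binds the k-th child of v. *)
Inductive ttm : Set :=
| TVar (tag : nat) (cs : list ncomp)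
| TConst (v : nat)
| TIdx (v : nat)
| TZero
| TOne
| TAdd (a b : ttm)
| TSub (a b : ttm)
| TMul (a b : ttm)
| TSum (v : nat) (b : ttm)
| TProd (v : nat) (b : ttm)
| TLet (v k : nat) (b : ttm).

Inductive tfm : Set :=
| MEq (a b : ttm)
| MLe (a b : ttm)
| MLt (a b : ttm)
| MNot (f : tfm)
| MAnd (f g : tfm)
| MOr (f g : tfm)
| MAll (v : nat) (f : tfm)
| MEx (v : nat) (f : tfm)
| MLet (v k : nat) (f : tfm).

Definition kid (e : env) (v k : nat) : nat * tree := (0, nth k (kids (snd (get e v))) (Leaf 0)).

Definition comp_bits (N : nat) (e : env) (c : ncomp) : list bool :=
  match c with
  | NLeaf v => bits (leafv (snd (get e v)))
  | NIdx v => repeat true (N - fst (get e v))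
  end.

(** Each digit is preceded by 1 and each component closed by 0, so components can be strung
    together, decoded uniquely, and printed digit by digit without knowing their lengths. In [code]
    the leading 1 makes the word a canonical numeral, and the tag is a first component in unary. *)
Definition delimit (nm : list (list bool)) : list bool :=
  flat_map (fun l => flat_map (fun b => [true; b]) l ++ [false]) nm.

Definition code (tag : nat) (nm : list (list bool)) : nat :=
  bval (true :: delimit (repeat true tag :: nm)).

Definition two : eterm := EAdd EOne EOne.
Definition ebit (b : bool) : eterm := if b then EOne else EZero.
(** Constants other than 0 and 1 have to be built. Doubling by a factor [two] mentions [t] only
    once, so the term is linear in the number of digits, whereas [t + t] would make it
    exponential. *)
Definition horner (l : list bool) : eterm :=
  fold_left (fun t b => EAdd (EMul two t) (ebit b)) l EZero.
Definition ones (k : nat) : eterm := fold_left (fun t (_ : unit) => EAdd t EOne) (repeat tt k) EZero.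

(** [TIdx] is a difference of two unary numbers, [N] and [N - i], because a position is only
    available as [N - i] marks. *)
Fixpoint tden (N : nat) (e : env) (t : ttm) : eterm :=
  match t with
  | TVar tag cs => EVar (code tag (map (comp_bits N e) cs))
  | TConst v => horner (bits (leafv (snd (get e v))))
  | TIdx v => ESub (ones N) (ones (N - fst (get e v)))
  | TZero => EZero
  | TOne => EOne
  | TAdd a b => EAdd (tden N e a) (tden N e b)
  | TSub a b => ESub (tden N e a) (tden N e b)
  | TMul a b => EMul (tden N e a) (tden N e b)
  | TSum v b => fold_left (fun acc it => EAdd acc (tden N (e ++ [it]) b))
                  (zipi 0 (kids (snd (get e v)))) EZero
  | TProd v b => fold_left (fun acc it => EMul acc (tden N (e ++ [it]) b))
                  (zipi 0 (kids (snd (get e v)))) EOne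
  | TLet v k b => tden N (e ++ [kid e v k]) b
  end.

Fixpoint fden (N : nat) (e : env) (f : tfm) : eform :=
  match f with
  | MEq a b => FEq (tden N e a) (tden N e b)
  | MLe a b => FLe (tden N e a) (tden N e b)
  | MLt a b => FLt (tden N e a) (tden N e b)
  | MNot f => FNot (fden N e f)
  | MAnd f g => FAnd (fden N e f) (fden N e g)
  | MOr f g => FOr (fden N e f) (fden N e g)
  | MAll v f => fold_left (fun acc it => FAnd acc (fden N (e ++ [it]) f))
                  (zipi 0 (kids (snd (get e v)))) (FEq EZero EZero)
  | MEx v f => fold_left (fun acc it => FOr acc (fden N (e ++ [it]) f))
                  (zipi 0 (kids (snd (get e v)))) (FLt EZero EZero)
  | MLet v k f => fden N (e ++ [kid e v k]) f
  end.

Definition op (k : nat) : list sym := SN :: enc_tree (Leaf k).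
Definition pre (t : eterm) : list sym := enc_tree (tr_eterm t).

(* Iterated binary operations print as: one opening per element, the base
   case, then every operand with its closing symbol. *)
Definition pfold (v k : nat) (base : list sym) (b : tmpl) : tmpl :=
  PSeq (PFor v (POut (op k))) (PSeq (POut base) (PFor v (PSeq b (POut [SE])))).

Definition pcomp (c : ncomp) : tmpl :=
  match c with
  | NLeaf v => PSeq (PBits v (fun b => [S1; b2s b])) (POut [S0])
  | NIdx v => PSeq (PUn v [S1; S1]) (POut [S0])
  end.

Definition pseq (l : list tmpl) : tmpl := fold_right PSeq (POut []) l.

Fixpoint tprint (t : ttm) : tmpl :=
  match t with
  | TVar tag cs =>
      PSeq (POut (op 0 ++ [SL; S1] ++ map b2s (delimit [repeat true tag])))
        (PSeq (pseq (map pcomp cs)) (POut [SE; SE]))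
  | TConst v =>
      PSeq (PBits v (fun _ => op 3 ++ op 5 ++ pre two))
        (PSeq (POut (pre EZero)) (PBits v (fun b => SE :: pre (ebit b) ++ [SE])))
  | TIdx v =>
      pseq [POut (op 4); PAll (op 3); POut (pre EZero); PAll (pre EOne ++ [SE]);
            PUn v (op 3); POut (pre EZero); PUn v (pre EOne ++ [SE]); POut [SE]]
  | TZero => POut (pre EZero)
  | TOne => POut (pre EOne)
  | TAdd a b => pseq [POut (op 3); tprint a; tprint b; POut [SE]]
  | TSub a b => pseq [POut (op 4); tprint a; tprint b; POut [SE]]
  | TMul a b => pseq [POut (op 5); tprint a; tprint b; POut [SE]]
  | TSum v b => pfold v 3 (pre EZero) (tprint b)
  | TProd v b => pfold v 5 (pre EOne) (tprint b)
  | TLet v k b => PProj v k (tprint b)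
  end.

Fixpoint fprint (f : tfm) : tmpl :=
  match f with
  | MEq a b => pseq [POut (op 0); tprint a; tprint b; POut [SE]]
  | MLe a b => pseq [POut (op 1); tprint a; tprint b; POut [SE]]
  | MLt a b => pseq [POut (op 2); tprint a; tprint b; POut [SE]]
  | MNot f => pseq [POut (op 3); fprint f; POut [SE]]
  | MAnd f g => pseq [POut (op 4); fprint f; fprint g; POut [SE]]
  | MOr f g => pseq [POut (op 5); fprint f; fprint g; POut [SE]]
  | MAll v f => pfold v 4 (enc_tree (tr_eform (FEq EZero EZero))) (fprint f)
  | MEx v f => pfold v 5 (enc_tree (tr_eform (FLt EZero EZero))) (fprint f)
  | MLet v k f => PProj v k (fprint f)
  end.

Lemma enc_bin k a b : enc_tree (Node [Leaf k; a; b]) = op k ++ enc_tree a ++ enc_tree b ++ [SE].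
Proof. rewrite enc_node, !encs_cons. unfold op, encs. simpl. now rewrite <- !app_assoc. Qed.

Lemma enc_fold {A} k (f : A -> tree) (xs : list A) : forall base,
  enc_tree (fold_left (fun acc x => Node [Leaf k; acc; f x]) xs base)
  = flat_map (fun _ => op k) xs ++ enc_tree base ++ flat_map (fun x => enc_tree (f x) ++ [SE]) xs.
Proof.
  induction xs as [|x xs IH]; intros base; cbn [flat_map fold_left app].
  - now rewrite app_nil_r.
  - rewrite IH, enc_bin.
    assert (H : forall l, flat_map (fun _ => op k) xs ++ op k ++ l = op k ++ flat_map (fun _ => op k) xs ++ l).
    { clear. induction xs as [|x xs IH]; intros l; cbn [flat_map app]; [reflexivity|].
      rewrite <- !app_assoc, IH. reflexivity. }
    rewrite <- !app_assoc, H. reflexivity.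
Qed.

Lemma fold_left_morph {A B C} (h : B -> C) (f : B -> A -> B) (g : C -> A -> C) :
  (forall b a, h (f b a) = g (h b) a) -> forall l b, h (fold_left f l b) = fold_left g l (h b).
Proof. intros H. induction l as [|a l IH]; intros b; simpl; [reflexivity|]. now rewrite IH, H. Qed.

Lemma flat_map_const {A B} (l : list A) (w : list B) : flat_map (fun _ => w) l = concat (repeat w (length l)).
Proof. induction l; simpl; congruence. Qed.

Lemma pre_add a b : pre (EAdd a b) = op 3 ++ pre a ++ pre b ++ [SE].
Proof. apply enc_bin. Qed.
Lemma pre_sub a b : pre (ESub a b) = op 4 ++ pre a ++ pre b ++ [SE].
Proof. apply enc_bin. Qed.
Lemma pre_mul a b : pre (EMul a b) = op 5 ++ pre a ++ pre b ++ [SE].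
Proof. apply enc_bin. Qed.

Lemma pre_horner l : pre (horner l) =
  flat_map (fun _ => op 3 ++ op 5 ++ pre two) l ++ pre EZero ++ flat_map (fun b => SE :: pre (ebit b) ++ [SE]) l.
Proof.
  unfold horner. generalize EZero. induction l as [|b l IH]; intros t; cbn [flat_map fold_left app].
  - now rewrite app_nil_r.
  - rewrite IH, pre_add, pre_mul.
    assert (H : forall w, flat_map (fun _ => op 3 ++ op 5 ++ pre two) l ++ op 3 ++ op 5 ++ pre two ++ w
      = op 3 ++ op 5 ++ pre two ++ flat_map (fun _ => op 3 ++ op 5 ++ pre two) l ++ w).
    { clear. induction l as [|x xs IH]; intros w; cbn [flat_map app]; [reflexivity|].
      rewrite <- !app_assoc, IH. reflexivity. }
    rewrite <- !app_assoc, H. cbn [app]. rewrite <- ?app_assoc. reflexivity.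
Qed.

Lemma pre_ones k : pre (ones k) =
  concat (repeat (op 3) k) ++ pre EZero ++ concat (repeat (pre EOne ++ [SE]) k).
Proof.
  unfold pre at 1, ones.
  rewrite (fold_left_morph tr_eterm _ (fun acc (_ : unit) => Node [Leaf 3; acc; tr_eterm EOne])) by reflexivity.
  rewrite (enc_fold 3 (fun _ : unit => tr_eterm EOne)), !flat_map_const, repeat_length. reflexivity.
Qed.

Lemma sem_pseq N e l : sem N e (pseq l) = flat_map (sem N e) l.
Proof. induction l; simpl; congruence. Qed.

Lemma map_flat_map {A B C} (f : B -> C) (g : A -> list B) l :
  map f (flat_map g l) = flat_map (fun x => map f (g x)) l.
Proof. induction l; simpl; [reflexivity|]. now rewrite map_app, IHl. Qed.

Lemma sem_pcomp N e c :
  sem N e (pcomp c) = map b2s (flat_map (fun b => [true; b]) (comp_bits N e c) ++ [false]).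
Proof.
  rewrite map_app, map_flat_map. destruct c as [v|v]; simpl; f_equal.
  generalize (N - fst (get e v)). intros k. induction k; simpl; congruence.
Qed.

Lemma delimit_cons l nm : delimit (l :: nm) = delimit [l] ++ delimit nm.
Proof. unfold delimit. simpl. now rewrite app_nil_r. Qed.

Lemma sem_tprint N t : forall e, sem N e (tprint t) = pre (tden N e t).
Proof.
  induction t as [tag cs|v|v| | |a IHa b IHb|a IHa b IHb|a IHa b IHb|v b IH|v b IH|v k b IH]; intros e;
    cbn [tprint tden]; try reflexivity; try apply IH.
  - cbn [sem]. rewrite sem_pseq. unfold pre; cbn [tr_eterm].
    rewrite enc_node, encs_cons, encs_one, enc_leaf.
    rewrite (enc_leaf (code _ _)). unfold code. rewrite bits_bval, delimit_cons, map_cons, map_app.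
    assert (HC : flat_map (sem N e) (map pcomp cs) = map b2s (delimit (map (comp_bits N e) cs))).
    { unfold delimit. rewrite map_flat_map. induction cs as [|c cs IH]; [reflexivity|].
      cbn [map flat_map]. now rewrite sem_pcomp, IH. }
    rewrite HC. unfold op. rewrite enc_leaf. simpl. rewrite <- !app_assoc. simpl.
    rewrite ?app_nil_r, ?map_app, <- ?app_assoc. reflexivity.
  - cbn [sem]. now rewrite pre_horner.
  - rewrite sem_pseq. cbn [flat_map sem]. 
    rewrite pre_sub, !pre_ones, app_nil_r, <- !app_assoc. reflexivity.
  - rewrite sem_pseq. cbn [flat_map sem]. rewrite IHa, IHb, app_nil_r.
    now rewrite ?pre_add, ?pre_sub, ?pre_mul.
  - rewrite sem_pseq. cbn [flat_map sem]. rewrite IHa, IHb, app_nil_r.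
    now rewrite ?pre_add, ?pre_sub, ?pre_mul.
  - rewrite sem_pseq. cbn [flat_map sem]. rewrite IHa, IHb, app_nil_r.
    now rewrite ?pre_add, ?pre_sub, ?pre_mul.
  - cbn [pfold sem]. unfold pre at 2.
    rewrite (fold_left_morph tr_eterm _ (fun acc it => Node [Leaf 3; acc; tr_eterm (tden N (e ++ [it]) b)])) by reflexivity.
    rewrite (enc_fold 3 (fun it => tr_eterm (tden N (e ++ [it]) b))). do 2 f_equal.
    apply flat_map_ext. intros it. now rewrite IH.
  - cbn [pfold sem]. unfold pre at 2.
    rewrite (fold_left_morph tr_eterm _ (fun acc it => Node [Leaf 5; acc; tr_eterm (tden N (e ++ [it]) b)])) by reflexivity.
    rewrite (enc_fold 5 (fun it => tr_eterm (tden N (e ++ [it]) b))). do 2 f_equal.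
    apply flat_map_ext. intros it. now rewrite IH.
Qed.

Lemma sem_fprint N f : forall e, sem N e (fprint f) = enc_tree (tr_eform (fden N e f)).
Proof.
  induction f as [a b|a b|a b|f IH|f IHf g IHg|f IHf g IHg|v f IH|v f IH|v k f IH]; intros e;
    cbn [fprint fden]; try apply IH.
  1-3: rewrite sem_pseq; cbn [flat_map sem]; rewrite !sem_tprint, app_nil_r; cbn [tr_eform];
    now rewrite enc_bin.
  - rewrite sem_pseq; cbn [flat_map sem]. rewrite IH, app_nil_r; cbn [tr_eform].
    rewrite enc_node, encs_cons, encs_one. unfold op. simpl. now rewrite <- ?app_assoc.
  - rewrite sem_pseq. cbn [flat_map sem]. rewrite IHf, IHg, app_nil_r. cbn [tr_eform]. now rewrite enc_bin.
  - rewrite sem_pseq. cbn [flat_map sem]. rewrite IHf, IHg, app_nil_r. cbn [tr_eform]. now rewrite enc_bin.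
  - cbn [pfold sem].
    rewrite (fold_left_morph tr_eform _ (fun acc it => Node [Leaf 4; acc; tr_eform (fden N (e ++ [it]) f)])) by reflexivity.
    rewrite (enc_fold 4 (fun it => tr_eform (fden N (e ++ [it]) f))). do 2 f_equal.
    apply flat_map_ext. intros it. now rewrite IH.
  - cbn [pfold sem].
    rewrite (fold_left_morph tr_eform _ (fun acc it => Node [Leaf 5; acc; tr_eform (fden N (e ++ [it]) f)])) by reflexivity.
    rewrite (enc_fold 5 (fun it => tr_eform (fden N (e ++ [it]) f))). do 2 f_equal.
    apply flat_map_ext. intros it. now rewrite IH.
Qed.

(* Turns a valuation of variable names into one of variable indices. *)
Fixpoint undelimit (acc : list bool) (l : list bool) : list (list bool) :=
  match l with
  | true :: b :: l' => undelimit (acc ++ [b]) l'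
  | false :: l' => acc :: undelimit [] l'
  | _ => []
  end.

Lemma undelimit_spec nm : undelimit [] (delimit nm) = nm.
Proof.
  induction nm as [|l nm IH]; [reflexivity|]. simpl. rewrite <- app_assoc. simpl.
  assert (H : forall acc, undelimit acc (flat_map (fun b => [true; b]) l ++ false :: delimit nm)
    = (acc ++ l) :: nm).
  { induction l as [|b l IHl]; intros acc; simpl.
    - now rewrite IH, app_nil_r.
    - rewrite IHl, <- app_assoc. reflexivity. }
  apply H.
Qed.

Lemma bval_repeat_false K : bval (true :: repeat false K) = 2 ^ K.
Proof.
  induction K as [|K IH]; [reflexivity|].
  replace (true :: repeat false (S K)) with ((true :: repeat false K) ++ [false]).
  - rewrite bval_snoc, IH, Nat.pow_succ_r'. unfold Nat.b2n. lia.
  - simpl. now rewrite repeat_cons.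
Qed.

Lemma bval_bound l : bval l < 2 ^ length l.
Proof.
  induction l as [|b l IH] using rev_ind; [apply Nat.lt_0_1|].
  rewrite bval_snoc, length_app, Nat.add_1_r, Nat.pow_succ_r'.
  destruct b; unfold Nat.b2n; lia.
Qed.

(** * Truth of templates under a valuation of variable names *)

Definition valuation : Type := nat -> list (list bool) -> R.

Fixpoint tval (rho : valuation) (N : nat) (e : env) (t : ttm) : R :=
  match t with
  | TVar tag cs => rho tag (map (comp_bits N e) cs)
  | TConst v => INR (leafv (snd (get e v)))
  | TIdx v => INR (fst (get e v))
  | TZero => 0
  | TOne => 1
  | TAdd a b => tval rho N e a + tval rho N e b
  | TSub a b => tval rho N e a - tval rho N e b
  | TMul a b => tval rho N e a * tval rho N e b
  | TSum v b => sumR (map (fun it => tval rho N (e ++ [it]) b) (zipi 0 (kids (snd (get e v)))))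
  | TProd v b => prodR (map (fun it => tval rho N (e ++ [it]) b) (zipi 0 (kids (snd (get e v)))))
  | TLet v k b => tval rho N (e ++ [kid e v k]) b
  end%R.

Fixpoint fval (rho : valuation) (N : nat) (e : env) (f : tfm) : Prop :=
  match f with
  | MEq a b => tval rho N e a = tval rho N e b
  | MLe a b => (tval rho N e a <= tval rho N e b)%R
  | MLt a b => (tval rho N e a < tval rho N e b)%R
  | MNot f => ~ fval rho N e f
  | MAnd f g => fval rho N e f /\ fval rho N e g
  | MOr f g => fval rho N e f \/ fval rho N e g
  | MAll v f => forall i t, nth_error (kids (snd (get e v))) i = Some t -> fval rho N (e ++ [(i, t)]) f
  | MEx v f => exists i t, nth_error (kids (snd (get e v))) i = Some t /\ fval rho N (e ++ [(i, t)]) f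
  | MLet v k f => fval rho N (e ++ [kid e v k]) f
  end.

(** Bounded positions make [N - i] determine [i], and bounded encodings limit the length of variable
    names. [2 <= N] covers the default subtree [Leaf 0], whose encoding has two symbols. *)
Definition env_ok (N : nat) (e : env) : Prop :=
  2 <= N /\ List.Forall (fun it => fst it <= N /\ length (enc_tree (snd it)) <= N) e.

Lemma env_ok_get N e v : env_ok N e ->
  fst (get e v) <= N /\ length (enc_tree (snd (get e v))) <= N.
Proof.
  intros [HN H]. unfold get. destruct (nth_in_or_default v e (0, Leaf 0)) as [Hi | ->].
  - rewrite Forall_forall in H. now apply H.
  - unfold enc_tree; simpl. lia.
Qed.

Lemma env_ok_snoc N e i t : env_ok N e -> i <= N -> length (enc_tree t) <= N -> env_ok N (e ++ [(i, t)]).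
Proof. intros [HN H] Hi Ht. split; [assumption|]. apply Forall_app. auto. Qed.

(** Each earlier sibling contributes at least one symbol, so the input length bounds positions as
    well as sizes. *)
Lemma enc_kid_lt t i u : nth_error (kids t) i = Some u ->
  i + length (enc_tree u) < length (enc_tree t).
Proof.
  destruct t as [n|ts]; cbn [kids]; intros H; [destruct i; discriminate|].
  rewrite enc_node. cbn [length]. rewrite length_app.
  enough (i + length (enc_tree u) <= length (encs ts)) by lia.
  revert i H. induction ts as [|t ts IH]; intros [|i]; cbn [nth_error]; try discriminate; intros H;
    rewrite encs_cons, length_app.
  - injection H as ->. lia.
  - specialize (IH i H).
    assert (0 < length (enc_tree t)) by (destruct t; [rewrite enc_leaf|rewrite enc_node]; simpl; lia).
    lia.
Qed.

Lemma env_ok_kids N e v i t : env_ok N e -> nth_error (kids (snd (get e v))) i = Some t ->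
  env_ok N (e ++ [(i, t)]).
Proof.
  intros He Ht. apply enc_kid_lt in Ht. destruct (env_ok_get N e v He).
  apply env_ok_snoc; [assumption|lia|lia].
Qed.

Lemma env_ok_kid N e v k : env_ok N e -> env_ok N (e ++ [kid e v k]).
Proof.
  intros He. destruct (env_ok_get N e v He) as [_ H]. unfold kid.
  destruct (nth_error (kids (snd (get e v))) k) as [t|] eqn:E.
  - rewrite (nth_error_nth _ _ _ E). apply enc_kid_lt in E. apply env_ok_snoc; [assumption|lia|lia].
  - rewrite nth_overflow by (now apply nth_error_None). apply env_ok_snoc; [assumption|lia|].
    destruct He. unfold enc_tree; simpl. lia.
Qed.

Lemma in_zipi {A} (l : list A) : forall k i x, In (i, x) (zipi k l) <->
  k <= i /\ nth_error l (i - k) = Some x.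
Proof.
  induction l as [|a l IH]; intros k i x; unfold zipi in *; simpl.
  - split; [tauto|]. intros [_ H]. destruct (i - k); discriminate.
  - rewrite IH. split.
    + intros [H|[H1 H2]].
      * injection H as -> ->. rewrite Nat.sub_diag. auto.
      * split; [lia|]. replace (i - k) with (S (i - S k)) by lia. exact H2.
    + intros [H1 H2]. destruct (Nat.eq_dec i k) as [->|Hne].
      * rewrite Nat.sub_diag in H2. injection H2 as ->. auto.
      * right. split; [lia|]. replace (i - k) with (S (i - S k)) in H2 by lia. exact H2.
Qed.

Lemma env_ok_zipi N e v it : env_ok N e -> In it (zipi 0 (kids (snd (get e v)))) -> env_ok N (e ++ [it]).
Proof.
  destruct it as [i t]. intros He Hi. apply in_zipi in Hi as [_ Hi]. rewrite Nat.sub_0_r in Hi.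
  eapply env_ok_kids; eassumption.
Qed.

Lemma eval_horner x l : eterm_eval x (horner l) = INR (bval l).
Proof.
  induction l as [|b l IH] using rev_ind; [reflexivity|].
  unfold horner in *. rewrite fold_left_app, bval_snoc, plus_INR, mult_INR, <- IH.
  replace (INR 2) with 2%R by (simpl; lra).
  destruct b; simpl; lra.
Qed.

Lemma eval_ones x k : eterm_eval x (ones k) = INR k.
Proof.
  induction k as [|k IH]; [reflexivity|]. unfold ones in *.
  replace (repeat tt (S k)) with (repeat tt k ++ [tt]) by (simpl; now rewrite <- repeat_cons).
  rewrite fold_left_app. simpl fold_left at 1. rewrite S_INR, <- IH. reflexivity.
Qed.

(** Relating [x] and [rho] by an equation serves both directions of the reduction: [x] can be built
    from [rho] by decoding variable numbers, and [rho] can be read off [x]. *)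
Lemma eval_tden (x : nat -> R) (rho : valuation) N t :
  (forall tag nm, x (code tag nm) = rho tag nm) ->
  forall e, env_ok N e -> eterm_eval x (tden N e t) = tval rho N e t.
Proof.
  intros Hx. induction t as [tag cs|v|v| | |a IHa b IHb|a IHa b IHb|a IHa b IHb|v b IH|v b IH|v k b IH];
    intros e He; simpl; auto.
  - now rewrite eval_horner, bval_bits.
  - destruct (env_ok_get N e v He). rewrite !eval_ones, minus_INR by assumption. lra.
  - now rewrite IHa, IHb.
  - now rewrite IHa, IHb.
  - now rewrite IHa, IHb.
  - rewrite (fold_left_morph (eterm_eval x) _ (fun r it => (r + eterm_eval x (tden N (e ++ [it]) b))%R))
      by reflexivity. simpl eterm_eval.
    assert (Hin : forall it, In it (zipi 0 (kids (snd (get e v)))) -> env_ok N (e ++ [it]))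
      by (intros; eapply env_ok_zipi; eassumption).
    revert Hin. generalize (zipi 0 (kids (snd (get e v)))). intros l Hin.
    rewrite <- (Rplus_0_l (sumR _)). generalize 0%R. induction l as [|it l IHl]; intros r; simpl; [lra|].
    rewrite IHl by (intros; apply Hin; now right). rewrite IH by (apply Hin; now left). lra.
  - rewrite (fold_left_morph (eterm_eval x) _ (fun r it => (r * eterm_eval x (tden N (e ++ [it]) b))%R))
      by reflexivity. simpl eterm_eval.
    assert (Hin : forall it, In it (zipi 0 (kids (snd (get e v)))) -> env_ok N (e ++ [it]))
      by (intros; eapply env_ok_zipi; eassumption).
    revert Hin. generalize (zipi 0 (kids (snd (get e v)))). intros l Hin.
    rewrite <- (Rmult_1_l (prodR _)). generalize 1%R at 1 2. induction l as [|it l IHl]; intros r; simpl; [lra|].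
    rewrite IHl by (intros; apply Hin; now right). rewrite IH by (apply Hin; now left). lra.
  - apply IH, env_ok_kid, He.
Qed.

Lemma eval_fden (x : nat -> R) (rho : valuation) N f :
  (forall tag nm, x (code tag nm) = rho tag nm) ->
  forall e, env_ok N e -> eform_holds x (fden N e f) <-> fval rho N e f.
Proof.
  intros Hx. induction f as [a b|a b|a b|f IH|f IHf g IHg|f IHf g IHg|v f IH|v f IH|v k f IH];
    intros e He; simpl; rewrite ?(eval_tden x rho) by assumption; try tauto.
  - now rewrite IH.
  - now rewrite IHf, IHg.
  - now rewrite IHf, IHg.
  - assert (H : forall l b, eform_holds x (fold_left (fun acc it => FAnd acc (fden N (e ++ [it]) f)) l b)
      <-> eform_holds x b /\ forall it, In it l -> eform_holds x (fden N (e ++ [it]) f)).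
    { clear. induction l as [|it l IH]; intros b; simpl.
      - split; [|tauto]. intros H; split; [exact H|]. intros _ [].
      - rewrite IH. simpl. split.
        + intros [[H1 H2] H3]. split; [exact H1|]. intros it' [->|H]; auto.
        + intros [H1 H2]. repeat split; auto. }
    rewrite H. simpl. split.
    + intros [_ HA] i t Ht. apply IH; [eapply env_ok_kids; eassumption|].
      apply HA, in_zipi. rewrite Nat.sub_0_r. auto with arith.
    + intros HA. split; [reflexivity|]. intros [i t] Ht.
      pose proof (env_ok_zipi _ _ _ _ He Ht). apply in_zipi in Ht as [_ Ht]. rewrite Nat.sub_0_r in Ht.
      apply IH; auto.
  - assert (H : forall l b, eform_holds x (fold_left (fun acc it => FOr acc (fden N (e ++ [it]) f)) l b)
      <-> eform_holds x b \/ exists it, In it l /\ eform_holds x (fden N (e ++ [it]) f)).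
    { clear. induction l as [|it l IH]; intros b; simpl.
      - split; [tauto|]. intros [H|(it & [] & _)]; exact H.
      - rewrite IH. simpl. split.
        + intros [[H1|H1]|(it' & H1 & H2)]; eauto.
        + intros [H1|(it' & [->|H1] & H2)]; eauto. }
    rewrite H. simpl. split.
    + intros [HF|([i t] & Ht & Hf)]; [lra|].
      pose proof (env_ok_zipi _ _ _ _ He Ht). apply in_zipi in Ht as [_ Ht]. rewrite Nat.sub_0_r in Ht.
      exists i, t. split; [exact Ht|]. now apply IH.
    + intros (i & t & Ht & Hf). right. exists (i, t). split.
      * apply in_zipi. rewrite Nat.sub_0_r. auto with arith.
      * apply IH; [eapply env_ok_kids; eassumption|exact Hf].
  - apply IH, env_ok_kid, He.
Qed.

(** * The reduction theorem *)

Fixpoint tnames_ok (t : ttm) : bool :=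
  match t with
  | TVar tag cs => (tag <=? 10) && (length cs <=? 4)
  | TConst _ | TIdx _ | TZero | TOne => true
  | TAdd a b | TSub a b | TMul a b => tnames_ok a && tnames_ok b
  | TSum _ b | TProd _ b | TLet _ _ b => tnames_ok b
  end%bool.

Fixpoint names_ok (f : tfm) : bool :=
  match f with
  | MEq a b | MLe a b | MLt a b => tnames_ok a && tnames_ok b
  | MNot f | MAll _ f | MEx _ f | MLet _ _ f => names_ok f
  | MAnd f g | MOr f g => names_ok f && names_ok g
  end%bool.

Lemma bits_enc n : length (bits n) <= length (enc_tree (Leaf n)).
Proof. rewrite enc_leaf. simpl. rewrite length_app, length_map. lia. Qed.

Lemma comp_bits_length N e c : env_ok N e -> length (comp_bits N e c) <= N.
Proof.
  intros He. destruct c as [v|v]; destruct (env_ok_get N e v He) as [H1 H2]; simpl.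
  - destruct (snd (get e v)) as [n|ts]; cbn [leafv].
    + pose proof (bits_enc n). lia.
    + simpl. lia.
  - rewrite repeat_length. lia.
Qed.

Lemma length_delimit_one l : length (delimit [l]) = 2 * length l + 1.
Proof.
  unfold delimit. simpl. rewrite app_nil_r, length_app.
  assert (H : length (flat_map (fun b => [true; b]) l) = 2 * length l)
    by (induction l; simpl; lia).
  rewrite H. simpl. lia.
Qed.

(** The tag takes at most 21 digits, each of at most four components takes at most [2 * N + 1], and
    the leading 1 is one more: [8 * N + 26] digits in all. *)
Lemma code_bound N e tag cs : env_ok N e -> tag <= 10 -> length cs <= 4 ->
  code tag (map (comp_bits N e) cs) < bval (true :: repeat false (8 * N + 26)).
Proof.
  intros He Ht Hc. rewrite bval_repeat_false. unfold code.
  eapply Nat.lt_le_trans; [apply bval_bound|]. apply Nat.pow_le_mono_r; [lia|].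
  cbn [length]. rewrite delimit_cons, length_app, length_delimit_one, repeat_length.
  assert (H : length (delimit (map (comp_bits N e) cs)) <= length cs * (2 * N + 1)).
  { clear Hc. induction cs as [|c cs IH]; [simpl; lia|].
    cbn [map length]. rewrite delimit_cons, length_app, length_delimit_one.
    pose proof (comp_bits_length N e c He). lia. }
  nia.
Qed.

Lemma fold_left_inv {A B} (f : B -> A -> B) (P : B -> Prop) l : forall b,
  (forall b a, In a l -> P b -> P (f b a)) -> P b -> P (fold_left f l b).
Proof.
  induction l as [|a l IH]; intros b H Hb; simpl; [assumption|].
  apply IH; [|apply H; [now left|assumption]]. intros b' a' Ha'. apply H. now right.
Qed.

Lemma tden_vars N t : tnames_ok t = true -> forall e, env_ok N e ->
  eterm_vars_below (bval (true :: repeat false (8 * N + 26))) (tden N e t).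
Proof.
  set (K := bval _).
  induction t as [tag cs|v|v| | |a IHa b IHb|a IHa b IHb|a IHa b IHb|v b IH|v b IH|v k b IH];
    intros Hok e He; simpl in Hok; cbn [tden eterm_vars_below]; auto.
  - apply andb_prop in Hok as [H1 H2]. apply Nat.leb_le in H1, H2. now apply code_bound.
  - unfold horner. apply fold_left_inv; simpl; [|exact I]. intros b [] _ Hb; simpl; auto.
  - unfold ones. split; apply fold_left_inv; simpl; auto.
  - apply andb_prop in Hok as [H1 H2]. auto.
  - apply andb_prop in Hok as [H1 H2]. auto.
  - apply andb_prop in Hok as [H1 H2]. auto.
  - apply fold_left_inv; simpl; [|exact I]. intros t it Hit Ht. split; [assumption|].
    apply IH; [assumption|]. eapply env_ok_zipi; eassumption.
  - apply fold_left_inv; simpl; [|exact I]. intros t it Hit Ht. split; [assumption|].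
    apply IH; [assumption|]. eapply env_ok_zipi; eassumption.
  - apply IH; [assumption|]. now apply env_ok_kid.
Qed.

Lemma fden_vars N f : names_ok f = true -> forall e, env_ok N e ->
  eform_vars_below (bval (true :: repeat false (8 * N + 26))) (fden N e f).
Proof.
  induction f as [a b|a b|a b|f IH|f IHf g IHg|f IHf g IHg|v f IH|v f IH|v k f IH];
    intros Hok e He; simpl in Hok; cbn [fden eform_vars_below];
    try (apply andb_prop in Hok as [H1 H2]; auto using tden_vars); auto.
  - apply fold_left_inv; simpl; [|split; exact I]. intros t it Hit Ht. split; [assumption|].
    apply IH; [assumption|]. eapply env_ok_zipi; eassumption.
  - apply fold_left_inv; simpl; [|split; exact I]. intros t it Hit Ht. split; [assumption|].
    apply IH; [assumption|]. eapply env_ok_zipi; eassumption.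
  - apply IH; [assumption|]. now apply env_ok_kid.
Qed.

Lemma word_inj l : forall l' r r', map b2s l ++ SE :: r = map b2s l' ++ SE :: r' -> l = l' /\ r = r'.
Proof.
  induction l as [|a l IH]; intros [|a' l'] r r' H; simpl in H.
  - injection H; auto.
  - destruct a'; discriminate.
  - destruct a; discriminate.
  - injection H as Ha H. apply IH in H as [-> ->]. destruct a, a'; simpl in Ha; auto; discriminate.
Qed.

(** With arbitrary continuations [r] and [r'] this says that encodings are prefix-free, which the
    induction over siblings needs. The outer induction is on length, as subtrees are nested inside
    lists. *)
Lemma enc_tree_inj_aux n : forall t t' r r', length (enc_tree t) <= n ->
  enc_tree t ++ r = enc_tree t' ++ r' -> t = t' /\ r = r'.
Proof.
  induction n as [|n IH]; intros t t' r r' Hn H.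
  - destruct t; [rewrite enc_leaf in Hn|rewrite enc_node in Hn]; simpl in Hn; lia.
  - destruct t as [m|ts], t' as [m'|ts']; rewrite ?enc_leaf, ?enc_node in H; try discriminate.
    + cbn [app] in H. injection H as H. rewrite <- !app_assoc in H. simpl in H.
      apply word_inj in H as [H ->]. split; [|reflexivity]. f_equal.
      now rewrite <- (bval_bits m), H, bval_bits.
    + cbn [app] in H. injection H as H. rewrite <- !app_assoc in H. cbn [app] in H.
      rewrite enc_node in Hn. cbn [length] in Hn. rewrite length_app in Hn.
      assert (Hl : length (encs ts) <= n) by lia. clear Hn.
      enough (ts = ts' /\ r = r') as [-> ->] by auto.
      revert ts' H. induction ts as [|t ts IHts]; intros [|t' ts'] H.
      * injection H; auto.
      * rewrite encs_cons in H. destruct t'; [rewrite enc_leaf in H|rewrite enc_node in H]; discriminate.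
      * rewrite encs_cons in H. destruct t; [rewrite enc_leaf in H|rewrite enc_node in H]; discriminate.
      * rewrite !encs_cons, <- !app_assoc in H. rewrite encs_cons, length_app in Hl.
        apply IH in H as [-> H]; [|lia]. apply IHts in H as [-> ->]; [auto|lia].
Qed.

Lemma enc_tree_inj t t' : enc_tree t = enc_tree t' -> t = t'.
Proof.
  intros H. apply (enc_tree_inj_aux (length (enc_tree t)) t t' [] []); [lia|]. now rewrite H.
Qed.

Lemma tr_eterm_inj a : forall b, tr_eterm a = tr_eterm b -> a = b.
Proof.
  induction a; intros []; simpl; intros H; try discriminate; inversion H; f_equal; auto.
Qed.

Lemma tr_eform_inj a : forall b, tr_eform a = tr_eform b -> a = b.
Proof.
  induction a; intros []; simpl; intros H; try discriminate; inversion H;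
    f_equal; auto using tr_eterm_inj.
Qed.

Lemma etr_lang_spec k phi : ETR_lang (enc_tree (Node [Leaf k; tr_eform phi])) <->
  eform_vars_below k phi /\ exists x, eform_holds x phi.
Proof.
  split.
  - intros (k' & phi' & He & H). apply enc_tree_inj in He. injection He as -> He.
    apply tr_eform_inj in He as ->. exact H.
  - intros H. exists k, phi. auto.
Qed.

Lemma etr_lang_nil : ~ ETR_lang [].
Proof. intros (k & phi & H & _). rewrite enc_node in H. discriminate. Qed.

(** The announced number of variables is a power of two above all variable numbers. In binary it is
    1 followed by zeros, eight per input symbol and 26 more, so it is printed without any
    arithmetic. *)
Definition sentence (f : tfm) : tmpl :=
  pseq [POut [SN; SL; S1]; PAll (repeat S0 8); POut (repeat S0 26 ++ [SE]); fprint f; POut [SE]].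

Lemma sem_sentence N e f : sem N e (sentence f) =
  enc_tree (Node [Leaf (bval (true :: repeat false (8 * N + 26))); tr_eform (fden N e f)]).
Proof.
  unfold sentence. rewrite sem_pseq. cbn [flat_map sem]. rewrite sem_fprint.
  rewrite enc_node, encs_cons, encs_one, enc_leaf, bits_bval.
  assert (H : forall k, concat (repeat (repeat S0 8) k) = repeat S0 (8 * k)).
  { induction k as [|k IH]; [reflexivity|]. replace (8 * S k) with (8 + 8 * k) by lia.
    change (concat (repeat (repeat S0 8) (S k))) with (repeat S0 8 ++ concat (repeat (repeat S0 8) k)).
    now rewrite repeat_app, IH. }
  rewrite H, app_nil_r. cbn [map b2s app]. rewrite map_repeat, repeat_app. cbn [b2s].
  now rewrite <- !app_assoc.
Qed.

(** The flag starts as a copy of the input, which is nonempty whenever it encodes a tree, and it is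
    also emptied when symbols remain after parsing. On failure nothing is printed, and the empty
    word encodes no sentence. *)
Definition reducer (G : sch) (f : tfm) : rcmd :=
  RSeq (RCopy 3 0) (RSeq (RCopy (ptr 0) 0) (RSeq (RCopy (idx 0) 0)
    (RSeq (chk G (ptr 0) (ptr 1))
      (RSeq (RCase (ptr 0) (fun o => match o with None => RSkip | Some _ => RClear 3 end))
        (RCase 3 (fun o => match o with
          | None => RSkip
          | Some _ => RSeq (RCopy (ptr 0) 0) (tcomp [G] (sentence f)) end)))))).

Lemma env_ok_root t : env_ok (length (enc_tree t)) [(0, t)].
Proof.
  split.
  - destruct t; rewrite ?enc_leaf, ?enc_node; simpl; rewrite length_app; simpl; lia.
  - constructor; [simpl; lia|constructor].
Qed.

Lemma reducer_spec G f w : is_item G = true -> sch_ok G = true -> wt [G] (sentence f) = true ->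
  (forall x t, to_trees G x = [t] -> enc_tree t = w ->
    run (reducer G f) (init_store w) 1 = sem (length w) [(0, t)] (sentence f)) /\
  ((forall x t, to_trees G x = [t] -> enc_tree t <> w) ->
    run (reducer G f) (init_store w) 1 = []).
Proof.
  intros Hit Hok Hwt. unfold reducer. cbn [run].
  set (st1 := upd (upd (upd (init_store w) _ _) _ _) _ _).
  assert (E0 : st1 0 = w) by reflexivity.
  assert (E1 : st1 1 = []) by reflexivity.
  assert (E3 : st1 3 = w) by reflexivity.
  assert (E4 : st1 (ptr 0) = w) by reflexivity.
  assert (E5 : st1 (idx 0) = w) by reflexivity.
  set (st2 := run (chk G (ptr 0) (ptr 1)) st1).
  assert (K2 : forall r, r < ptr 1 -> r <> ptr 0 -> r <> 3 -> st2 r = st1 r)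
    by (intros r H1 H2 H3; apply run_keeps, chk_keeps; assumption).
  assert (L1 : length (st1 (ptr 0)) <= length (st1 0)) by (rewrite E4, E0; lia).
  split.
  - intros x t Hx Ht.
    assert (P : st1 (ptr 0) = encs (to_trees G x) ++ []).
    { rewrite Hx, encs_one, app_nil_r, Ht. exact E4. }
    destruct (chk_complete G (ptr 0) ltac:(unfold ptr; lia) Hok (ptr 1) x st1 []
      ltac:(unfold ptr; lia) P (or_introl Hit) L1) as [H1 H2].
    fold st2 in H1, H2. rewrite H1. cbn [hd_error run].
    rewrite H2, E3.
    assert (Hw : exists a l, w = a :: l).
    { rewrite <- Ht. destruct t; rewrite ?enc_leaf, ?enc_node; eauto. }
    destruct Hw as (a & l & Hw). rewrite Hw at 1. cbn [hd_error run].
    rewrite (tcomp_sem (length w) (sentence f) [G] [(0, t)]); [|assumption|].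
    + rewrite upd_ne by (unfold ptr; lia). rewrite K2 by (unfold ptr; lia). now rewrite E1.
    + repeat split.
      * rewrite upd_ne by (unfold ptr; lia). rewrite K2 by (unfold ptr; lia). now rewrite E0.
      * destruct v as [|[|v]]; simpl in H; [|discriminate|discriminate]. congruence.
      * destruct v as [|[|v]]; simpl in H; [|discriminate|discriminate]. congruence.
      * destruct v as [|[|v]]; simpl in H; [|discriminate|discriminate]. injection H as <-.
        exists x, []. cbn [get nth snd fst]. rewrite upd_eq, K2, E0 by (unfold ptr; lia).
        rewrite upd_ne, K2, E5 by (unfold ptr, idx; lia). rewrite app_nil_r. repeat split; auto; lia.
  - intros HN.
    set (st3 := run _ st2).
    assert (F1 : st3 1 = []).
    { rewrite <- E1, <- K2 by (unfold ptr; lia). unfold st3.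
      destruct (hd_error (st2 (ptr 0))); simpl; reflexivity. }
    destruct (st3 3) as [|a l] eqn:E; cbn [hd_error run]; [exact F1|]. exfalso.
    unfold st3 in E. destruct (st2 (ptr 0)) as [|b v] eqn:Ep; cbn [hd_error run] in E.
    + destruct (chk_sound G (ptr 0) ltac:(unfold ptr; lia) (ptr 1) st1 ltac:(unfold ptr; lia))
        as [_ [x Hx]].
      * fold st2. congruence.
      * fold st2 in Hx. rewrite Ep, app_nil_r, E4 in Hx. destruct (item_tree G x Hit) as [t Ht].
        rewrite Ht, encs_one in Hx. apply (HN x t Ht). auto.
    + rewrite upd_eq in E. discriminate.
Qed.

Theorem reduction (G : sch) (f : tfm) (L : list sym -> Prop) :
  is_item G = true -> sch_ok G = true -> wt [G] (sentence f) = true -> names_ok f = true ->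
  (forall w, L w <-> exists x t, to_trees G x = [t] /\ enc_tree t = w /\
    exists rho, fval rho (length w) [(0, t)] f) ->
  in_ExistsR L.
Proof.
  intros Hit Hok Hwt Hnm HL.
  destruct (rok_tcomp (sentence f) [G] Hwt) as [m0 Hm0].
  set (m := m0 + ptr 2 + depth G).
  assert (Hrok : rok m (reducer G f)).
  { unfold reducer. cbn [rok]. unfold m, ptr, idx in *.
    repeat match goal with |- _ /\ _ => split end; try lia.
    - apply chk_rok; lia.
    - intros [a|]; simpl; lia.
    - intros [a|]; cbn [rok]; [|exact I]. split; [lia|].
      apply (rok_mono m0); [lia|exact Hm0]. }
  destruct (rcmd_machine (reducer G f) m ltac:(unfold m, ptr; lia) Hrok) as (M & k & d & HM).
  exists M, k, d. intros w. destruct (HM w) as (cf & H1 & H2). exists cf. split; [exact H1|].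
  rewrite H2, HL. destruct (reducer_spec G f w Hit Hok Hwt) as [R1 R2].
  assert (HD : (exists x t, to_trees G x = [t] /\ enc_tree t = w) \/
    (forall x t, to_trees G x = [t] -> enc_tree t <> w)).
  { destruct (Classical_Prop.classic (exists x t, to_trees G x = [t] /\ enc_tree t = w)) as [H|H];
      [now left|right]. intros x t Hx Ht. apply H. eauto. }
  destruct HD as [(x & t & Hx & Ht)|HN].
  - rewrite (R1 x t Hx Ht), sem_sentence, etr_lang_spec.
    assert (He : env_ok (length w) [(0, t)]) by (rewrite <- Ht; apply env_ok_root).
    split.
    + intros (x' & t' & Hx' & Ht' & rho & Hrho).
      assert (t' = t) as -> by (apply enc_tree_inj; congruence).
      split; [now apply fden_vars|].
      (* A variable number is decoded back into its name: the leading 1 is dropped, and the length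
         of the first component is the tag. *)
      exists (fun i => let nm := undelimit [] (tl (bits i)) in rho (length (hd [] nm)) (tl nm)).
      apply (eval_fden _ rho); [|assumption|exact Hrho]. intros tag nm. unfold code.
      cbv zeta. rewrite bits_bval. cbn [tl]. rewrite undelimit_spec. cbn [hd tl].
      now rewrite repeat_length.
    + intros [_ [v Hv]]. exists x, t. repeat split; trivial.
      exists (fun tag nm => v (code tag nm)).
      apply (eval_fden v); [reflexivity|assumption|exact Hv].
  - rewrite (R2 HN). split.
    + intros (x & t & Hx & Ht & _). elim (HN x t Hx Ht).
    + intros H. elim (etr_lang_nil H).
Qed.

(** * Memoryless certificates *)

Local Open Scope R_scope.

Lemma sumR_app a b : sumR (a ++ b) = sumR a + sumR b.
Proof. unfold sumR. induction a; simpl; lra. Qed.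

Lemma sumR_ext {A} (f g : A -> R) l : (forall a, In a l -> f a = g a) -> sumR (map f l) = sumR (map g l).
Proof. intros H. f_equal. now apply map_ext_in. Qed.

Lemma sumR_le {A} (f g : A -> R) l : (forall a, In a l -> f a <= g a) -> sumR (map f l) <= sumR (map g l).
Proof.
  induction l as [|a l IH]; simpl; intros H; [lra|].
  pose proof (H a (or_introl eq_refl)). assert (sumR (map f l) <= sumR (map g l)) by auto. lra.
Qed.

Lemma sumR_0 {A} (l : list A) : sumR (map (fun _ => 0) l) = 0.
Proof. induction l; simpl; lra. Qed.

Lemma sumR_ge0 {A} (f : A -> R) l : (forall a, In a l -> 0 <= f a) -> 0 <= sumR (map f l).
Proof. intros H. rewrite <- (sumR_0 l). now apply sumR_le. Qed.

Lemma sumR_plus {A} (f g : A -> R) l :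
  sumR (map (fun a => f a + g a) l) = sumR (map f l) + sumR (map g l).
Proof. induction l; simpl; lra. Qed.

Lemma sumR_scal {A} c (f : A -> R) l : sumR (map (fun a => c * f a) l) = c * sumR (map f l).
Proof. induction l; simpl; lra. Qed.

Lemma sumR_swap {A B} (f : A -> B -> R) l l' :
  sumR (map (fun a => sumR (map (f a) l')) l) = sumR (map (fun b => sumR (map (fun a => f a b) l)) l').
Proof.
  induction l as [|a l IH]; simpl.
  - now rewrite sumR_0.
  - now rewrite sumR_plus, IH.
Qed.

Lemma sumR_elem_le {A} (f : A -> R) l a : (forall a, In a l -> 0 <= f a) -> In a l -> f a <= sumR (map f l).
Proof.
  induction l as [|b l IH]; simpl; intros H; [intros []|intros [->|Ha]].
  - assert (0 <= sumR (map f l)) by (apply sumR_ge0; auto). lra.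
  - pose proof (H b (or_introl eq_refl)). assert (f a <= sumR (map f l)) by auto. lra.
Qed.

Lemma sumR_delta (f : nat -> R) l c : NoDup l -> In c l ->
  sumR (map (fun b => f b * (if Nat.eqb c b then 1 else 0)) l) = f c.
Proof.
  induction 1 as [|b l Hb _ IH]; simpl; [tauto|]. intros [->|Hc].
  - rewrite Nat.eqb_refl.
    rewrite (sumR_ext _ (fun _ => 0)), sumR_0; [lra|]. intros a Ha.
    destruct (Nat.eqb_spec c a); [congruence|lra].
  - rewrite IH by assumption. destruct (Nat.eqb_spec c b); [congruence|lra].
Qed.

Lemma sumR_map_flat_map {A B C} (f : B -> R) (g : A -> C -> B) l (l' : list C) :
  sumR (map f (flat_map (fun x => map (g x) l') l))
  = sumR (map (fun x => sumR (map (fun y => f (g x y)) l')) l).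
Proof.
  induction l as [|x l IH]; simpl; [reflexivity|].
  rewrite map_app, sumR_app, IH, map_map. reflexivity.
Qed.

(* Mixed profiles: q p is the distribution used by player p. *)
Definition weight (q : nat -> nat -> R) (k : nat) (a : list nat) : R :=
  prodR (map (fun pa => q (fst pa) (snd pa)) (combine (seq k (length a)) a)).

(** Distributivity of products over sums. When every player's mass is 1, it shows that independent
    randomisation gives a distribution on profiles. *)
Lemma weight_cart (q : nat -> nat -> R) ls : forall k,
  sumR (map (weight q k) (cart ls))
  = prodR (map (fun pl => sumR (map (q (fst pl)) (snd pl))) (combine (seq k (length ls)) ls)).
Proof.
  induction ls as [|l ls IH]; intros k; simpl.
  - unfold weight; simpl. lra.
  - rewrite sumR_map_flat_map. unfold weight at 1. simpl.
    rewrite (sumR_ext _ (fun x => sumR (map (weight q (S k)) (cart ls)) * q k x)).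
    + rewrite sumR_scal, IH. lra.
    + intros x _. rewrite Rmult_comm, <- sumR_scal. reflexivity.
Qed.

Lemma weight_ge0 q k a : (forall i, (i < length a)%nat -> 0 <= q (k + i)%nat (nth i a 0%nat)) ->
  0 <= weight q k a.
Proof.
  revert k. induction a as [|x a IH]; intros k H; unfold weight; simpl; [lra|].
  apply Rmult_le_pos.
  - specialize (H 0%nat). rewrite Nat.add_0_r in H. apply H. simpl; lia.
  - apply IH. intros i Hi. specialize (H (S i)). simpl in H.
    replace (S k + i)%nat with (k + S i)%nat by lia. apply H. lia.
Qed.

Lemma weight_snoc q k a c : weight q k (a ++ [c]) = weight q k a * q (k + length a)%nat c.
Proof.
  revert k. induction a as [|x a IH]; intros k; unfold weight in *; simpl.
  - rewrite Nat.add_0_r. lra.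
  - rewrite IH. replace (S k + length a)%nat with (k + S (length a))%nat by lia. lra.
Qed.

Lemma weight_ext q q' k a : (forall i c, (k <= i < k + length a)%nat -> q i c = q' i c) ->
  weight q k a = weight q' k a.
Proof.
  revert k. induction a as [|x a IH]; intros k H; unfold weight; simpl; [reflexivity|].
  f_equal; [apply H; simpl; lia|]. apply IH. intros i c Hi. apply H. simpl. lia.
Qed.

Lemma in_cart ls : forall a, In a (cart ls) <-> Forall2 (@In nat) a ls.
Proof.
  induction ls as [|l ls IH]; intros a; simpl.
  - split; [intros [<-|[]]; constructor|]. intros H; inversion H; auto.
  - rewrite in_flat_map. split.
    + intros (x & Hx & Ha). apply in_map_iff in Ha as (a' & <- & Ha). constructor; [assumption|].
      now apply IH.
    + intros H. inversion H as [|x ? a' ? Hx Ha]; subst. exists x. split; [assumption|].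
      apply in_map, IH, Ha.
Qed.

Lemma in_profiles g s a : In a (profiles g s) <->
  length a = S (gi_team g) /\ forall p, (p <= gi_team g)%nat -> In (nth p a 0%nat) (av g p s).
Proof.
  unfold profiles. rewrite in_cart.
  assert (H : forall n k a, Forall2 (@In nat) a (map (fun p => av g p s) (seq k n)) <->
    length a = n /\ forall i, (i < n)%nat -> In (nth i a 0%nat) (av g (k + i) s)).
  { clear a. induction n as [|n IH]; intros k a; simpl.
    - split.
      + intros H; inversion H. split; [reflexivity|lia].
      + intros [H _]. destruct a; [constructor|discriminate].
    - split.
      + intros H. inversion H as [|x ? a' ? Hx Ha]; subst. apply IH in Ha as [H1 H2].
        split; [simpl; congruence|]. intros [|i] Hi; simpl; [now rewrite Nat.add_0_r|].
        replace (k + S i)%nat with (S k + i)%nat by lia. apply H2. lia.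
      + intros [H1 H2]. destruct a as [|x a]; [discriminate|]. constructor.
        * specialize (H2 0%nat ltac:(lia)). now rewrite Nat.add_0_r in H2.
        * apply IH. simpl in H1. split; [lia|]. intros i Hi.
          specialize (H2 (S i) ltac:(lia)). now replace (S k + i)%nat with (k + S i)%nat by lia. }
  rewrite H. split; intros [H1 H2]; split; trivial; intros p Hp; [apply (H2 p)|apply H2]; lia.
Qed.

Definition expect_step (g : game_inst) (s : nat) (q : nat -> nat -> R) (f : nat -> R) : R :=
  sumR (map (fun a => weight q 0 a * sumR (map (fun s' => delta g s a s' * f s') (seq 0 (gi_nst g))))
    (profiles g s)).

Definition point (n : nat) (q : nat -> nat -> R) (b : nat) : nat -> nat -> R :=
  fun p a => if Nat.eqb p n then (if Nat.eqb a b then 1 else 0) else q p a.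

Definition dist_on (q : nat -> R) (l : list nat) : Prop :=
  (forall a, In a l -> 0 <= q a) /\ sumR (map q l) = 1.

Definition mixed (g : game_inst) (s : nat) (q : nat -> nat -> R) : Prop :=
  forall p, (p <= gi_team g)%nat -> dist_on (q p) (av g p s).

Definition team_mixed (g : game_inst) (s : nat) (q : nat -> nat -> R) : Prop :=
  forall p, (p < gi_team g)%nat -> dist_on (q p) (av g p s).

Lemma delta_dist g s a : game_wf g -> (s < gi_nst g)%nat -> In a (profiles g s) ->
  (forall s', 0 <= delta g s a s') /\ sumR (map (delta g s a) (seq 0 (gi_nst g))) = 1.
Proof.
  intros (_ & _ & _ & _ & H & _) Hs Ha. destruct (H s a Hs Ha) as (d & Hd & Hl & Hp & Hsum).
  unfold delta. rewrite Hd. split.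
  - intros s'. destruct (nth_in_or_default s' d 0%Q) as [Hi| ->].
    + rewrite Forall_forall in Hp. apply Hp, Qle_Rle in Hi. unfold Q2R in Hi at 1. simpl in Hi. lra.
    + unfold Q2R; simpl; lra.
  - rewrite <- Hl.
    assert (HE : forall d k, sumR (map (fun s' => Q2R (nth (s' - k) d 0%Q)) (seq k (length d)))
      = Q2R (fold_right Qplus 0%Q d)).
    { clear. induction d as [|q d IH]; intros k; simpl; [unfold Q2R; simpl; lra|].
      rewrite Q2R_plus, Nat.sub_diag. f_equal. rewrite <- (IH (S k)). apply sumR_ext.
      intros s' Hs'. apply in_seq in Hs'. replace (s' - k)%nat with (S (s' - S k)) by lia. reflexivity. }
    specialize (HE d 0%nat). rewrite (Qeq_eqR _ _ Hsum) in HE.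
    replace 1 with (Q2R 1) by (unfold Q2R; simpl; lra). rewrite <- HE.
    apply sumR_ext. intros s' _. now rewrite Nat.sub_0_r.
Qed.

Lemma weight_profile_ge0 g s q a : mixed g s q -> In a (profiles g s) -> 0 <= weight q 0 a.
Proof.
  intros Hq Ha. apply in_profiles in Ha as [Hl Ha]. apply weight_ge0. intros i Hi. simpl.
  apply Hq; [lia|]. apply Ha. lia.
Qed.

Lemma expect_le g s q f f' : game_wf g -> (s < gi_nst g)%nat -> mixed g s q ->
  (forall s', (s' < gi_nst g)%nat -> f s' <= f' s') -> expect_step g s q f <= expect_step g s q f'.
Proof.
  intros Hg Hs Hq Hf. apply sumR_le. intros a Ha. apply Rmult_le_compat_l.
  - eapply weight_profile_ge0; eassumption.
  - apply sumR_le. intros s' Hs'. apply in_seq in Hs'. apply Rmult_le_compat_l.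
    + now apply (delta_dist g s a).
    + apply Hf. lia.
Qed.

Lemma expect_scal g s q c f : expect_step g s q (fun s' => c * f s') = c * expect_step g s q f.
Proof.
  unfold expect_step. rewrite <- sumR_scal. apply sumR_ext. intros a _.
  rewrite (sumR_ext _ (fun s' => c * (delta g s a s' * f s'))) by (intros; lra).
  rewrite sumR_scal. lra.
Qed.

Lemma expect_plus g s q f f' :
  expect_step g s q (fun s' => f s' + f' s') = expect_step g s q f + expect_step g s q f'.
Proof.
  unfold expect_step. rewrite <- sumR_plus. apply sumR_ext. intros a _.
  rewrite (sumR_ext _ (fun s' => delta g s a s' * f s' + delta g s a s' * f' s')) by (intros; lra).
  rewrite sumR_plus. lra.
Qed.

Lemma expect_const g s q c : game_wf g -> (s < gi_nst g)%nat -> mixed g s q ->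
  expect_step g s q (fun _ => c) = c.
Proof.
  intros Hg Hs Hq. unfold expect_step.
  rewrite (sumR_ext _ (fun a => c * weight q 0 a)).
  - rewrite sumR_scal. unfold profiles. rewrite weight_cart.
    assert (H : forall n k, (forall i, (i < n)%nat -> sumR (map (q (k + i)%nat) (av g (k + i) s)) = 1) ->
      prodR (map (fun pl => sumR (map (q (fst pl)) (snd pl)))
        (combine (seq k (length (map (fun p => av g p s) (seq k n)))) (map (fun p => av g p s) (seq k n)))) = 1).
    { induction n as [|n IH]; intros k H; simpl; [reflexivity|].
      rewrite IH; [pose proof (H 0%nat ltac:(lia)) as H0; rewrite Nat.add_0_r in H0; rewrite H0; lra|].
      intros i Hi. specialize (H (S i) ltac:(lia)). now replace (S k + i)%nat with (k + S i)%nat by lia. }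
    rewrite H; [lra|]. intros i Hi. apply Hq. lia.
  - intros a Ha. destruct (delta_dist g s a Hg Hs Ha) as [_ HD].
    rewrite (sumR_ext _ (fun s' => c * delta g s a s')) by (intros; lra).
    rewrite sumR_scal, HD. lra.
Qed.

Lemma expect_ext_f g s q f f' : (forall s', (s' < gi_nst g)%nat -> f s' = f' s') ->
  expect_step g s q f = expect_step g s q f'.
Proof.
  intros H. apply sumR_ext. intros a _. f_equal. apply sumR_ext. intros s' Hs'.
  apply in_seq in Hs'. rewrite H; [reflexivity|lia].
Qed.

Lemma expect_ext_q g s q q' f : (forall p a, (p <= gi_team g)%nat -> q p a = q' p a) ->
  expect_step g s q f = expect_step g s q' f.
Proof.
  intros H. apply sumR_ext. intros a Ha. apply in_profiles in Ha as [Hl _]. f_equal.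
  apply weight_ext. intros i c Hi. apply H. lia.
Qed.

(** The opponent is the last player, so a profile splits into the team's choices and one opponent
    action, and the expectation is linear in the opponent's distribution. This is why certificates
    need to consider only pure opponent actions. *)
Lemma expect_opponent g s q f : NoDup (av g (gi_team g) s) ->
  expect_step g s q f =
  sumR (map (fun b => q (gi_team g) b * expect_step g s (point (gi_team g) q b) f) (av g (gi_team g) s)).
Proof.
  intros Hnd. unfold expect_step at 2.
  rewrite (sumR_ext _ (fun b => sumR (map (fun a => q (gi_team g) b * (weight (point (gi_team g) q b) 0 a *
    sumR (map (fun s' => delta g s a s' * f s') (seq 0 (gi_nst g))))) (profiles g s))))
    by (intros; now rewrite sumR_scal).
  rewrite sumR_swap. apply sumR_ext. intros a Ha. apply in_profiles in Ha as [Hl Ha].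
  set (D := sumR _).
  assert (Hne : a <> []) by (destruct a; [discriminate|congruence]).
  destruct (exists_last Hne) as (a' & c & ->).
  rewrite length_app in Hl. simpl in Hl.
  assert (Hl' : length a' = gi_team g) by lia.
  assert (Hc : In c (av g (gi_team g) s)).
  { specialize (Ha (gi_team g) (le_n _)). rewrite app_nth2 in Ha by lia.
    now rewrite Hl', Nat.sub_diag in Ha. }
  rewrite weight_snoc. simpl. rewrite Hl'.
  rewrite (sumR_ext _ (fun b => (weight q 0 a' * D) * (q (gi_team g) b * (if Nat.eqb c b then 1 else 0)))).
  - rewrite sumR_scal, sumR_delta by assumption. lra.
  - intros b _. rewrite weight_snoc. simpl. rewrite Hl'. unfold point at 2. rewrite Nat.eqb_refl.
    rewrite (weight_ext (point (gi_team g) q b) q).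
    + lra.
    + intros i x Hi. unfold point. destruct (Nat.eqb_spec i (gi_team g)); [lia|reflexivity].
Qed.

Lemma wf_av g p s : game_wf g -> (p <= gi_team g)%nat -> (s < gi_nst g)%nat ->
  av g p s <> [] /\ NoDup (av g p s).
Proof. intros (_ & _ & _ & H & _) Hp Hs. destruct (H p s Hp Hs) as (H1 & H2 & _). auto. Qed.

Lemma dist_point l b : NoDup l -> In b l -> dist_on (fun a => if Nat.eqb a b then 1 else 0) l.
Proof.
  intros Hn Hb. split.
  - intros a _. destruct (Nat.eqb a b); lra.
  - etransitivity; [|exact (sumR_delta (fun _ => 1) l b Hn Hb)]. apply sumR_ext. intros a _.
    rewrite Nat.eqb_sym. destruct (Nat.eqb b a); lra.
Qed.

Lemma mixed_point g s q b : game_wf g -> (s < gi_nst g)%nat -> team_mixed g s q ->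
  In b (av g (gi_team g) s) -> mixed g s (point (gi_team g) q b).
Proof.
  intros Hg Hs Hq Hb p Hp. unfold point. destruct (Nat.eqb_spec p (gi_team g)) as [->|Hne].
  - apply dist_point; [|assumption]. now apply wf_av.
  - apply Hq. lia.
Qed.

(** * Certificates and their soundness *)

Record certificate (g : game_inst) (x : nat -> nat -> nat -> R) (w : nat -> R) (lam : R) : Prop := {
  cert_team : forall s, (s < gi_nst g)%nat -> team_mixed g s (fun p => x p s);
  cert_lam : 0 < lam < 1;
  cert_pos : forall s, (s < gi_nst g)%nat -> 0 <= w s;
  cert_target : forall s, (s < gi_nst g)%nat -> is_target g s = true -> w s <= 1;
  cert_step : forall s b, (s < gi_nst g)%nat -> is_target g s = false -> In b (av g (gi_team g) s) ->
    w s <= lam * expect_step g s (point (gi_team g) (fun p => x p s) b) w;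
  cert_init : Q2R (gi_thr g) < w (gi_init g) }.

Lemma reach_within_S g strat n h :
  reach_within g strat (S n) h = if is_target g (last h 0%nat) then 1 else
    expect_step g (last h 0%nat) (fun p => strat p h) (fun s' => reach_within g strat n (h ++ [s'])).
Proof. reflexivity. Qed.

Definition hist_ok (g : game_inst) (h : list nat) : Prop :=
  h <> [] /\ List.Forall (fun s => (s < gi_nst g)%nat) h.

Lemma hist_last g h : hist_ok g h -> (last h 0 < gi_nst g)%nat.
Proof.
  intros [Hn Hf]. destruct (exists_last Hn) as (h' & s & ->). rewrite last_last.
  apply Forall_app in Hf as [_ Hf]. inversion Hf; assumption.
Qed.

Lemma hist_snoc g h s : hist_ok g h -> (s < gi_nst g)%nat -> hist_ok g (h ++ [s]).
Proof.
  intros [Hn Hf] Hs. split; [destruct h; discriminate|]. apply Forall_app. auto.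
Qed.

Lemma hist_one g s : (s < gi_nst g)%nat -> hist_ok g [s].
Proof. split; [discriminate|auto]. Qed.

Lemma valid_dist g p sigma h : valid_strategy g p sigma -> hist_ok g h ->
  dist_on (sigma h) (av g p (last h 0%nat)).
Proof. intros H [H1 H2]. destruct (H h H1 H2) as (H3 & _ & H5). split; auto. Qed.

Lemma expect_opp_bound g s q f c : game_wf g -> (s < gi_nst g)%nat -> mixed g s q ->
  (forall b, In b (av g (gi_team g) s) -> c <= expect_step g s (point (gi_team g) q b) f) ->
  c <= expect_step g s q f.
Proof.
  intros Hg Hs Hq H. rewrite expect_opponent by (now apply wf_av).
  destruct (Hq (gi_team g) (le_n _)) as [H1 H2].
  replace c with (c * 1) by lra. rewrite <- H2, <- sumR_scal. apply sumR_le.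
  intros b Hb. rewrite Rmult_comm. apply Rmult_le_compat_l; auto.
Qed.

Lemma certificate_sound g x w lam : game_wf g -> certificate g x w lam -> threshold_yes g.
Proof.
  intros Hg Hc.
  (* The certificate constrains [x] on available actions only; elsewhere a valid strategy has to be
     0. *)
  set (team := fun (p : nat) (h : list nat) (a : nat) =>
    if in_dec Nat.eq_dec a (av g p (last h 0%nat)) then x p (last h 0%nat) a else 0).
  assert (Hteam : forall p h, (p < gi_team g)%nat -> hist_ok g h ->
    dist_on (team p h) (av g p (last h 0%nat))).
  { intros p h Hp Hh. destruct (cert_team _ _ _ _ Hc _ (hist_last _ _ Hh) p Hp) as [H1 H2]. split.
    - intros a Ha. unfold team. destruct (in_dec _ _ _); [auto|lra].
    - rewrite <- H2. apply sumR_ext. intros a Ha. unfold team.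
      destruct (in_dec _ _ _); [reflexivity|contradiction]. }
  exists team. split.
  - intros p Hp h Hn Hf. destruct (Hteam p h Hp (conj Hn Hf)) as [H1 H2]. cbv zeta.
    repeat split.
    + intros a. destruct (in_dec Nat.eq_dec a (av g p (last h 0%nat))) as [Hi|Hi]; [auto|].
      unfold team. destruct (in_dec _ _ _); [contradiction|lra].
    + intros a Ha. unfold team. destruct (in_dec _ _ _); [contradiction|reflexivity].
    + exact H2.
  - intros opp Hopp.
    set (strat := profile_of g team opp).
    assert (Hmix : forall h, hist_ok g h -> mixed g (last h 0%nat) (fun p => strat p h)).
    { intros h Hh p Hp. unfold strat, profile_of. destruct (Nat.eqb_spec p (gi_team g)) as [->|Hne].
      - now apply valid_dist.
      - apply Hteam; [lia|assumption]. }
    (* A common bound of all weights, serving as the error at horizon 0. *)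
    set (M := sumR (map w (seq 0 (gi_nst g)))).
    assert (HM : forall s, (s < gi_nst g)%nat -> w s <= M).
    { intros s Hs. apply sumR_elem_le; [|apply in_seq; lia]. intros s' Hs'. apply in_seq in Hs'.
      apply (cert_pos _ _ _ _ Hc). lia. }
    destruct (cert_lam _ _ _ _ Hc) as [L0 L1].
    assert (HM0 : 0 <= M).
    { apply sumR_ge0. intros s Hs. apply in_seq in Hs. apply (cert_pos _ _ _ _ Hc). lia. }
    assert (HR0 : forall n h, hist_ok g h -> 0 <= reach_within g strat n h).
    { induction n as [|n IH]; intros h Hh.
      - simpl. destruct (is_target g _); lra.
      - rewrite reach_within_S. destruct (is_target g _); [lra|].
        rewrite <- (expect_const g (last h 0%nat) (fun p => strat p h) 0) by (auto using hist_last).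
        apply expect_le; auto using hist_last, hist_snoc. }
    (* Each step multiplies the error by [lam]. The same factor in front of the reaching probability
       may be dropped, since by [HR0] that probability is nonnegative. *)
    assert (HR : forall n h, hist_ok g h -> w (last h 0%nat) <= reach_within g strat n h + lam ^ n * M).
    { induction n as [|n IH]; intros h Hh; pose proof (hist_last g h Hh) as Hl.
      - simpl. pose proof (HM _ Hl). destruct (is_target g _); lra.
      - rewrite reach_within_S. pose proof (pow_le lam n (Rlt_le _ _ L0)).
        destruct (is_target g (last h 0%nat)) eqn:Ht.
        + pose proof (cert_target _ _ _ _ Hc _ Hl Ht).
          assert (0 <= lam ^ S n * M) by (apply Rmult_le_pos; [apply pow_le; lra|assumption]). lra.
        + set (q := fun p => strat p h).
          assert (H1 : w (last h 0%nat) <= lam * expect_step g (last h 0%nat) q w).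
          { rewrite <- expect_scal. apply expect_opp_bound; [assumption|assumption|apply Hmix, Hh|].
            intros b Hb. rewrite expect_scal.
              etransitivity; [apply (cert_step _ _ _ _ Hc _ b Hl Ht Hb)|]. apply Req_le. f_equal.
              unfold expect_step. apply sumR_ext. intros a Ha. f_equal.
              apply in_profiles in Ha as [Hla Ha].
              unfold weight, prodR. f_equal. apply map_ext_in. intros [p c] Hpc. simpl.
              unfold point, q, strat, profile_of. destruct (Nat.eqb_spec p (gi_team g)); [reflexivity|].
              unfold team. destruct (in_dec _ _ _) as [|Hn]; [reflexivity|]. elim Hn.
              assert (Hpi : exists i, (i < length a)%nat /\ p = i /\ c = nth i a 0%nat).
              { apply (In_nth _ _ (0%nat, 0%nat)) in Hpc as (i & Hi & Hpc).
                rewrite length_combine, length_seq, Nat.min_id in Hi.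
                rewrite combine_nth in Hpc by (now rewrite length_seq).
                rewrite seq_nth in Hpc by assumption. injection Hpc as <- <-. eauto. }
              destruct Hpi as (i & Hi & -> & ->). apply Ha. lia. }
          assert (H2 : expect_step g (last h 0%nat) q w <=
            expect_step g (last h 0%nat) q (fun s' => reach_within g strat n (h ++ [s'])) + lam ^ n * M).
          { rewrite <- (expect_const g (last h 0%nat) q (lam ^ n * M)) at 1 by (assumption || apply Hmix, Hh).
            rewrite <- expect_plus. apply expect_le; [assumption|assumption|apply Hmix, Hh|].
            intros s' Hs'. specialize (IH (h ++ [s']) (hist_snoc _ _ _ Hh Hs')).
            rewrite last_last in IH. exact IH. }
          assert (H3 : 0 <= expect_step g (last h 0%nat) q (fun s' => reach_within g strat n (h ++ [s']))).
          { rewrite <- (expect_const g (last h 0%nat) q 0) by (assumption || apply Hmix, Hh).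
            apply expect_le; [assumption|assumption|apply Hmix, Hh|]. intros s' Hs'. apply HR0. now apply hist_snoc. }
          set (E2 := expect_step g (last h 0%nat) q (fun s' => reach_within g strat n (h ++ [s']))) in *.
          change (w (last h 0%nat) <= E2 + lam * lam ^ n * M).
          set (E1 := expect_step g (last h 0%nat) q w) in *. clearbody E1 E2.
          assert (lam * E1 <= lam * (E2 + lam ^ n * M)) by (apply Rmult_le_compat_l; lra).
          assert (lam * E2 <= E2) by nra. lra. }
    unfold reach_prob. fold strat.
    assert (Hs0 : (gi_init g < gi_nst g)%nat) by apply Hg.
    apply Rbar_lt_le_trans with (Finite (w (gi_init g))); [apply (cert_init _ _ _ _ Hc)|].
    replace (Finite (w (gi_init g))) with (Lim_seq (fun n => w (gi_init g) - lam ^ n * M)).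
    + apply Lim_seq_le_loc. exists 0%nat. intros n _.
      specialize (HR n [gi_init g] (hist_one _ _ Hs0)). simpl last in HR. lra.
    + apply is_lim_seq_unique.
      replace (Finite (w (gi_init g))) with (Rbar_minus (w (gi_init g)) (Rbar_mult 0 M))
        by (simpl; f_equal; lra).
      apply is_lim_seq_minus'; [apply is_lim_seq_const|].
      apply (is_lim_seq_scal_r (fun n => lam ^ n) M 0). apply is_lim_seq_geom.
      rewrite Rabs_pos_eq; lra.
Qed.

(** * Finite-horizon values and completeness of certificates *)

Definition min_over (f : nat -> R) (l : list nat) : R :=
  match l with
  | [] => 0
  | b :: l => fold_right (fun b m => Rmin (f b) m) (f b) l
  end.

Lemma min_over_le f l b : In b l -> min_over f l <= f b.
Proof.
  destruct l as [|c l]; simpl; [tauto|]. induction l as [|d l IH]; simpl; intros [->|H].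
  - lra.
  - destruct H.
  - etransitivity; [apply Rmin_r|]. apply IH. now left.
  - destruct H as [->|H]; [apply Rmin_l|]. etransitivity; [apply Rmin_r|]. apply IH. now right.
Qed.

Lemma min_over_in f l : l <> [] -> exists b, In b l /\ min_over f l = f b.
Proof.
  destruct l as [|c l]; [congruence|]. intros _. simpl.
  induction l as [|d l (b & Hb & E)]; simpl; [eauto|].
  rewrite E. unfold Rmin. destruct (Rle_dec _ _); [exists d; auto|].
  exists b. split; [|reflexivity]. tauto.
Qed.

(* n-step value of the fixed team strategy against the best opponent, each step discounted by lam. *)
Fixpoint value (g : game_inst) (team : nat -> strategy) (lam : R) (n : nat) (h : list nat) : R :=
  if is_target g (last h 0%nat) then 1 else
  match n with
  | O => 0
  | S n' => lam * min_over (fun b => expect_step g (last h 0%nat)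
      (point (gi_team g) (fun p => team p h) b) (fun s' => value g team lam n' (h ++ [s'])))
      (av g (gi_team g) (last h 0%nat))
  end.

Lemma value_S g team lam n h : value g team lam (S n) h = if is_target g (last h 0%nat) then 1 else
  lam * min_over (fun b => expect_step g (last h 0%nat)
      (point (gi_team g) (fun p => team p h) b) (fun s' => value g team lam n (h ++ [s'])))
      (av g (gi_team g) (last h 0%nat)).
Proof. reflexivity. Qed.

Definition team_valid (g : game_inst) (team : nat -> strategy) : Prop :=
  forall p, (p < gi_team g)%nat -> valid_strategy g p (team p).

Lemma team_mixed_at g team h : team_valid g team -> hist_ok g h ->
  team_mixed g (last h 0%nat) (fun p => team p h).
Proof. intros Ht Hh p Hp. now apply valid_dist; [apply Ht|]. Qed.

Lemma min_expect_le g s q f f' : game_wf g -> (s < gi_nst g)%nat -> team_mixed g s q ->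
  (forall s', (s' < gi_nst g)%nat -> f s' <= f' s') ->
  min_over (fun b => expect_step g s (point (gi_team g) q b) f) (av g (gi_team g) s) <=
  min_over (fun b => expect_step g s (point (gi_team g) q b) f') (av g (gi_team g) s).
Proof.
  intros Hg Hs Hq Hf. destruct (wf_av g (gi_team g) s Hg (le_n _) Hs) as [Hn _].
  destruct (min_over_in (fun b => expect_step g s (point (gi_team g) q b) f') _ Hn) as (b & Hb & ->).
  etransitivity; [apply (min_over_le _ _ b Hb)|]. apply expect_le; auto. now apply mixed_point.
Qed.

Lemma min_expect_const g s q c : game_wf g -> (s < gi_nst g)%nat -> team_mixed g s q ->
  min_over (fun b => expect_step g s (point (gi_team g) q b) (fun _ => c)) (av g (gi_team g) s) = c.
Proof.
  intros Hg Hs Hq. destruct (wf_av g (gi_team g) s Hg (le_n _) Hs) as [Hn _].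
  destruct (min_over_in (fun b => expect_step g s (point (gi_team g) q b) (fun _ => c)) _ Hn) as (b & Hb & ->).
  apply expect_const; auto. now apply mixed_point.
Qed.

Lemma value_bounds g team lam : game_wf g -> team_valid g team -> 0 < lam <= 1 ->
  forall n h, hist_ok g h -> 0 <= value g team lam n h <= 1.
Proof.
  intros Hg Ht Hl. induction n as [|n IH]; intros h Hh.
  - simpl. destruct (is_target g _); lra.
  - rewrite value_S. destruct (is_target g _); [lra|].
    pose proof (hist_last g h Hh) as Hs. pose proof (team_mixed_at g team h Ht Hh) as Hq.
    set (f := fun s' => value g team lam n (h ++ [s'])).
    assert (H0 : 0 <= min_over (fun b => expect_step g (last h 0%nat)
      (point (gi_team g) (fun p => team p h) b) f) (av g (gi_team g) (last h 0%nat))).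
    { rewrite <- (min_expect_const g (last h 0%nat) (fun p => team p h) 0) by assumption.
      apply min_expect_le; auto. intros s' Hs'. apply IH. now apply hist_snoc. }
    assert (H1 : min_over (fun b => expect_step g (last h 0%nat)
      (point (gi_team g) (fun p => team p h) b) f) (av g (gi_team g) (last h 0%nat)) <= 1).
    { rewrite <- (min_expect_const g (last h 0%nat) (fun p => team p h) 1) by assumption.
      apply min_expect_le; auto. intros s' Hs'. apply IH. now apply hist_snoc. }
    nra.
Qed.

Lemma value_incr g team : game_wf g -> team_valid g team ->
  forall n h, hist_ok g h -> value g team 1 n h <= value g team 1 (S n) h.
Proof.
  intros Hg Ht. induction n as [|n IH]; intros h Hh.
  - destruct (value_bounds g team 1 Hg Ht ltac:(lra) 1 h Hh) as [H _].
    simpl value at 1. destruct (is_target g (last h 0%nat)) eqn:E; [|exact H].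
    rewrite value_S, E. lra.
  - rewrite (value_S _ _ _ (S n)), value_S. destruct (is_target g _); [lra|].
    apply Rmult_le_compat_l; [lra|]. apply min_expect_le; auto using hist_last, team_mixed_at.
    intros s' Hs'. apply IH. now apply hist_snoc.
Qed.

(** A target reached within [n] steps has been discounted at most [n] times. *)
Lemma value_discount g team lam : game_wf g -> team_valid g team -> 0 < lam <= 1 ->
  forall n h, hist_ok g h -> lam ^ n * value g team 1 n h <= value g team lam n h.
Proof.
  intros Hg Ht Hl. induction n as [|n IH]; intros h Hh.
  - simpl. lra.
  - rewrite !value_S. destruct (is_target g _).
    + assert (lam ^ S n <= 1) by (rewrite <- (pow1 (S n)); apply pow_incr; lra). lra.
    + simpl. rewrite Rmult_1_l, Rmult_assoc. apply Rmult_le_compat_l; [lra|].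
      pose proof (hist_last g h Hh) as Hs. pose proof (team_mixed_at g team h Ht Hh) as Hq.
      destruct (wf_av g (gi_team g) _ Hg (le_n _) Hs) as [Hn _].
      destruct (min_over_in (fun b => expect_step g (last h 0%nat) (point (gi_team g) (fun p => team p h) b)
        (fun s' => value g team lam n (h ++ [s']))) _ Hn) as (b & Hb & ->).
      eapply Rle_trans.
      * apply Rmult_le_compat_l; [apply pow_le; lra|]. apply (min_over_le _ _ b Hb).
      * rewrite <- expect_scal. apply expect_le; auto using mixed_point.
        intros s' Hs'. apply IH. now apply hist_snoc.
Qed.

Lemma is_lim_seq_sumR {A} (u : nat -> A -> R) (v : A -> R) l :
  (forall a, In a l -> is_lim_seq (fun n => u n a) (v a)) ->
  is_lim_seq (fun n => sumR (map (u n) l)) (sumR (map v l)).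
Proof.
  induction l as [|a l IH]; intros H; simpl; [apply is_lim_seq_const|].
  apply is_lim_seq_plus'; [apply H; now left|]. apply IH. intros b Hb. apply H. now right.
Qed.

Lemma is_lim_seq_expect g s q (u : nat -> nat -> R) (v : nat -> R) :
  (forall s', (s' < gi_nst g)%nat -> is_lim_seq (fun n => u n s') (v s')) ->
  is_lim_seq (fun n => expect_step g s q (u n)) (expect_step g s q v).
Proof.
  intros H. unfold expect_step.
  apply (is_lim_seq_sumR (fun n a => weight q 0 a *
    sumR (map (fun s' => delta g s a s' * u n s') (seq 0 (gi_nst g))))).
  intros a _. apply (is_lim_seq_scal_l _ _ (Finite _)).
  apply (is_lim_seq_sumR (fun n s' => delta g s a s' * u n s')). intros s' Hs'. apply in_seq in Hs'.
  apply (is_lim_seq_scal_l _ _ (Finite _)). apply H. lia.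
Qed.

Lemma eventually_all {A} (P : A -> nat -> Prop) l :
  (forall a, In a l -> Hierarchy.eventually (P a)) -> Hierarchy.eventually (fun n => forall a, In a l -> P a n).
Proof.
  induction l as [|a l IH]; intros H.
  - exists 0%nat. intros n _ b [].
  - destruct (H a (or_introl eq_refl)) as [N1 H1].
    destruct IH as [N2 H2]; [intros b Hb; apply H; now right|].
    exists (max N1 N2). intros n Hn b [<-|Hb]; [apply H1|apply H2]; trivial; lia.
Qed.

Definition limit_value (g : game_inst) (team : nat -> strategy) (h : list nat) : R :=
  real (Lim_seq (fun n => value g team 1 n h)).

Lemma limit_value_lim g team h : game_wf g -> team_valid g team -> hist_ok g h ->
  is_lim_seq (fun n => value g team 1 n h) (limit_value g team h).
Proof.
  intros Hg Ht Hh.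
  assert (H : ex_finite_lim_seq (fun n => value g team 1 n h)).
  { apply (ex_finite_lim_seq_incr _ 1).
    - intros n. now apply value_incr.
    - intros n. apply value_bounds; auto; lra. }
  apply Lim_seq_correct' in H. exact H.
Qed.

Lemma value_le_limit g team h n : game_wf g -> team_valid g team -> hist_ok g h ->
  value g team 1 n h <= limit_value g team h.
Proof.
  intros Hg Ht Hh. apply (is_lim_seq_incr_compare (fun n => value g team 1 n h)).
  - now apply limit_value_lim.
  - intros k. now apply value_incr.
Qed.

(* Minimisation over finitely many actions commutes with the monotone limit. *)
Lemma limit_value_greedy g team h : game_wf g -> team_valid g team -> hist_ok g h ->
  is_target g (last h 0%nat) = false ->
  exists b, In b (av g (gi_team g) (last h 0%nat)) /\
    expect_step g (last h 0%nat) (point (gi_team g) (fun p => team p h) b)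
      (fun s' => limit_value g team (h ++ [s'])) <= limit_value g team h.
Proof.
  intros Hg Ht Hh Htar. apply NNPP. intros HN.
  pose proof (hist_last g h Hh) as Hs.
  destruct (wf_av g (gi_team g) _ Hg (le_n _) Hs) as [Hn _].
  (* If no action were greedy, the finitely many actions would all exceed the limit from a common
     horizon [N] on, and the value at horizon [N + 1] would exceed its own limit. *)
  destruct (eventually_all (fun b n => limit_value g team h <
    expect_step g (last h 0%nat) (point (gi_team g) (fun p => team p h) b)
      (fun s' => value g team 1 n (h ++ [s']))) (av g (gi_team g) (last h 0%nat))) as [N HNN].
  - intros b Hb.
    assert (HL : limit_value g team h < expect_step g (last h 0%nat) (point (gi_team g) (fun p => team p h) b)
      (fun s' => limit_value g team (h ++ [s']))).
    { apply Rnot_le_lt. intros H. apply HN. eauto. }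
    pose proof (is_lim_seq_expect g (last h 0%nat) (point (gi_team g) (fun p => team p h) b)
      (fun n s' => value g team 1 n (h ++ [s'])) (fun s' => limit_value g team (h ++ [s']))) as HE.
    apply is_lim_seq_spec in HE; [|intros s' Hs'; apply limit_value_lim; auto; now apply hist_snoc].
    set (E := expect_step _ _ _ _) in HL, HE.
    assert (Heps : 0 < E - limit_value g team h) by lra.
    destruct (HE (mkposreal _ Heps)) as [N HN']. exists N. intros n Hn'. specialize (HN' n Hn').
    simpl in HN'. apply Rabs_def2 in HN'. lra.
  - pose proof (value_le_limit g team h (S N) Hg Ht Hh) as HV. rewrite value_S, Htar in HV.
    destruct (min_over_in (fun b => expect_step g (last h 0%nat) (point (gi_team g) (fun p => team p h) b)
      (fun s' => value g team 1 N (h ++ [s']))) _ Hn) as (b & Hb & Hmin).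
    rewrite Hmin in HV. specialize (HNN N (le_n _) b Hb). lra.
Qed.

Lemma team_finite_horizon g team : game_wf g -> team_valid g team ->
  (forall opp, valid_strategy g (gi_team g) opp ->
     Rbar_lt (Finite (Q2R (gi_thr g))) (reach_prob g (profile_of g team opp))) ->
  exists n, Q2R (gi_thr g) < value g team 1 n [gi_init g].
Proof.
  intros Hg Ht Hwin.
  assert (HG : exists beta : list nat -> nat, forall h, hist_ok g h ->
    In (beta h) (av g (gi_team g) (last h 0%nat)) /\ (is_target g (last h 0%nat) = false ->
    expect_step g (last h 0%nat) (point (gi_team g) (fun p => team p h) (beta h))
      (fun s' => limit_value g team (h ++ [s'])) <= limit_value g team h)).
  { assert (H : forall h, exists b, hist_ok g h -> In b (av g (gi_team g) (last h 0%nat)) /\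
      (is_target g (last h 0%nat) = false ->
      expect_step g (last h 0%nat) (point (gi_team g) (fun p => team p h) b)
      (fun s' => limit_value g team (h ++ [s'])) <= limit_value g team h)).
    { intros h. destruct (classic (hist_ok g h)) as [Hh|Hh]; [|exists 0%nat; tauto].
      destruct (is_target g (last h 0%nat)) eqn:E.
      - destruct (wf_av g (gi_team g) _ Hg (le_n _) (hist_last g h Hh)) as [Hn _].
        destruct (av g (gi_team g) (last h 0%nat)) as [|b l]; [congruence|].
        exists b. intros _. split; [now left|discriminate].
      - destruct (limit_value_greedy g team h Hg Ht Hh E) as (b & H1 & H2). exists b. auto. }
    exists (fun h => proj1_sig (constructive_indefinite_description _ (H h))). intros h.
    exact (proj2_sig (constructive_indefinite_description _ (H h))). }
  destruct HG as [beta Hbeta].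
  set (opp := fun h a => if Nat.eqb a (beta h) then 1 else 0).
  assert (Hopp : valid_strategy g (gi_team g) opp).
  { intros h Hn Hf. cbv zeta. destruct (Hbeta h (conj Hn Hf)) as [Hin _].
    pose proof (hist_last g h (conj Hn Hf)) as Hs. repeat split.
    - intros a. unfold opp. destruct (Nat.eqb _ _); lra.
    - intros a Ha. unfold opp. destruct (Nat.eqb_spec a (beta h)); [congruence|reflexivity].
    - apply dist_point; [|assumption]. now apply wf_av. }
  specialize (Hwin opp Hopp).
  (* Against greedy play the limit values do not increase in expectation, so they dominate the
     reaching probability at every horizon. *)
  assert (HR : forall n h, hist_ok g h -> reach_within g (profile_of g team opp) n h <= limit_value g team h).
  { induction n as [|n IH]; intros h Hh; pose proof (value_le_limit g team h 0 Hg Ht Hh) as H0.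
    - exact H0.
    - rewrite reach_within_S. simpl in H0. destruct (is_target g (last h 0%nat)) eqn:E; [exact H0|].
      destruct (Hbeta h Hh) as [Hin Hle]. etransitivity; [|apply Hle; exact E].
      rewrite (expect_ext_q g _ _ (point (gi_team g) (fun p => team p h) (beta h))).
      + apply expect_le; auto using hist_last.
        * apply mixed_point; auto using hist_last, team_mixed_at.
        * intros s' Hs'. apply IH. now apply hist_snoc.
      + intros p a _. unfold profile_of, point. destruct (Nat.eqb p (gi_team g)); reflexivity. }
  assert (Hs0 : hist_ok g [gi_init g]) by (apply hist_one, Hg).
  assert (HL : Q2R (gi_thr g) < limit_value g team [gi_init g]).
  { apply (Rbar_lt_le_trans (Finite _) _ (Finite _) Hwin). unfold reach_prob.
    rewrite <- (Lim_seq_const (limit_value g team [gi_init g])). apply Lim_seq_le_loc.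
    exists 0%nat. intros n _. now apply HR. }
  pose proof (limit_value_lim g team _ Hg Ht Hs0) as HE. apply is_lim_seq_spec in HE.
  assert (Heps : 0 < limit_value g team [gi_init g] - Q2R (gi_thr g)) by lra.
  destruct (HE (mkposreal _ Heps)) as [N HN]. exists N. specialize (HN N (le_n _)).
  simpl in HN. apply Rabs_def2 in HN. lra.
Qed.

Lemma bernoulli e n : 0 <= e <= 1 -> 1 - INR n * e <= (1 - e) ^ n.
Proof.
  intros He. induction n as [|n IH]; [simpl; lra|]. rewrite S_INR. simpl.
  pose proof (pos_INR n).
  assert ((1 - e) * (1 - INR n * e) <= (1 - e) * (1 - e) ^ n) by (apply Rmult_le_compat_l; lra).
  assert (0 <= INR n * (e * e)) by (apply Rmult_le_pos; [assumption|nra]). nra.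
Qed.

Lemma discount_exists v t n : 0 <= v <= 1 -> t < v -> exists lam, 0 < lam < 1 /\ t < lam ^ n * v.
Proof.
  intros Hv Ht. set (d := v - t). pose proof (pos_INR n).
  (* By [bernoulli] and [v <= 1], discounting [n] times by [1 - e] loses at most [INR n * e], which
     has to stay below the gap [d]. The bound 1/2 keeps [1 - e] positive, and [INR n + 1] allows for
     [n = 0]. *)
  set (e := Rmin (1 / 2) (d / (2 * (INR n + 1)))).
  assert (He : 0 < e).
  { unfold e. apply Rmin_pos; [lra|]. apply Rdiv_lt_0_compat; unfold d; lra. }
  assert (He1 : e <= 1 / 2) by apply Rmin_l.
  assert (He2 : INR n * e < d).
  { assert (e <= d / (2 * (INR n + 1))) by apply Rmin_r.
    assert (H2 : e * (2 * (INR n + 1)) <= d).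
    { apply Rmult_le_reg_r with (/ (2 * (INR n + 1))); [apply Rinv_0_lt_compat; lra|].
      rewrite Rmult_assoc, Rinv_r by lra. unfold Rdiv in *. lra. }
    nra. }
  exists (1 - e). split; [lra|].
  pose proof (bernoulli e n ltac:(lra)).
  assert ((1 - INR n * e) * v <= (1 - e) ^ n * v) by (apply Rmult_le_compat_r; lra).
  assert (INR n * e * v <= INR n * e) by (assert (0 <= INR n * e) by nra; nra).
  unfold d in *. nra.
Qed.

Lemma certificate_complete g : game_wf g -> threshold_yes g -> exists x w lam, certificate g x w lam.
Proof.
  intros Hg (team & Ht & Hwin).
  destruct (team_finite_horizon g team Hg Ht Hwin) as [n0 Hn0].
  assert (Hs0 : hist_ok g [gi_init g]) by (apply hist_one, Hg).
  pose proof (value_bounds g team 1 Hg Ht ltac:(lra) n0 _ Hs0) as HB0.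
  destruct (discount_exists _ _ n0 HB0 Hn0) as (lam & Hlam & Hlt).
  set (lam' := (1 + lam) / 2).
  (* All horizons are taken together so that [w] survives one step: a value at horizon [n + 1]
     refers to values at horizon [n] of longer histories, and [w] bounds these too. *)
  set (E := fun s y => exists n h, hist_ok g h /\ last h 0%nat = s /\ y = value g team lam n h).
  set (w := fun s => real (Lub_Rbar (E s))).
  assert (Hw : forall s, (s < gi_nst g)%nat -> is_lub_Rbar (E s) (w s)).
  { intros s Hs. unfold w. pose proof (Lub_Rbar_correct (E s)) as HL.
    destruct (Lub_Rbar (E s)) as [r| |] eqn:El; [exact HL| |].
    - destruct HL as [_ HL]. specialize (HL (Finite 1)). elim HL.
      intros y (n & h & Hh & _ & ->). simpl. apply value_bounds; auto; lra.
    - destruct HL as [HL _]. elim (HL (value g team lam 0 [s])).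
      exists 0%nat, [s]. split; [now apply hist_one|]. auto. }
  assert (Hub : forall n h, hist_ok g h -> value g team lam n h <= w (last h 0%nat)).
  { intros n h Hh. destruct (Hw _ (hist_last g h Hh)) as [HU _]. apply (HU (value g team lam n h)).
    exists n, h. auto. }
  assert (Hw0 : forall s, (s < gi_nst g)%nat -> 0 <= w s).
  { intros s Hs. etransitivity; [|apply (Hub 0%nat [s]), hist_one, Hs].
    apply value_bounds; auto; [lra|]. now apply hist_one. }
  assert (Hw1 : forall s, (s < gi_nst g)%nat -> w s <= 1).
  { intros s Hs. destruct (Hw s Hs) as [_ HL]. apply (HL (Finite 1)).
    intros y (n & h & Hh & _ & ->). simpl. apply value_bounds; auto; lra. }
  assert (HX : exists H : nat -> list nat, forall s, (s < gi_nst g)%nat ->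
    hist_ok g (H s) /\ last (H s) 0%nat = s /\ (is_target g s = false ->
      forall b, In b (av g (gi_team g) s) ->
      w s <= lam' * expect_step g s (point (gi_team g) (fun p => team p (H s)) b) w)).
  { assert (HX : forall s, exists h, (s < gi_nst g)%nat -> hist_ok g h /\ last h 0%nat = s /\
      (is_target g s = false -> forall b, In b (av g (gi_team g) s) ->
      w s <= lam' * expect_step g s (point (gi_team g) (fun p => team p h) b) w)).
    { intros s. destruct (le_lt_dec (gi_nst g) s) as [Hs|Hs]; [exists []; lia|].
      assert (Hpos : forall h b, hist_ok g h -> last h 0%nat = s -> In b (av g (gi_team g) s) ->
        0 <= expect_step g s (point (gi_team g) (fun p => team p h) b) w).
      { intros h b Hh Hl Hb.
        assert (Hm : mixed g s (point (gi_team g) (fun p => team p h) b))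
          by (apply mixed_point; auto; rewrite <- Hl; now apply team_mixed_at).
        rewrite <- (expect_const g s (point (gi_team g) (fun p => team p h) b) 0) by assumption.
        apply expect_le; auto. }
      (* At weight 0 the inequality holds for any choice, its right side being nonnegative. A
         positive weight exceeds [w s * lam / lam'], which leaves room for a history with a value in
         between. *)
      destruct (Rle_lt_or_eq_dec 0 (w s) (Hw0 s Hs)) as [Hpw|Hzw].
      - assert (HEx : exists n h, hist_ok g h /\ last h 0%nat = s /\ w s * lam / lam' < value g team lam n h).
        { apply NNPP. intros HN. destruct (Hw s Hs) as [_ HL].
          specialize (HL (Finite (w s * lam / lam'))).
          assert (HC : w s <= w s * lam / lam').
          { apply HL. intros y (n & h & Hh & Hl & ->). simpl. apply Rnot_lt_le. intros Hlt'.
            apply HN. eauto. }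
          assert (w s * lam / lam' < w s).
          { apply Rmult_lt_reg_r with lam'; [unfold lam'; lra|].
            unfold Rdiv. rewrite Rmult_assoc, Rinv_l by (unfold lam'; lra).
            unfold lam'. nra. }
          lra. }
        destruct HEx as (n & h & Hh & Hl & Hv). exists h. intros _. split; [exact Hh|]. split; [exact Hl|].
        intros Htar b Hb. destruct n as [|n].
        (* At a nontarget state horizon 0 has value 0 and cannot be close to a positive supremum. *)
        + simpl in Hv. rewrite Hl, Htar in Hv.
          assert (0 < w s * lam / lam').
          { apply Rdiv_lt_0_compat; [nra|unfold lam'; lra]. }
          lra.
        (* The unfolded step carries a factor [lam]; cancelling it against the slack [lam / lam']
           leaves exactly the discount [lam']. *)
        + rewrite value_S, Hl, Htar in Hv.
          assert (H1 : w s * lam / lam' < lam * expect_step g s (point (gi_team g) (fun p => team p h) b) w).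
          { eapply Rlt_le_trans; [exact Hv|]. apply Rmult_le_compat_l; [lra|].
            etransitivity; [apply (min_over_le _ _ b Hb)|]. apply expect_le; auto.
            - apply mixed_point; auto. rewrite <- Hl. now apply team_mixed_at.
            - intros s' Hs'. pose proof (Hub n (h ++ [s']) (hist_snoc _ _ _ Hh Hs')) as HU.
              now rewrite last_last in HU. }
          set (e := expect_step g s _ w) in *.
          assert (H2 : w s * lam < lam * e * lam').
          { apply Rmult_lt_reg_r with (/ lam'); [apply Rinv_0_lt_compat; unfold lam'; lra|].
            rewrite (Rmult_assoc (lam * e)), Rinv_r by (unfold lam'; lra). unfold Rdiv in H1. lra. }
          apply Rlt_le, Rmult_lt_reg_l with lam; lra.
      - exists [s]. intros _. split; [now apply hist_one|]. split; [reflexivity|].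
        intros _ b Hb. rewrite <- Hzw. apply Rmult_le_pos; [unfold lam'; lra|].
        apply Hpos; auto. now apply hist_one. }
    exists (fun s => proj1_sig (constructive_indefinite_description _ (HX s))). intros s.
    exact (proj2_sig (constructive_indefinite_description _ (HX s))). }
  destruct HX as [H HX].
  exists (fun p s => team p (H s)), w, lam'. constructor.
  - intros s Hs p Hp. destruct (HX s Hs) as (H1 & H2 & _). rewrite <- H2 at 2.
    apply valid_dist; auto.
  - unfold lam'. lra.
  - exact Hw0.
  - intros s Hs _. now apply Hw1.
  - intros s b Hs Htar Hb. now apply HX.
  - eapply Rlt_le_trans; [exact Hlt|]. etransitivity; [apply value_discount; auto; lra|].
    apply (Hub n0 [gi_init g] Hs0).
Qed.

Lemma threshold_certificate g : game_wf g ->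
  threshold_yes g <-> exists x w lam, certificate g x w lam.
Proof.
  intros Hg. split; [now apply certificate_complete|].
  intros (x & w & lam & Hc). now apply (certificate_sound g x w lam).
Qed.

(** * The sentence of a game *)

Local Open Scope nat_scope.

(* Rationals are triples ((sign code, absolute numerator), denominator), as in [tr_Q]. *)
Definition rawq : Set := (nat * nat * nat)%type.

(** This is what the grammar guarantees about an input. Its rationals may still have a zero
    denominator, an impossible sign code, or a numerator at odds with the sign; rejecting these is
    left to the sentence. *)
Record raw : Set := mkRaw {
  r_team : nat;
  r_nst : nat;
  r_nact : list nat;
  r_av : list (list (list nat));
  r_tr : list (nat * list nat * list rawq);
  r_target : list nat;
  r_init : nat;
  r_thr : rawq }.

Definition tr_rawq (q : rawq) : tree := Node [Node [Leaf (fst (fst q)); Leaf (snd (fst q))]; Leaf (snd q)].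

Definition tr_entry (e : nat * list nat * list rawq) : tree :=
  Node [Leaf (fst (fst e)); tr_nats (snd (fst e)); Node (map tr_rawq (snd e))].

Definition tr_raw (r : raw) : tree :=
  Node [Leaf (r_team r); Leaf (r_nst r); tr_nats (r_nact r);
        Node (map (fun l => Node (map tr_nats l)) (r_av r));
        Node (map tr_entry (r_tr r));
        tr_nats (r_target r); Leaf (r_init r); tr_rawq (r_thr r)].

Definition nats_sch : sch := SNd (SStar SLf).
Definition rat_sch : sch := SNd (SCons (SNd (SCons SLf SLf)) SLf).
Definition game_sch : sch :=
  SNd (SCons SLf (SCons SLf (SCons nats_sch (SCons (SNd (SStar (SNd (SStar nats_sch))))
    (SCons (SNd (SStar (SNd (SCons SLf (SCons nats_sch (SNd (SStar rat_sch)))))))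
      (SCons nats_sch (SCons SLf rat_sch))))))).

Lemma game_sch_spec (x : den game_sch) : to_trees game_sch x =
  match x with (team, (nst, (nact, (avl, (tr, (tgt, (init, thr))))))) =>
    [tr_raw (mkRaw team nst nact avl (map (fun e => (fst e, fst (snd e), snd (snd e))) tr) tgt init thr)]
  end.
Proof.
  destruct x as (team & nst & nact & avl & tr & tgt & init & thr).
  unfold tr_raw. cbn [r_team r_nst r_nact r_av r_tr r_target r_init r_thr]. rewrite map_map.
  reflexivity.
Qed.

Lemma game_sch_raw t : (exists x, to_trees game_sch x = [t]) <-> exists r, t = tr_raw r.
Proof.
  split.
  - intros [x Hx]. rewrite game_sch_spec in Hx.
    destruct x as (team & nst & nact & avl & tr & tgt & init & thr).
    injection Hx as <-. eexists; reflexivity.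
  - intros [[team nst nact avl tr tgt init thr] ->].
    exists (team, (nst, (nact, (avl, (map (fun e => (fst (fst e), (snd (fst e), snd e))) tr,
      (tgt, (init, thr))))))).
    rewrite game_sch_spec, map_map. do 3 f_equal. rewrite <- (map_id tr) at 2. apply map_ext.
    intros [[? ?] ?]; reflexivity.
Qed.

Definition sumi {A} (F : nat -> A -> R) (l : list A) : R :=
  sumR (map (fun ix => F (fst ix) (snd ix)) (zipi 0 l)).
Definition prodi {A} (F : nat -> A -> R) (l : list A) : R :=
  prodR (map (fun ix => F (fst ix) (snd ix)) (zipi 0 l)).

Lemma zipi_map {A B} (f : A -> B) l : forall k,
  zipi k (map f l) = map (fun ix => (fst ix, f (snd ix))) (zipi k l).
Proof.
  induction l as [|x l IH]; intros k; [reflexivity|].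
  unfold zipi in *. simpl. now rewrite IH.
Qed.

Lemma sum_kids {A} (G : nat * tree -> R) (f : A -> tree) l :
  sumR (map G (zipi 0 (map f l))) = sumi (fun i x => G (i, f x)) l.
Proof. unfold sumi. now rewrite zipi_map, map_map. Qed.

Lemma prod_kids {A} (G : nat * tree -> R) (f : A -> tree) l :
  prodR (map G (zipi 0 (map f l))) = prodi (fun i x => G (i, f x)) l.
Proof. unfold prodi. now rewrite zipi_map, map_map. Qed.

Lemma length_zipi {A} k (l : list A) : length (zipi k l) = length l.
Proof. unfold zipi. now rewrite length_combine, length_seq, Nat.min_id. Qed.

Lemma sum_ones {A} k (l : list A) : sumR (map (fun _ => 1%R) (zipi k l)) = INR (length l).
Proof.
  rewrite <- (length_zipi k l). induction (zipi k l) as [|x z IH]; [reflexivity|].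
  cbn [map length]. rewrite S_INR, <- IH. unfold sumR. simpl. lra.
Qed.

Lemma sumi_ext {A} (F G : nat -> A -> R) l :
  (forall i x, nth_error l i = Some x -> F i x = G i x) -> sumi F l = sumi G l.
Proof.
  intros H. unfold sumi. f_equal. apply map_ext_in. intros [i x] Hi. apply in_zipi in Hi as [_ Hi].
  rewrite Nat.sub_0_r in Hi. now apply H.
Qed.

Lemma prodi_ext {A} (F G : nat -> A -> R) l :
  (forall i x, nth_error l i = Some x -> F i x = G i x) -> prodi F l = prodi G l.
Proof.
  intros H. unfold prodi. f_equal. apply map_ext_in. intros [i x] Hi. apply in_zipi in Hi as [_ Hi].
  rewrite Nat.sub_0_r in Hi. now apply H.
Qed.

Lemma all_kids {A} (P : nat -> tree -> Prop) (Q : nat -> A -> Prop) (f : A -> tree) l :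
  (forall i x, nth_error l i = Some x -> (P i (f x) <-> Q i x)) ->
  (forall i t, nth_error (map f l) i = Some t -> P i t) <-> (forall i x, nth_error l i = Some x -> Q i x).
Proof.
  intros H. split.
  - intros HP i x Hx. apply H; [assumption|]. apply HP. now rewrite nth_error_map, Hx.
  - intros HQ i t Ht. rewrite nth_error_map in Ht. destruct (nth_error l i) as [x|] eqn:E; [|discriminate].
    injection Ht as <-. apply H; auto.
Qed.

Lemma ex_kids {A} (P : nat -> tree -> Prop) (Q : nat -> A -> Prop) (f : A -> tree) l :
  (forall i x, nth_error l i = Some x -> (P i (f x) <-> Q i x)) ->
  (exists i t, nth_error (map f l) i = Some t /\ P i t) <-> (exists i x, nth_error l i = Some x /\ Q i x).
Proof.
  intros H. split.
  - intros (i & t & Ht & HP). rewrite nth_error_map in Ht.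
    destruct (nth_error l i) as [x|] eqn:E; [|discriminate].
    injection Ht as <-. exists i, x. split; [assumption|]. now apply H.
  - intros (i & x & Hx & HQ). exists i, (f x). rewrite nth_error_map, Hx. split; [reflexivity|].
    now apply H.
Qed.

Lemma INR_eq_iff a b : INR a = INR b <-> a = b.
Proof. split; [apply INR_eq|congruence]. Qed.

Lemma INR_lt_iff a b : (INR a < INR b)%R <-> a < b.
Proof. split; [apply INR_lt|apply lt_INR]. Qed.

Lemma INR_pos_iff a : (0 < INR a)%R <-> 0 < a.
Proof. change 0%R with (INR 0). apply INR_lt_iff. Qed.

(** A template walks through the children of a bound node but cannot access a child by the position
    of another one. Variables named by positions serve as tables for that: [vL p s] is a number of
    available actions, [vM e s] the indicator that entry [e] is the one used for its profile at [s],
    [vX] the team's choice and [vW] the weight. [vD] gives rationals without division. [vY] is a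
    player's factor in a profile when the opponent plays [b]; it is a variable because terms have no
    case distinction. *)
Record vars : Type := mkVars {
  vD : rawq -> R;
  vL : nat -> nat -> R;
  vM : nat -> nat -> R;
  vX : nat -> nat -> nat -> R;
  vlam : R;
  vW : nat -> R;
  vY : nat -> nat -> nat -> nat -> R }.

Definition vars_of (N : nat) (rho : valuation) : vars :=
  let u i := repeat true (N - i) in
  mkVars (fun q => rho 0 [bits (fst (fst q)); bits (snd (fst q)); bits (snd q)])
    (fun p s => rho 1 [u p; u s])
    (fun e s => rho 2 [u e; u s])
    (fun p s a => rho 3 [u p; u s; bits a])
    (rho 4 [])
    (fun s => rho 5 [u s])
    (fun p a s b => rho 6 [u p; bits a; u s; bits b]).

(* In the templates below, levels 1 to 8 are the components of the game, in the order of [raw]. *)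
Definition mand (l : list tfm) : tfm := fold_right MAnd (MEq TZero TZero) l.

(* The rational is at level v; l is the next free level. *)
Definition t_rat (v l : nat) : ttm :=
  TLet v 0 (TLet l 0 (TLet l 1 (TLet v 1 (TVar 0 [NLeaf (1 + l); NLeaf (2 + l); NLeaf (3 + l)])))).

Definition f_rat (v l : nat) : tfm :=
  let sg := TConst (1 + l) in let m := TConst (2 + l) in let d := TConst (3 + l) in
  let D := TVar 0 [NLeaf (1 + l); NLeaf (2 + l); NLeaf (3 + l)] in
  MLet v 0 (MLet l 0 (MLet l 1 (MLet v 1 (MAnd (MLt TZero d)
    (MOr (MAnd (MEq sg TZero) (MAnd (MEq m TZero) (MEq D TZero)))
    (MOr (MAnd (MEq sg TOne) (MAnd (MLt TZero m) (MEq (TMul D d) m)))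
      (MAnd (MEq sg (TAdd TOne TOne)) (MAnd (MLt TZero m) (MEq (TMul D d) (TSub TZero m)))))))))).

(** The value is fixed by an equation with the denominator multiplied out, and the conditions on [m]
    and [d] admit only the codes that [tr_Q] produces. *)
Definition rat_ok (v : vars) (q : rawq) : Prop :=
  let sg := fst (fst q) in let m := snd (fst q) in let d := snd q in
  0 < d /\ ((sg = 0 /\ m = 0 /\ vD v q = 0%R) \/ (sg = 1 /\ 0 < m /\ (vD v q * INR d = INR m)%R) \/
    (sg = 2 /\ 0 < m /\ (vD v q * INR d = 0 - INR m)%R)).

Definition t_len (v : nat) : ttm := TSum v TOne.

Definition f_target (v l : nat) : tfm := MEx 6 (MEq (TConst l) (TIdx v)).
Definition targeted (r : raw) (s : nat) : Prop := exists i t, nth_error (r_target r) i = Some t /\ t = s.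

Definition f_shape : tfm :=
  mand [MEq (t_len 3) (TAdd (TConst 1) TOne); MEq (t_len 4) (TAdd (TConst 1) TOne);
        MAll 4 (MEq (t_len 9) (TConst 2));
        MAll 4 (MAll 9 (mand [MLt TZero (t_len 10);
          MAll 10 (MAll 10 (MOr (MEq (TIdx 11) (TIdx 12)) (MNot (MEq (TConst 11) (TConst 12)))));
          MAll 10 (MAll 3 (MOr (MNot (MEq (TIdx 12) (TIdx 9))) (MLt (TConst 11) (TConst 12))))]))].

(** This predicate and those below follow their templates connective by connective, which makes the
    translation mechanical; a [True] conjunct stands for the base case of [mand]. A lookup at a
    given position appears as a quantifier over all positions guarded by an equation. *)
Definition shape (r : raw) : Prop :=
  length (r_nact r) = S (r_team r) /\ length (r_av r) = S (r_team r) /\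
  (forall p lp, nth_error (r_av r) p = Some lp -> length lp = r_nst r) /\
  (forall p lp, nth_error (r_av r) p = Some lp -> forall s l, nth_error lp s = Some l ->
    0 < length l /\
    (forall i a, nth_error l i = Some a -> forall j b, nth_error l j = Some b -> i = j \/ a <> b) /\
    (forall i a, nth_error l i = Some a -> forall p' n, nth_error (r_nact r) p' = Some n -> p' <> p \/ a < n) /\
    True) /\ True.

(* Levels: 10 state, 13 action list. *)
Definition f_valid : tfm :=
  MAnd (MEq (t_len 13) (TAdd (TConst 1) TOne))
    (MAll 13 (MEx 4 (MAnd (MEq (TIdx 15) (TIdx 14)) (MEx 15 (MAnd (MEq (TIdx 16) (TIdx 10))
      (MEx 16 (MEq (TConst 17) (TConst 14)))))))).

Definition valid_acts (r : raw) (s : nat) (al : list nat) : Prop :=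
  length al = S (r_team r) /\
  forall i a, nth_error al i = Some a -> exists p lp, nth_error (r_av r) p = Some lp /\ p = i /\
    exists s' l, nth_error lp s' = Some l /\ s' = s /\ exists j b, nth_error l j = Some b /\ b = a.

(* Levels: 11 entry, 12 its state, 13 its action list. *)
Definition f_first : tfm :=
  MAll 5 (MLet 14 0 (MLet 14 1 (MOr (MNot (MLt (TIdx 14) (TIdx 11))) (MNot (mand [MEq (TConst 15) (TConst 12);
    MEq (t_len 16) (t_len 13);
    MAll 13 (MAll 16 (MOr (MNot (MEq (TIdx 17) (TIdx 18))) (MEq (TConst 17) (TConst 18))))]))))).

(** A transition lookup returns the first match, so an entry counts only if no earlier one has the
    same state and action list. *)
Definition first_entry (r : raw) (e : nat) (s : nat) (al : list nat) : Prop :=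
  forall e' x, nth_error (r_tr r) e' = Some x -> ~ (e' < e) \/
    ~ (fst (fst x) = s /\ length (snd (fst x)) = length al /\
       (forall i a, nth_error al i = Some a -> forall j b, nth_error (snd (fst x)) j = Some b -> i <> j \/ a = b)
       /\ True).

(** The input has no list of states. They are enumerated as the positions in the rows of the
    availability table, whose lengths [f_shape] equates with the number of states; a statement about
    states is thus repeated for every player. *)
Definition f_states (f : tfm) : tfm := MAll 4 (MAll 9 f).
Definition all_states (r : raw) (P : nat -> nat -> list nat -> Prop) : Prop :=
  forall p lp, nth_error (r_av r) p = Some lp -> forall s l, nth_error lp s = Some l -> P p s l.

Definition t_M (e s : nat) : ttm := TVar 2 [NIdx e; NIdx s].
Definition t_L (p s : nat) : ttm := TVar 1 [NIdx p; NIdx s].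
Definition t_X (p s a : nat) : ttm := TVar 3 [NIdx p; NIdx s; NLeaf a].
Definition t_lam : ttm := TVar 4 [].
Definition t_W (s : nat) : ttm := TVar 5 [NIdx s].
Definition t_Y (p a s b : nat) : ttm := TVar 6 [NIdx p; NLeaf a; NIdx s; NLeaf b].

Definition f_select : tfm :=
  f_states (MAll 5 (MLet 11 0 (MLet 11 1 (
    let cond := mand [MEq (TConst 12) (TIdx 10); f_valid; f_first] in
    MOr (MAnd (MEq (t_M 11 10) TOne) cond) (MAnd (MEq (t_M 11 10) TZero) (MNot cond)))))).

Definition selected (r : raw) (e s : nat) (x : nat * list nat * list rawq) : Prop :=
  fst (fst x) = s /\ valid_acts r s (snd (fst x)) /\ first_entry r e (fst (fst x)) (snd (fst x)) /\ True.

Definition select_ok (r : raw) (v : vars) : Prop :=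
  all_states r (fun _ s _ => forall e x, nth_error (r_tr r) e = Some x ->
    (vM v e s = 1%R /\ selected r e s x) \/ (vM v e s = 0%R /\ ~ selected r e s x)).

Definition f_complete : tfm :=
  MAnd (f_states (MEq (t_L 9 10) (t_len 10))) (f_states (MEq (TProd 4 (t_L 11 10)) (TSum 5 (t_M 11 10)))).

Definition complete_ok (r : raw) (v : vars) : Prop :=
  all_states r (fun p s l => vL v p s = INR (length l)) /\
  all_states r (fun _ s _ => prodi (fun p _ => vL v p s) (r_av r) = sumi (fun e _ => vM v e s) (r_tr r)).

(** Only entries that a lookup can return are constrained: [game_wf] leaves the others arbitrary,
    and the sentence must not reject such inputs. *)
Definition f_distr : tfm :=
  f_states (MAll 5 (MOr (MEq (t_M 11 10) TZero) (MLet 11 2 (mand [MEq (t_len 12) (TConst 2);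
    MAll 12 (MLe TZero (t_rat 13 14)); MEq (TSum 12 (t_rat 13 14)) TOne])))).

Definition distr_ok (r : raw) (v : vars) : Prop :=
  all_states r (fun _ s _ => forall e x, nth_error (r_tr r) e = Some x -> vM v e s = 0%R \/
    (length (snd x) = r_nst r /\ (forall i q, nth_error (snd x) i = Some q -> (0 <= vD v q)%R) /\
     sumi (fun _ q => vD v q) (snd x) = 1%R /\ True)).

Definition f_targets : tfm :=
  MAnd (MAll 6 (MLt (TConst 9) (TConst 2)))
    (f_states (MAll 5 (MOr (MEq (t_M 11 10) TZero) (MOr (MNot (f_target 10 12))
      (MLet 11 2 (MAll 12 (MOr (f_target 13 14) (MEq (t_rat 13 14) TZero)))))))).

Definition targets_ok (r : raw) (v : vars) : Prop :=
  (forall i t, nth_error (r_target r) i = Some t -> t < r_nst r) /\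
  all_states r (fun _ s _ => forall e x, nth_error (r_tr r) e = Some x -> vM v e s = 0%R \/
    ~ targeted r s \/ forall s' q, nth_error (snd x) s' = Some q -> targeted r s' \/ vD v q = 0%R).

Definition f_scalars : tfm :=
  mand [MLt (TConst 7) (TConst 2); MLe TZero (t_rat 8 9); MLe (t_rat 8 9) TOne; MLt TZero t_lam; MLt t_lam TOne].

Definition scalars_ok (r : raw) (v : vars) : Prop :=
  r_init r < r_nst r /\ (0 <= vD v (r_thr r))%R /\ (vD v (r_thr r) <= 1)%R /\
  (0 < vlam v)%R /\ (vlam v < 1)%R /\ True.

Definition f_team : tfm :=
  f_states (MOr (MEq (TIdx 9) (TConst 1))
    (MAnd (MAll 10 (MLe TZero (t_X 9 10 11))) (MEq (TSum 10 (t_X 9 10 11)) TOne))).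

Definition team_ok (r : raw) (v : vars) : Prop :=
  all_states r (fun p s l => p = r_team r \/
    ((forall i a, nth_error l i = Some a -> (0 <= vX v p s a)%R) /\ sumi (fun _ a => vX v p s a) l = 1%R)).

Definition f_weights : tfm :=
  f_states (mand [MLe TZero (t_W 10); MOr (MNot (f_target 10 11)) (MLe (t_W 10) TOne);
    MOr (MNot (MEq (TIdx 10) (TConst 7))) (MLt (t_rat 8 11) (t_W 10))]).

Definition weights_ok (r : raw) (v : vars) : Prop :=
  all_states r (fun _ s _ => (0 <= vW v s)%R /\ (~ targeted r s \/ (vW v s <= 1)%R) /\
    (s <> r_init r \/ (vD v (r_thr r) < vW v s)%R) /\ True).

(** The universally quantified part pins the factors [vY]: the indicator of [b] for the opponent,
    [vX] for the team. The expectation is then a sum over table entries, of which those with [vM]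
    equal to 1 correspond to the profiles at the state. *)
Definition f_step : tfm :=
  MAll 4 (MOr (MNot (MEq (TIdx 9) (TConst 1))) (MAll 9 (MOr (f_target 10 11) (MAll 10 (MAnd
    (MAll 5 (MLet 12 1 (MAll 13 (MOr
      (MAnd (MEq (TIdx 14) (TConst 1)) (MOr (MAnd (MEq (TConst 14) (TConst 11)) (MEq (t_Y 14 14 10 11) TOne))
         (MAnd (MNot (MEq (TConst 14) (TConst 11))) (MEq (t_Y 14 14 10 11) TZero))))
      (MAnd (MNot (MEq (TIdx 14) (TConst 1))) (MEq (t_Y 14 14 10 11) (t_X 14 10 14)))))))
    (MLe (t_W 10) (TMul t_lam (TSum 5 (TMul (TMul (t_M 12 10)
      (TLet 12 1 (TProd 13 (t_Y 14 14 10 11))))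
      (TLet 12 2 (TSum 13 (TMul (t_rat 14 15) (t_W 14))))))))))))).

Definition step_ok (r : raw) (v : vars) : Prop :=
  forall p lp, nth_error (r_av r) p = Some lp -> p <> r_team r \/
  forall s l, nth_error lp s = Some l -> targeted r s \/ forall i b, nth_error l i = Some b ->
    (forall e x, nth_error (r_tr r) e = Some x -> forall p' a, nth_error (snd (fst x)) p' = Some a ->
      (p' = r_team r /\ ((a = b /\ vY v p' a s b = 1%R) \/ (a <> b /\ vY v p' a s b = 0%R))) \/
      (p' <> r_team r /\ vY v p' a s b = vX v p' s a)) /\
    (vW v s <= vlam v * sumi (fun e x => vM v e s * prodi (fun p' a => vY v p' a s b) (snd (fst x)) *
      sumi (fun s' q => vD v q * vW v s') (snd x)) (r_tr r))%R.

Definition f_rats : tfm := MAnd (f_rat 8 9) (MAll 5 (MLet 9 2 (MAll 10 (f_rat 11 12)))).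

Definition rats_ok (r : raw) (v : vars) : Prop :=
  rat_ok v (r_thr r) /\
  forall e x, nth_error (r_tr r) e = Some x -> forall i q, nth_error (snd x) i = Some q -> rat_ok v q.

Definition game_formula : tfm :=
  MLet 0 0 (MLet 0 1 (MLet 0 2 (MLet 0 3 (MLet 0 4 (MLet 0 5 (MLet 0 6 (MLet 0 7 (
    mand [f_rats; f_shape; f_select; f_complete; f_distr; f_targets; f_scalars; f_team; f_weights; f_step])))))))).

Definition game_spec (r : raw) (v : vars) : Prop :=
  rats_ok r v /\ shape r /\ select_ok r v /\ complete_ok r v /\ distr_ok r v /\ targets_ok r v /\
  scalars_ok r v /\ team_ok r v /\ weights_ok r v /\ step_ok r v /\ True.

Lemma game_formula_wt : wt [game_sch] (sentence game_formula) = true.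
Proof. vm_compute. reflexivity. Qed.

Lemma game_formula_names : names_ok game_formula = true.
Proof. reflexivity. Qed.

(** * Matching the templates with their meaning *)

Lemma and_iff (A B C D : Prop) : (A <-> C) -> (B <-> D) -> (A /\ B) <-> (C /\ D).
Proof. tauto. Qed.
Lemma or_iff (A B C D : Prop) : (A <-> C) -> (B <-> D) -> (A \/ B) <-> (C \/ D).
Proof. tauto. Qed.

Lemma INR_succ_iff a b : (INR a = INR b + 1)%R <-> a = S b.
Proof. rewrite <- S_INR. apply INR_eq_iff. Qed.
Lemma INR_0_iff a : INR a = 0%R <-> a = 0.
Proof. change 0%R with (INR 0). apply INR_eq_iff. Qed.
Lemma INR_1_iff a : INR a = 1%R <-> a = 1.
Proof. change 1%R with (INR 1). apply INR_eq_iff. Qed.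
Lemma INR_2_iff a : INR a = (1 + 1)%R <-> a = 2.
Proof. change (1 + 1)%R with (INR 2). apply INR_eq_iff. Qed.
Lemma refl_iff (x : R) : x = x <-> True.
Proof. tauto. Qed.

Ltac atom :=
  lazymatch goal with
  | |- (INR _ = INR _) <-> _ => apply INR_eq_iff
  | |- (INR _ = INR _ + 1)%R <-> _ => apply INR_succ_iff
  | |- (INR _ = 0%R) <-> _ => apply INR_0_iff
  | |- (INR _ = 1%R) <-> _ => apply INR_1_iff
  | |- (INR _ = (1 + 1)%R) <-> _ => apply INR_2_iff
  | |- (INR _ < INR _)%R <-> _ => apply INR_lt_iff
  | |- (0 < INR _)%R <-> _ => apply INR_pos_iff
  | |- (?x = ?x) <-> True => apply refl_iff
  | |- ?A <-> ?A => exact (iff_refl A)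
  | _ => idtac
  end.

Ltac evalf :=
  cbv beta iota zeta delta [fval tval get nth app fst snd kids leafv kid comp_bits mand fold_right
       tr_nats tr_rawq tr_entry tr_raw t_len t_rat f_rat f_target f_states
       t_M t_L t_X t_lam t_W t_Y vD vL vM vX vlam vW vY vars_of Nat.add];
  fold tr_rawq tr_entry tr_nats;
  cbn [map]; rewrite ?sum_ones, ?length_map.

Ltac walk := evalf;
  lazymatch goal with
  | |- (_ /\ _) <-> (_ /\ _) => apply and_iff; walk
  | |- (_ \/ _) <-> (_ \/ _) => apply or_iff; walk
  | |- (~ _) <-> (_ <> _) => apply not_iff_compat; walk
  | |- (~ _) <-> (~ _) => apply not_iff_compat; walk
  | |- (forall i t, nth_error (map _ _) i = Some t -> _) <-> _ => apply all_kids; intros ? ? ?; walk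
  | |- (exists i t, nth_error (map _ _) i = Some t /\ _) <-> _ => apply ex_kids; intros ? ? ?; walk
  | _ => atom
  end.

Ltac conjuncts := apply and_iff; [|first [apply refl_iff | conjuncts]].

Lemma game_formula_spec rho N r :
  fval rho N [(0, tr_raw r)] game_formula <-> game_spec r (vars_of N rho).
Proof.
  (* The environment after the eight outermost [MLet], which is what fixes the levels 1 to 8. *)
  set (E := [(0, tr_raw r); (0, Leaf (r_team r)); (0, Leaf (r_nst r)); (0, tr_nats (r_nact r));
    (0, Node (map (fun l => Node (map tr_nats l)) (r_av r))); (0, Node (map tr_entry (r_tr r)));
    (0, tr_nats (r_target r)); (0, Leaf (r_init r)); (0, tr_rawq (r_thr r))]).
  change (fval rho N E (mand [f_rats; f_shape; f_select; f_complete; f_distr; f_targets; f_scalars;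
    f_team; f_weights; f_step]) <-> game_spec r (vars_of N rho)).
  unfold game_spec. cbn [mand fold_right fval]. unfold E; clear E.
  conjuncts.
  - unfold f_rats, rats_ok, rat_ok. walk.
  - unfold f_shape, shape. walk.
  - unfold f_select, select_ok, all_states, selected, f_valid, f_first, valid_acts, first_entry. walk.
  - unfold f_complete, complete_ok, all_states. walk.
    + rewrite prod_kids, sum_kids. reflexivity.
  - unfold f_distr, distr_ok, all_states. walk.
    + rewrite sum_kids. reflexivity.
  - unfold f_targets, targets_ok, all_states, targeted. walk.
  - unfold f_scalars, scalars_ok. walk.
  - unfold f_team, team_ok, all_states. walk. rewrite sum_kids. reflexivity.
  - unfold f_weights, weights_ok, all_states, targeted. walk.
  - unfold f_step, step_ok, targeted. walk.
    rewrite sum_kids.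
    match goal with |- (_ <= _ * ?x)%R <-> (_ <= _ * ?y)%R => replace x with y; [reflexivity|] end.
    apply sumi_ext. intros e y _. evalf. rewrite prod_kids, sum_kids. reflexivity.
Qed.

(** * Games and their descriptions *)

(** Total on raw triples: sign codes other than 0 and 1 are read as negative, and a denominator 0 as
    1. [canonical] excludes the accidental readings. *)
Definition rat_of (q : rawq) : Q :=
  Qmake (match fst (fst q) with 0%nat => 0 | 1%nat => Z.of_nat (snd (fst q)) | _ => - Z.of_nat (snd (fst q)) end)%Z
    (Pos.of_nat (snd q)).

Definition canonical (q : rawq) : Prop :=
  0 < snd q /\ ((fst (fst q) = 0 /\ snd (fst q) = 0) \/ (fst (fst q) = 1 /\ 0 < snd (fst q)) \/
    (fst (fst q) = 2 /\ 0 < snd (fst q))).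

Lemma tr_rat_of q : canonical q -> tr_Q (rat_of q) = tr_rawq q.
Proof.
  destruct q as [[sg m] d]. unfold canonical, rat_of, tr_Q, tr_rawq; simpl. intros (Hd & H).
  rewrite Nat2Pos.id by lia. f_equal. f_equal.
  destruct H as [[-> ->]|[[-> Hm]|[-> Hm]]]; [reflexivity| |];
    destruct m as [|m]; try lia; simpl; now rewrite SuccNat2Pos.id_succ.
Qed.

Lemma rat_of_surj x : exists q, canonical q /\ rat_of q = x.
Proof.
  destruct x as [[|p|p] d].
  - exists ((0, 0), Pos.to_nat d). unfold canonical, rat_of; simpl. rewrite Pos2Nat.id.
    split; [split; [lia|auto]|reflexivity].
  - exists ((1, Pos.to_nat p), Pos.to_nat d). unfold canonical, rat_of; simpl. rewrite Pos2Nat.id, positive_nat_Z.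
    split; [split; [lia|right; left; lia]|reflexivity].
  - exists ((2, Pos.to_nat p), Pos.to_nat d). unfold canonical, rat_of; simpl. rewrite Pos2Nat.id, positive_nat_Z.
    split; [split; [lia|right; right; lia]|reflexivity].
Qed.

Lemma Q2R_rat_of q : Q2R (rat_of q) =
  ((match fst (fst q) with 0%nat => 0 | 1%nat => INR (snd (fst q)) | _ => - INR (snd (fst q)) end) / IZR (Zpos (Pos.of_nat (snd q))))%R.
Proof.
  unfold Q2R, rat_of, Rdiv. simpl. f_equal.
  destruct (fst (fst q)) as [|[|?]]; rewrite ?opp_IZR, <- ?INR_IZR_INZ; reflexivity.
Qed.

Lemma rat_ok_iff v q : rat_ok v q <-> canonical q /\ vD v q = Q2R (rat_of q).
Proof.
  rewrite Q2R_rat_of. destruct q as [[sg m] d]. unfold rat_ok, canonical; simpl.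
  assert (HD : 0 < d -> IZR (Zpos (Pos.of_nat d)) = INR d).
  { intros Hd. rewrite INR_IZR_INZ. f_equal. rewrite <- positive_nat_Z, Nat2Pos.id by lia. reflexivity. }
  assert (HP : 0 < d -> (0 < INR d)%R) by (intros; now apply lt_0_INR).
  generalize (vD v (sg, m, d)). intros D. split.
  - intros (Hd & H). rewrite HD by assumption. specialize (HP Hd). split; [split; [assumption|tauto]|].
    destruct H as [(-> & -> & ->)|[(-> & Hm & H)|(-> & Hm & H)]].
    + unfold Rdiv. lra.
    + rewrite <- H. field. lra.
    + apply (Rmult_eq_reg_r (INR d)); [|lra]. rewrite H. field. lra.
  - intros ((Hd & H) & HE). rewrite HD in HE by assumption. specialize (HP Hd).
    split; [assumption|]. destruct H as [(-> & ->)|[(-> & Hm)|(-> & Hm)]].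
    + left. repeat split. rewrite HE. unfold Rdiv. lra.
    + right; left. repeat split; [assumption|]. rewrite HE. field. lra.
    + right; right. repeat split; [assumption|]. rewrite HE. field. lra.
Qed.

Definition game_of (r : raw) : game_inst :=
  mkGame (r_team r) (r_nst r) (r_nact r) (r_av r)
    (map (fun e => (fst e, map rat_of (snd e))) (r_tr r)) (r_target r) (r_init r) (rat_of (r_thr r)).

Definition raw_canonical (r : raw) : Prop :=
  canonical (r_thr r) /\ forall e x, nth_error (r_tr r) e = Some x ->
    forall i q, nth_error (snd x) i = Some q -> canonical q.

Lemma tr_game_of r : raw_canonical r -> tr_game (game_of r) = tr_raw r.
Proof.
  intros [H1 H2]. unfold tr_game, tr_raw, game_of. cbn [gi_team gi_nst gi_nact gi_av gi_trans gi_target gi_init gi_thr].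
  rewrite (tr_rat_of _ H1), map_map. do 5 f_equal. f_equal. f_equal. apply map_ext_in.
  intros x Hx. apply In_nth_error in Hx as [e He]. unfold tr_entry. cbn [fst snd].
  replace (map tr_Q (map rat_of (snd x))) with (map tr_rawq (snd x)); [reflexivity|].
  rewrite map_map. symmetry. apply map_ext_in. intros q Hq. apply In_nth_error in Hq as [i Hi].
  apply tr_rat_of. eapply H2; eassumption.
Qed.

Lemma map_surj {A B} (f : A -> B) (P : A -> Prop) l : (forall b, In b l -> exists a, P a /\ f a = b) ->
  exists l', map f l' = l /\ forall a, In a l' -> P a.
Proof.
  induction l as [|b l IH]; intros H.
  - exists []. split; [reflexivity|]. intros a [].
  - destruct (H b (or_introl eq_refl)) as (a & Ha & <-).
    destruct IH as (l' & <- & Hl'); [intros; apply H; now right|].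
    exists (a :: l'). split; [reflexivity|]. intros a' [<-|Ha']; auto.
Qed.

Lemma game_of_surj g : exists r, raw_canonical r /\ game_of r = g.
Proof.
  destruct g as [team nst nact avl tr tgt init thr].
  destruct (rat_of_surj thr) as (q & Hq & <-).
  destruct (map_surj (fun e : nat * list nat * list rawq => (fst e, map rat_of (snd e)))
    (fun e => forall q, In q (snd e) -> canonical q) tr) as (tr' & <- & Htr).
  - intros [sa d] _. destruct (map_surj rat_of canonical d) as (d' & <- & Hd').
    + intros x _. apply rat_of_surj.
    + exists (sa, d'). auto.
  - exists (mkRaw team nst nact avl tr' tgt init q). split; [|reflexivity].
    split; [exact Hq|]. intros e x Hx i p Hp. apply (Htr x); eapply nth_error_In; eassumption.
Qed.

(** * Well-formedness read off the raw description *)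

Section Raw.
Context (r : raw).
Let g := game_of r.

Definition sized : Prop :=
  length (r_av r) = S (r_team r) /\ forall p lp, nth_error (r_av r) p = Some lp -> length lp = r_nst r.

Lemma av_nth p lp s l : nth_error (r_av r) p = Some lp -> nth_error lp s = Some l -> av g p s = l.
Proof.
  intros H1 H2. unfold av. simpl. rewrite (nth_error_nth _ _ _ H1). now apply nth_error_nth.
Qed.

Lemma all_states_iff P : sized ->
  all_states r P <-> forall p s, p <= r_team r -> s < r_nst r -> P p s (av g p s).
Proof.
  intros [H1 H2]. split.
  - intros H p s Hp Hs.
    destruct (nth_error (r_av r) p) as [lp|] eqn:E; [|apply nth_error_None in E; lia].
    destruct (nth_error lp s) as [l|] eqn:E'; [|apply nth_error_None in E'; rewrite (H2 _ _ E) in E'; lia].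
    rewrite (av_nth _ _ _ _ E E'). eapply H; eassumption.
  - intros H p lp Hp s l Hs. rewrite <- (av_nth _ _ _ _ Hp Hs).
    apply nth_error_lt in Hs. rewrite (H2 _ _ Hp) in Hs. apply nth_error_lt in Hp.
    apply H; lia.
Qed.

Definition shaped : Prop :=
  length (r_nact r) = S (r_team r) /\ length (r_av r) = S (r_team r) /\
  (forall p, p <= r_team r -> length (nth p (r_av r) []) = r_nst r) /\
  (forall p s, p <= r_team r -> s < r_nst r ->
     av g p s <> [] /\ NoDup (av g p s) /\
     List.Forall (fun a => a < nth p (r_nact r) 0) (av g p s)).

Lemma shaped_sized : shaped -> sized.
Proof.
  intros (_ & H1 & H2 & _). split; [exact H1|]. intros p lp Hp.
  pose proof (nth_error_lt _ _ _ Hp). rewrite <- (nth_error_nth _ _ [] Hp). apply H2. lia.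
Qed.

Lemma NoDup_nth_error_iff {A} (l : list A) :
  (forall i a, nth_error l i = Some a -> forall j b, nth_error l j = Some b -> i = j \/ a <> b) <-> NoDup l.
Proof.
  rewrite NoDup_nth_error. split.
  - intros H i j Hi Hij. destruct (nth_error l i) as [a|] eqn:E; [|apply nth_error_None in E; lia].
    destruct (H i a E j a (eq_sym Hij)); tauto.
  - intros H i a Hi j b Hj. destruct (Nat.eq_dec i j) as [|Hne]; [now left|right]. intros ->.
    apply Hne, H; [eapply nth_error_lt; eassumption|congruence].
Qed.

Lemma shape_iff : shape r <-> shaped.
Proof.
  split.
  - intros (H1 & H2 & H3 & H4 & _).
    assert (Hsz : sized) by (split; assumption).
    pose proof (proj1 (all_states_iff _ Hsz) H4) as H. cbv beta in H.
    repeat split; trivial.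
    + intros p Hp. destruct (nth_error (r_av r) p) as [lp|] eqn:E; [|apply nth_error_None in E; lia].
      rewrite (nth_error_nth _ _ _ E). eauto.
    + destruct (H p s H0 H5) as (Hl & _). destruct (av g p s); [simpl in Hl; lia|discriminate].
    + destruct (H p s H0 H5) as (_ & Hn & _). now apply NoDup_nth_error_iff.
    + destruct (H p s H0 H5) as (_ & _ & Ha & _). apply Forall_forall. intros a Hi.
      apply In_nth_error in Hi as [i Hi].
      destruct (nth_error (r_nact r) p) as [n|] eqn:E; [|apply nth_error_None in E; lia].
      destruct (Ha i a Hi p n E) as [?|Hlt]; [congruence|].
      now rewrite (nth_error_nth _ _ _ E).
  - intros Hsh. pose proof (shaped_sized Hsh) as Hsz. destruct Hsh as (H1 & H2 & H3 & H4).
    repeat split; trivial; [apply Hsz|..].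
    all: assert (Hav : p <= r_team r /\ s < r_nst r /\ av g p s = l)
      by (split; [|split; [|eapply av_nth; eassumption]];
          [apply nth_error_lt in H; lia|apply nth_error_lt in H0; rewrite (proj2 Hsz _ _ H) in H0; lia]).
    all: destruct Hav as (Hp & Hs & <-); destruct (H4 p s Hp Hs) as (A1 & A2 & A3).
    + destruct (av g p s); [congruence|simpl; lia].
    + now apply NoDup_nth_error_iff.
    + intros i a Hi p' n Hn. destruct (Nat.eq_dec p' p) as [->|Hne]; [right|now left].
      rewrite Forall_forall in A3. rewrite <- (nth_error_nth _ _ 0 Hn). apply A3. eapply nth_error_In; eassumption.
Qed.

Lemma valid_acts_iff s al : sized -> s < r_nst r -> valid_acts r s al <-> In al (profiles g s).
Proof.
  intros Hsz Hs. rewrite in_profiles. unfold valid_acts. simpl.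
  split; intros [Hl H]; (split; [exact Hl|]).
  - intros p Hp.
    destruct (nth_error al p) as [a|] eqn:E; [|apply nth_error_None in E; lia].
    destruct (H p a E) as (p' & lp & H1 & -> & s' & l & H2 & -> & j & b & H3 & ->).
    rewrite (nth_error_nth _ _ _ E), (av_nth _ _ _ _ H1 H2). eapply nth_error_In; eassumption.
  - intros i a Hi. pose proof (nth_error_lt _ _ _ Hi) as Hlt. destruct Hsz as [S1 S2].
    destruct (nth_error (r_av r) i) as [lp|] eqn:E; [|apply nth_error_None in E; lia].
    destruct (nth_error lp s) as [l|] eqn:E'; [|apply nth_error_None in E'; rewrite (S2 _ _ E) in E'; lia].
    exists i, lp. repeat split; trivial. exists s, l. repeat split; trivial.
    specialize (H i ltac:(lia)). rewrite (nth_error_nth _ _ _ Hi), (av_nth _ _ _ _ E E') in H.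
    apply In_nth_error in H as [j Hj]. eauto.
Qed.

Lemma first_entry_iff e s al : first_entry r e s al <->
  forall e' x, nth_error (r_tr r) e' = Some x -> e' < e -> fst x <> (s, al).
Proof.
  assert (HL : forall (a b : list nat), (length b = length a /\
    (forall i x, nth_error a i = Some x -> forall j y, nth_error b j = Some y -> i <> j \/ x = y) /\ True)
    <-> b = a).
  { intros a b. split.
    - intros (Hl & H & _). apply nth_error_ext. intros i.
      destruct (nth_error a i) as [x|] eqn:E, (nth_error b i) as [y|] eqn:E'; trivial.
      + destruct (H i x E i y E'); [tauto|congruence].
      + apply nth_error_lt in E. apply nth_error_None in E'. lia.
      + apply nth_error_lt in E'. apply nth_error_None in E. lia.
    - intros ->. repeat split. intros i x Hi j y Hj. destruct (Nat.eq_dec i j); [right|tauto]. congruence. }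
  unfold first_entry. split.
  - intros H e' x Hx Hlt HE. destruct (H e' x Hx) as [?|HN]; [lia|]. apply HN.
    rewrite HE. simpl. split; [reflexivity|]. now apply HL.
  - intros H e' x Hx. destruct (le_lt_dec e e') as [Hle|Hlt]; [left; lia|right].
    intros (H1 & H2). apply HL in H2. apply (H e' x Hx Hlt). destruct (fst x); simpl in *; congruence.
Qed.

Lemma nat_list_eqb_eq a : forall b, nat_list_eqb a b = true <-> a = b.
Proof.
  induction a as [|x a IH]; intros [|y b]; simpl; try (split; congruence).
  rewrite Bool.andb_true_iff, Nat.eqb_eq, IH. split; [intros [-> ->]|intros [= -> ->]]; auto.
Qed.

Lemma find_first {A} (f : A -> bool) l x : find f l = Some x <->
  exists i, nth_error l i = Some x /\ f x = true /\ forall j y, nth_error l j = Some y -> j < i -> f y = false.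
Proof.
  induction l as [|a l IH]; simpl.
  - split; [discriminate|]. intros (i & Hi & _). destruct i; discriminate.
  - destruct (f a) eqn:E.
    + split.
      * intros [= ->]. exists 0. repeat split; trivial. intros; lia.
      * intros ([|i] & Hi & Hx & H); simpl in Hi; [congruence|].
        specialize (H 0 a eq_refl ltac:(lia)). congruence.
    + rewrite IH. split.
      * intros (i & Hi & Hx & H). exists (S i). repeat split; trivial.
        intros [|j] y Hj Hlt; simpl in Hj; [congruence|]. apply (H j); trivial; lia.
      * intros ([|i] & Hi & Hx & H); simpl in Hi; [congruence|].
        exists i. repeat split; trivial. intros j y Hj Hlt. apply (H (S j)); trivial; lia.
Qed.

Lemma lookup_iff s a d : trans_lookup g s a = Some d <->
  exists e x, nth_error (r_tr r) e = Some x /\ fst x = (s, a) /\ first_entry r e s a /\ d = map rat_of (snd x).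
Proof.
  unfold trans_lookup.
  assert (HK : forall x : nat * list nat * list Q,
    (Nat.eqb (fst (fst x)) s && nat_list_eqb (snd (fst x)) a)%bool = true <-> fst x = (s, a)).
  { intros [[s0 a0] d0]. simpl. rewrite Bool.andb_true_iff, Nat.eqb_eq, nat_list_eqb_eq.
    split; [intros [-> ->]|intros [= -> ->]]; auto. }
  split.
  - intros H. destruct (find _ (gi_trans g)) as [x|] eqn:E; [|discriminate]. injection H as <-.
    apply find_first in E as (e & He & Hx & Hf). simpl in He. rewrite nth_error_map in He.
    destruct (nth_error (r_tr r) e) as [y|] eqn:Ey; [|discriminate]. injection He as <-.
    exists e, y. apply HK in Hx. simpl in Hx. repeat split; trivial.
    apply first_entry_iff. intros e' z Hz Hlt Hzk.
    specialize (Hf e' (fst z, map rat_of (snd z))). simpl in Hf.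
    rewrite nth_error_map, Hz in Hf. specialize (Hf eq_refl Hlt).
    pose proof (proj2 (HK (fst z, map rat_of (snd z))) Hzk) as HT. simpl in HT. congruence.
  - intros (e & x & Hx & Hk & Hf & ->). rewrite first_entry_iff in Hf.
    assert (HF : find (fun e0 => (Nat.eqb (fst (fst e0)) s && nat_list_eqb (snd (fst e0)) a)%bool)
      (gi_trans g) = Some (fst x, map rat_of (snd x))).
    { apply find_first. exists e. simpl. rewrite nth_error_map, Hx. repeat split.
      - now apply (HK (fst x, map rat_of (snd x))).
      - intros j y Hj Hlt. rewrite nth_error_map in Hj.
        destruct (nth_error (r_tr r) j) as [z|] eqn:Ez; [|discriminate]. injection Hj as <-.
        apply Bool.not_true_is_false. intros HT. apply (HK (fst z, map rat_of (snd z))) in HT.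
        exact (Hf j z Ez Hlt HT). }
    rewrite HF. reflexivity.
Qed.

Lemma is_target_iff s : is_target g s = true <-> targeted r s.
Proof.
  unfold is_target, targeted. rewrite existsb_exists. split.
  - intros (t & Ht & E). apply Nat.eqb_eq in E. apply In_nth_error in Ht as [i Hi]. simpl in Hi. eauto.
  - intros (i & t & Hi & ->). exists s. split; [eapply nth_error_In; eassumption|]. apply Nat.eqb_refl.
Qed.

End Raw.

(** * Counting profiles and selected entries *)

Lemma NoDup_cart ls : List.Forall (@NoDup nat) ls -> NoDup (cart ls).
Proof.
  induction 1 as [|l ls Hl _ IH]; simpl; [constructor; [tauto|constructor]|].
  induction Hl as [|x l Hx _ IHl]; simpl; [constructor|].
  apply NoDup_app; [|exact IHl|].
  - apply FinFun.Injective_map_NoDup; [|exact IH]. intros a b [= ->]. reflexivity.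
  - intros a Ha Hb. apply in_map_iff in Ha as (a' & <- & _).
    apply in_flat_map in Hb as (y & Hy & Hb). apply in_map_iff in Hb as (b' & E & _).
    injection E as -> _. contradiction.
Qed.

Lemma length_cart ls : INR (length (cart ls)) = prodR (map (fun l => INR (length l)) ls).
Proof.
  induction ls as [|l ls IH]; simpl; [reflexivity|].
  rewrite (length_flat_map _ _ ), (map_ext _ (fun _ => length (cart ls))) by (intros; apply length_map).
  fold (prodR (map (fun l => INR (length l)) ls)). rewrite <- IH, <- mult_INR. f_equal.
  clear. induction l; simpl; [reflexivity|]. lia.
Qed.

Lemma sumR_perm {A} (F : A -> R) l l' : Permutation l l' -> sumR (map F l) = sumR (map F l').
Proof. induction 1; simpl; lra. Qed.

Lemma map_fst_zipi {A} (l : list A) : forall k, map fst (zipi k l) = seq k (length l).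
Proof. induction l as [|x l IH]; intros k; [reflexivity|]. unfold zipi in *. simpl. now rewrite IH. Qed.

Lemma map_snd_zipi {A} (l : list A) : forall k, map snd (zipi k l) = l.
Proof. induction l as [|x l IH]; intros k; [reflexivity|]. unfold zipi in *. simpl. now rewrite IH. Qed.

Lemma sumi_fst {A} (F : nat -> R) (l : list A) : sumi (fun i _ => F i) l = sumR (map F (seq 0 (length l))).
Proof. unfold sumi. rewrite <- map_fst_zipi, map_map. reflexivity. Qed.

Lemma sumi_snd {A} (F : A -> R) (l : list A) : sumi (fun _ x => F x) l = sumR (map F l).
Proof. unfold sumi. rewrite <- (map_snd_zipi l 0) at 2. rewrite map_map. reflexivity. Qed.

Lemma prodi_fst {A} (F : nat -> R) (l : list A) : prodi (fun i _ => F i) l = prodR (map F (seq 0 (length l))).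
Proof. unfold prodi. rewrite <- map_fst_zipi, map_map. reflexivity. Qed.

Lemma NoDup_map_filter_zipi {A B} (f : nat * A -> B) (p : nat * A -> bool) l : forall k,
  (forall a b, In a (zipi k l) -> In b (zipi k l) -> p a = true -> p b = true -> fst a < fst b -> f a <> f b) ->
  NoDup (map f (filter p (zipi k l))).
Proof.
  induction l as [|x l IH]; intros k H; [constructor|].
  change (zipi k (x :: l)) with ((k, x) :: zipi (S k) l) in *.
  assert (HI : NoDup (map f (filter p (zipi (S k) l)))).
  { apply IH. intros a b Ha Hb. apply H; now right. }
  simpl. destruct (p (k, x)) eqn:E; [|exact HI]. simpl. constructor; [|exact HI].
  intros Hin. apply in_map_iff in Hin as ([j y] & Hf & Hj). apply filter_In in Hj as [Hj Hp].
  pose proof Hj as Hj'. apply in_zipi in Hj' as [Hle _].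
  refine (H (k, x) (j, y) (or_introl eq_refl) (or_intror Hj) E Hp _ (eq_sym Hf)). simpl. lia.
Qed.

Lemma sumR_indicator {A} (m F : A -> R) (l : list A) :
  (forall a, In a l -> m a = 1%R \/ m a = 0%R) ->
  sumR (map (fun a => m a * F a)%R l) =
  sumR (map F (filter (fun a => if Req_EM_T (m a) 1 then true else false) l)).
Proof.
  induction l as [|a l IH]; intros H; [reflexivity|]. simpl.
  assert (HI := IH (fun b Hb => H b (or_intror Hb))).
  destruct (H a (or_introl eq_refl)) as [E|E]; destruct (Req_EM_T (m a) 1) as [E'|E'];
    try lra; simpl; rewrite HI, E; lra.
Qed.

Lemma Q2R_sum l : Q2R (fold_right Qplus 0%Q (map rat_of l)) = sumR (map (fun q => Q2R (rat_of q)) l).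
Proof.
  induction l as [|q l IH]; simpl; [unfold Q2R; simpl; lra|]. rewrite Q2R_plus, IH. reflexivity.
Qed.

Lemma Q2R_0 : Q2R 0 = 0%R.
Proof. unfold Q2R; simpl; lra. Qed.
Lemma Q2R_1 : Q2R 1 = 1%R.
Proof. unfold Q2R; simpl; lra. Qed.

Section Selection.
Context (r : raw) (v : vars).
Let g := game_of r.
Context (Hsh : shaped r) (Hsel : select_ok r v).

Let Hsz : sized r := shaped_sized r Hsh.

Lemma select_at e s x : s < r_nst r -> nth_error (r_tr r) e = Some x ->
  (vM v e s = 1%R /\ selected r e s x) \/ (vM v e s = 0%R /\ ~ selected r e s x).
Proof.
  intros Hs Hx. exact (proj1 (all_states_iff r _ Hsz) Hsel 0 s (Nat.le_0_l _) Hs e x Hx).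
Qed.

Lemma selected_iff e s x : s < r_nst r -> selected r e s x <->
  fst (fst x) = s /\ In (snd (fst x)) (profiles g s) /\ first_entry r e s (snd (fst x)).
Proof.
  intros Hs. unfold selected. rewrite (valid_acts_iff r s _ Hsz Hs). split.
  - intros (E & H1 & H2 & _). rewrite E in H2. auto.
  - intros (E & H1 & H2). rewrite <- E in H2 at 1. auto.
Qed.

Definition sel_entries (s : nat) : list (nat * (nat * list nat * list rawq)) :=
  filter (fun ix => if Req_EM_T (vM v (fst ix) s) 1 then true else false) (zipi 0 (r_tr r)).

(** These are the profiles at [s] that have a transition, each listed once: of two entries with the
    same key the later one is not selected. Completeness of the table thus becomes a matter of
    counting. *)
Definition acts (s : nat) : list (list nat) := map (fun ix => snd (fst (snd ix))) (sel_entries s).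

Lemma in_sel s e x : s < r_nst r -> In (e, x) (sel_entries s) <->
  nth_error (r_tr r) e = Some x /\ selected r e s x.
Proof.
  intros Hs. unfold sel_entries. rewrite filter_In, in_zipi, Nat.sub_0_r. simpl. split.
  - intros [[_ Hx] HM]. split; [exact Hx|]. destruct (Req_EM_T _ _) as [E|]; [|discriminate].
    destruct (select_at e s x Hs Hx) as [[_ H]|[H _]]; [exact H|lra].
  - intros [Hx H]. split; [split; [lia|exact Hx]|].
    destruct (select_at e s x Hs Hx) as [[HM _]|[_ HN]]; [|contradiction].
    destruct (Req_EM_T _ _); [reflexivity|contradiction].
Qed.

Lemma in_acts s a : s < r_nst r -> In a (acts s) <->
  In a (profiles g s) /\ exists d, trans_lookup g s a = Some d.
Proof.
  intros Hs. unfold acts. rewrite in_map_iff. split.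
  - intros ([e x] & <- & H). apply in_sel in H as [Hx H]; [|assumption].
    apply selected_iff in H as (E & H1 & H2); [|assumption]. simpl. split; [exact H1|].
    eexists. apply lookup_iff. exists e, x. repeat split; trivial. destruct x as [[? ?] ?]; simpl in *; congruence.
  - intros (Ha & d & Hd). apply lookup_iff in Hd as (e & x & Hx & Hk & Hf & _).
    exists (e, x). simpl. rewrite Hk. split; [reflexivity|]. apply in_sel; [assumption|].
    split; [exact Hx|]. apply selected_iff; [assumption|]. rewrite Hk. auto.
Qed.

Lemma nodup_acts s : s < r_nst r -> NoDup (acts s).
Proof.
  intros Hs. apply NoDup_map_filter_zipi. intros [i x] [j y] Hi Hj Hpi Hpj Hlt E. simpl in *.
  assert (Hx : In (i, x) (sel_entries s)) by (apply filter_In; auto).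
  assert (Hy : In (j, y) (sel_entries s)) by (apply filter_In; auto).
  apply in_sel in Hx as [Hx H1]; [|assumption]. apply in_sel in Hy as [Hy H2]; [|assumption].
  apply selected_iff in H1 as (E1 & _ & _); [|assumption].
  apply selected_iff in H2 as (E2 & _ & H2); [|assumption].
  rewrite first_entry_iff in H2. apply (H2 i x Hx Hlt).
  destruct (fst x); simpl in *; congruence.
Qed.

Lemma nodup_profiles s : s < r_nst r -> NoDup (profiles g s).
Proof.
  intros Hs. apply NoDup_cart. apply Forall_forall. intros l Hl.
  apply in_map_iff in Hl as (p & <- & Hp). apply in_seq in Hp. apply Hsh; [simpl in Hp; lia|exact Hs].
Qed.

Lemma sum_selected s (F : nat -> nat * list nat * list rawq -> R) (H : list nat -> R) : s < r_nst r ->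
  (forall e x, nth_error (r_tr r) e = Some x -> selected r e s x -> F e x = H (snd (fst x))) ->
  sumi (fun e x => vM v e s * F e x)%R (r_tr r) = sumR (map H (acts s)).
Proof.
  intros Hs HF. unfold sumi.
  rewrite (sumR_indicator (fun ix => vM v (fst ix) s) (fun ix => F (fst ix) (snd ix))).
  - unfold acts. rewrite map_map. apply sumR_ext. intros [e x] Hi.
    apply in_sel in Hi as [Hx Hi]; [|assumption]. simpl. auto.
  - intros [e x] Hi. apply in_zipi in Hi as [_ Hi]. rewrite Nat.sub_0_r in Hi. simpl.
    destruct (select_at e s x Hs Hi); tauto.
Qed.

Lemma count_selected s : s < r_nst r -> sumi (fun e _ => vM v e s) (r_tr r) = INR (length (acts s)).
Proof.
  intros Hs.
  transitivity (sumR (map (fun _ => 1%R) (acts s))).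
  - rewrite <- (sum_selected s (fun _ _ => 1%R) (fun _ => 1%R) Hs) by reflexivity.
    apply sumi_ext. intros. lra.
  - induction (acts s) as [|a l IH]; [reflexivity|].
    cbn [length map]. rewrite S_INR, <- IH. unfold sumR; simpl; lra.
Qed.

Lemma count_profiles s : prodR (map (fun p => INR (length (av g p s))) (seq 0 (length (r_av r))))
  = INR (length (profiles g s)).
Proof.
  unfold profiles. rewrite length_cart, map_map. destruct Hsz as [-> _]. reflexivity.
Qed.

Lemma acts_incl s : s < r_nst r -> incl (acts s) (profiles g s).
Proof. intros Hs a Ha. now apply in_acts in Ha as [Ha _]. Qed.

(* A duplicate-free sublist with as many elements as the whole list exhausts it. *)
Lemma acts_perm s : s < r_nst r ->
  sumi (fun e _ => vM v e s) (r_tr r) = INR (length (profiles g s)) <-> Permutation (acts s) (profiles g s).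
Proof.
  intros Hs. rewrite count_selected by assumption. split.
  - intros H. apply INR_eq in H. apply NoDup_Permutation_bis; [now apply nodup_acts|lia|now apply acts_incl].
  - intros H. now rewrite (Permutation_length H).
Qed.

Lemma delta_entry s a e x s' q : nth_error (r_tr r) e = Some x -> fst x = (s, a) -> first_entry r e s a ->
  nth_error (snd x) s' = Some q -> delta g s a s' = Q2R (rat_of q).
Proof.
  intros Hx Hk Hf Hq. unfold delta.
  assert (HL : trans_lookup g s a = Some (map rat_of (snd x))) by (apply lookup_iff; eauto 7).
  rewrite HL.
  f_equal. apply nth_error_nth. now rewrite nth_error_map, Hq.
Qed.

(** The indicator [vM] removes all but the selected entries, and these run through the profiles
    exactly once, so summing over the table is summing over the profiles. *)
Lemma step_sum s b (W : nat -> R) (Y : nat -> nat -> R) (x : nat -> nat -> R) : s < r_nst r ->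
  (forall e y, nth_error (r_tr r) e = Some y -> selected r e s y -> length (snd y) = r_nst r) ->
  (forall e y i q, nth_error (r_tr r) e = Some y -> nth_error (snd y) i = Some q -> vD v q = Q2R (rat_of q)) ->
  Permutation (acts s) (profiles g s) ->
  (forall e y, nth_error (r_tr r) e = Some y -> forall p a, nth_error (snd (fst y)) p = Some a ->
     Y p a = point (r_team r) x b p a) ->
  sumi (fun e y => vM v e s * prodi (fun p a => Y p a) (snd (fst y)) *
      sumi (fun s' q => vD v q * W s') (snd y))%R (r_tr r)
  = expect_step g s (point (gi_team g) x b) W.
Proof.
  intros Hs Hlen HD HP HY.
  set (H := fun a => (weight (point (gi_team g) x b) 0 a *
    sumR (map (fun s' => delta g s a s' * W s') (seq 0 (gi_nst g))))%R).
  unfold expect_step. fold H. rewrite <- (sumR_perm H _ _ HP).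
  rewrite <- (sum_selected s (fun e y => prodi (fun p a => Y p a) (snd (fst y)) *
      sumi (fun s' q => vD v q * W s') (snd y))%R H Hs).
  - apply sumi_ext. intros. ring.
  - intros e y Hy Hsl. unfold H. f_equal.
    + apply prodi_ext. intros p a Ha. apply (HY e y Hy p a Ha).
    + pose proof (proj1 (selected_iff e s y Hs) Hsl) as (E & _ & Hf).
      simpl gi_nst. rewrite <- (Hlen e y Hy Hsl), <- (sumi_fst (fun s' => delta g s (snd (fst y)) s' * W s')%R).
      apply sumi_ext. intros i q Hq. rewrite (HD e y i q Hy Hq).
      rewrite (delta_entry s (snd (fst y)) e y i q); trivial.
      destruct (fst y); simpl in *; congruence.
Qed.

End Selection.

(** * From solutions of the sentence to certified games, and back *)

Lemma game_spec_sound r v : game_spec r v ->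
  raw_canonical r /\ game_wf (game_of r) /\ certificate (game_of r) (vX v) (vW v) (vlam v).
Proof.
  intros (HR & Hshape & Hsel & [HL HC] & Hdist & [Ht1 Ht2] & (Hi & Hth0 & Hth1 & Hl0 & Hl1 & _) & Hteam & Hw & Hstep & _).
  apply shape_iff in Hshape as Hsh. pose proof (shaped_sized r Hsh) as Hsz.
  set (g := game_of r).
  assert (HD : vD v (r_thr r) = Q2R (rat_of (r_thr r))) by (apply rat_ok_iff, HR).
  assert (HDq : forall e y i q, nth_error (r_tr r) e = Some y -> nth_error (snd y) i = Some q ->
    vD v q = Q2R (rat_of q)).
  { intros e y i q Hy Hq. apply rat_ok_iff. eapply HR; eassumption. }
  unfold complete_ok, distr_ok, targets_ok, team_ok, weights_ok in *.
  rewrite all_states_iff in HL, HC, Hdist, Ht2, Hteam, Hw by assumption.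
  (* Statements about states hold once for every player; player 0 always exists and provides the
     instance. *)
  assert (Hp0 : 0 <= r_team r) by lia.
  assert (HP : forall s, s < r_nst r -> Permutation (acts r v s) (profiles g s)).
  { intros s Hs. apply acts_perm; trivial. rewrite <- (HC 0 s Hp0 Hs).
    rewrite <- (count_profiles r Hsh s), <- prodi_fst. apply prodi_ext. intros p lp Hp.
    apply HL; [|assumption]. apply nth_error_lt in Hp. rewrite (proj1 Hsz) in Hp. lia. }
  assert (HE : forall s a, s < r_nst r -> In a (profiles g s) -> exists e x,
    nth_error (r_tr r) e = Some x /\ fst x = (s, a) /\ first_entry r e s a /\
    trans_lookup g s a = Some (map rat_of (snd x)) /\ selected r e s x /\ vM v e s = 1%R /\
    length (snd x) = r_nst r).
  { intros s a Hs Ha. apply (Permutation_in a (Permutation_sym (HP s Hs))) in Ha.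
    apply in_acts in Ha as [Ha (d & Hd)]; trivial. pose proof Hd as Hd'.
    apply lookup_iff in Hd as (e & x & Hx & Hk & Hf & ->). exists e, x.
    assert (Hse : selected r e s x) by (apply selected_iff; trivial; rewrite Hk; auto).
    assert (HM : vM v e s = 1%R) by (destruct (select_at r v Hsh Hsel e s x Hs Hx); tauto).
    refine (conj Hx (conj Hk (conj Hf (conj Hd' (conj Hse (conj HM _)))))).
    destruct (Hdist 0 s Hp0 Hs e x Hx) as [?|H]; [lra|apply H]. }
  assert (Htg : forall s, is_target g s = true <-> targeted r s) by (intros; apply is_target_iff).
  split; [|split].
  - split; [apply rat_ok_iff with v, HR|]. intros e x Hx i q Hq. apply rat_ok_iff with v.
    eapply HR; eassumption.
  - destruct Hsh as (H1 & H2 & H3 & H4).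
    repeat split; trivial; simpl gi_nst in *; simpl gi_team in *; try (now apply H4).
    + intros s a Hs Ha. destruct (HE s a Hs Ha) as (e & x & Hx & Hk & Hf & Hlk & Hse & HM & Hlen).
      destruct (Hdist 0 s Hp0 Hs e x Hx) as [?|(_ & Hpos & Hsum & _)]; [lra|].
      exists (map rat_of (snd x)). repeat split; trivial.
      * now rewrite length_map.
      * apply Forall_forall. intros y Hy. apply in_map_iff in Hy as (q & <- & Hq).
        apply In_nth_error in Hq as [i Hq]. apply Rle_Qle. rewrite Q2R_0, <- (HDq e x i q Hx Hq). eauto.
      * apply eqR_Qeq. rewrite Q2R_sum, Q2R_1, <- Hsum, <- sumi_snd. apply sumi_ext.
        intros i q Hq. symmetry. eapply HDq; eassumption.
    + apply Forall_forall. intros t Ht. apply In_nth_error in Ht as [i Hti]. eauto.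
    + intros s a s' Hs Hta Ha Hs' Hta'. destruct (HE s a Hs Ha) as (e & x & Hx & Hk & Hf & Hlk & Hse & HM & Hlen).
      destruct (nth_error (snd x) s') as [q|] eqn:Hq; [|apply nth_error_None in Hq; lia].
      etransitivity; [exact (delta_entry r s a e x s' q Hx Hk Hf Hq)|].
      rewrite <- (HDq e x s' q Hx Hq). destruct (Ht2 0 s Hp0 Hs e x Hx) as [?|[HN|H]]; [lra|elim HN; now apply Htg|].
      destruct (H s' q Hq) as [HT|]; [|assumption]. apply Htg in HT. congruence.
    + apply Rle_Qle. rewrite Q2R_0. simpl. lra.
    + apply Rle_Qle. rewrite Q2R_1. simpl. lra.
  - constructor; simpl gi_nst; simpl gi_team.
    + intros s Hs p Hp. simpl in Hs, Hp. destruct (Hteam p s ltac:(lia) Hs) as [->|[H1 H2]]; [lia|].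
      split.
      * intros a Ha. apply In_nth_error in Ha as [i Ha]. eauto.
      * now rewrite <- sumi_snd.
    + auto.
    + intros s Hs. now apply (Hw 0 s Hp0 Hs).
    + intros s Hs Ht. destruct (Hw 0 s Hp0 Hs) as (_ & [HN|H] & _); [|exact H]. elim HN. now apply Htg.
    + intros s b Hs Ht Hb.
      destruct (nth_error (r_av r) (r_team r)) as [lp|] eqn:E;
        [|apply nth_error_None in E; rewrite (proj1 Hsz) in E; lia].
      destruct (nth_error lp s) as [l|] eqn:E'; [|apply nth_error_None in E'; rewrite (proj2 Hsz _ _ E) in E'; lia].
      change (gi_team g) with (r_team r) in Hb. unfold g in Hb. rewrite (av_nth r _ _ _ _ E E') in Hb.
      apply In_nth_error in Hb as [i Hb].
      destruct (Hstep _ _ E) as [?|H]; [congruence|]. destruct (H s l E') as [HT|H'].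
      { apply Htg in HT. congruence. }
      destruct (H' i b Hb) as [HY HLe].
      rewrite (step_sum r v Hsh Hsel s b (vW v) (fun p a => vY v p a s b) (fun p => vX v p s)) in HLe; trivial.
      * intros e y Hy Hse. destruct (Hdist 0 s Hp0 Hs e y Hy) as [HM|HM]; [|apply HM].
        destruct (select_at r v Hsh Hsel e s y Hs Hy) as [[? _]|[_ ?]]; [lra|contradiction].
      * now apply HP.
      * intros e y Hy p a Ha. unfold point.
        destruct (HY e y Hy p a Ha) as [(-> & [(-> & ->)|(Hab & ->)])|(Hp & ->)].
        -- now rewrite !Nat.eqb_refl.
        -- rewrite Nat.eqb_refl. apply Nat.eqb_neq in Hab. now rewrite Hab.
        -- apply Nat.eqb_neq in Hp. now rewrite Hp.
    + simpl. rewrite <- HD. destruct (Hw 0 (r_init r) Hp0 Hi) as (_ & _ & [?|?] & _); [congruence|assumption].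
Qed.

Lemma enc_kid_le N t i u : length (enc_tree t) <= N -> nth_error (kids t) i = Some u ->
  i <= N /\ length (enc_tree u) <= N.
Proof. intros H Hi. apply enc_kid_lt in Hi. lia. Qed.

(** Variable names contain positions as [N - i] marks. Such bounds keep the truncated subtraction
    invertible, so that tables indexed by positions can be filled at will. *)
Lemma av_bounds N r p lp : length (enc_tree (tr_raw r)) <= N -> nth_error (r_av r) p = Some lp ->
  p <= N /\ forall s l, nth_error lp s = Some l -> s <= N.
Proof.
  intros HN Hp. apply (enc_kid_le N (tr_raw r) 3 (Node (map (fun l => Node (map tr_nats l)) (r_av r)))) in HN; [|reflexivity]. destruct HN as [_ HN].
  apply (enc_kid_le N _ p (Node (map tr_nats lp))) in HN; [|simpl; now rewrite nth_error_map, Hp].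
  destruct HN as [HpN HN]. split; [exact HpN|]. intros s l Hs.
  apply (enc_kid_le N _ s (tr_nats l)) in HN; [tauto|simpl; now rewrite nth_error_map, Hs].
Qed.

Lemma entry_bounds N r e x : length (enc_tree (tr_raw r)) <= N -> nth_error (r_tr r) e = Some x ->
  e <= N /\ (forall p a, nth_error (snd (fst x)) p = Some a -> p <= N) /\
  (forall s q, nth_error (snd x) s = Some q -> s <= N).
Proof.
  intros HN He. apply (enc_kid_le N (tr_raw r) 4 (Node (map tr_entry (r_tr r)))) in HN; [|reflexivity]. destruct HN as [_ HN].
  apply (enc_kid_le N _ e (tr_entry x)) in HN; [|simpl; now rewrite nth_error_map, He].
  destruct HN as [HeN HN]. split; [exact HeN|]. split; intros j y Hj.
  - pose proof (proj2 (enc_kid_le N (tr_entry x) 1 (tr_nats (snd (fst x))) HN eq_refl)) as HN'; clear HN; rename HN' into HN.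
    apply (enc_kid_le N _ j (Leaf y)) in HN; [tauto|simpl; now rewrite nth_error_map, Hj].
  - pose proof (proj2 (enc_kid_le N (tr_entry x) 2 (Node (map tr_rawq (snd x))) HN eq_refl)) as HN'; clear HN; rename HN' into HN.
    apply (enc_kid_le N _ j (tr_rawq y)) in HN; [tauto|simpl; now rewrite nth_error_map, Hj].
Qed.

Lemma indicator_exists {A B} (P : A -> B -> Prop) : exists f : A -> B -> R,
  forall a b, (f a b = 1%R /\ P a b) \/ (f a b = 0%R /\ ~ P a b).
Proof.
  assert (H : forall ab, exists y : R, (y = 1%R /\ P (fst ab) (snd ab)) \/ (y = 0%R /\ ~ P (fst ab) (snd ab))).
  { intros [a b]. destruct (classic (P a b)); [exists 1%R|exists 0%R]; auto. }
  exists (fun a b => proj1_sig (constructive_indefinite_description _ (H (a, b)))). intros a b.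
  exact (proj2_sig (constructive_indefinite_description _ (H (a, b)))).
Qed.

(* The valuation reads back numbers from bits and indices i from N - i marks. *)
Definition valuation_of (N : nat) (r : raw) (sel : nat -> nat -> R) (x : nat -> nat -> nat -> R)
  (w : nat -> R) (lam : R) : valuation :=
  fun tag nm =>
    match tag, nm with
    | 0, [a; b; c] => Q2R (rat_of ((bval a, bval b), bval c))
    | 1, [p; s] => INR (length (av (game_of r) (N - length p) (N - length s)))
    | 2, [e; s] => sel (N - length e) (N - length s)
    | 3, [p; s; a] => x (N - length p) (N - length s) (bval a)
    | 4, _ => lam
    | 5, [s] => w (N - length s)
    | 6, [p; a; s; b] => point (r_team r) (fun p => x p (N - length s)) (bval b) (N - length p) (bval a)
    | _, _ => 0%R
    end.

Lemma game_spec_complete r N x w lam : raw_canonical r -> length (enc_tree (tr_raw r)) <= N ->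
  game_wf (game_of r) -> certificate (game_of r) x w lam ->
  exists rho, game_spec r (vars_of N rho).
Proof.
  intros Hcan HN Hg Hc.
  (* Selection is a proposition about the whole table, so its indicator is obtained classically;
     only the existence of a valuation is at stake. *)
  destruct (indicator_exists (fun e s => exists y, nth_error (r_tr r) e = Some y /\ selected r e s y)) as [sel Hsel].
  exists (valuation_of N r sel x w lam). set (v := vars_of N _).
  assert (HU : forall i, i <= N -> N - length (repeat true (N - i)) = i)
    by (intros; rewrite repeat_length; lia).
  assert (VD : forall q, vD v q = Q2R (rat_of q)).
  { intros [[sg m] d]. simpl. now rewrite !bval_bits. }
  assert (VL : forall p s, p <= N -> s <= N -> vL v p s = INR (length (av (game_of r) p s)))
    by (intros; simpl; rewrite !HU by assumption; reflexivity).
  assert (VM : forall e s, e <= N -> s <= N -> vM v e s = sel e s)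
    by (intros; simpl; rewrite !HU by assumption; reflexivity).
  assert (VX : forall p s a, p <= N -> s <= N -> vX v p s a = x p s a)
    by (intros; simpl; rewrite !HU, bval_bits by assumption; reflexivity).
  assert (VW : forall s, s <= N -> vW v s = w s)
    by (intros; simpl; rewrite !HU by assumption; reflexivity).
  assert (VY : forall p a s b, p <= N -> s <= N ->
    vY v p a s b = point (r_team r) (fun p => x p s) b p a)
    by (intros; simpl; rewrite !HU, !bval_bits by assumption; reflexivity).
  assert (Vlam : vlam v = lam) by reflexivity.
  clearbody v.
  pose proof Hg as (W1 & W2 & W3 & W4 & W5 & W6 & W7 & W8 & W9 & W10).
  simpl gi_team in *; simpl gi_nst in *; simpl gi_nact in *; simpl gi_av in *; simpl gi_target in *;
    simpl gi_init in *; simpl gi_thr in *.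
  assert (Hsh : shaped r) by (repeat split; trivial; now apply W4).
  pose proof (shaped_sized r Hsh) as Hsz.
  assert (Hb : forall p s, p <= r_team r -> s < r_nst r -> p <= N /\ s <= N).
  { intros p s Hp Hs. destruct Hsz as [S1 S2].
    destruct (nth_error (r_av r) p) as [lp|] eqn:E; [|apply nth_error_None in E; lia].
    destruct (nth_error lp s) as [l|] eqn:E'; [|apply nth_error_None in E'; rewrite (S2 _ _ E) in E'; lia].
    destruct (av_bounds N r p lp HN E) as [B1 B2]. split; [exact B1|]. eauto. }
  assert (Hp0 : 0 <= r_team r) by lia.
  assert (Hs0 : forall s, s < r_nst r -> s <= N) by (intros s Hs; apply (Hb 0 s Hp0 Hs)).
  assert (Hselok : select_ok r v).
  { unfold select_ok. apply all_states_iff; [exact Hsz|]. intros p s _ Hs e y Hy.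
    destruct (entry_bounds N r e y HN Hy) as [B _]. rewrite VM by auto.
    destruct (Hsel e s) as [[E (y' & Hy' & H)]|[E H]]; [left|right]; split; trivial.
    - congruence.
    - intros H'. apply H. eauto. }
  (* Since the transition function is total, every profile occurs among the selected entries. In
     this direction the counting equation is a consequence of the permutation. *)
  assert (HP : forall s, s < r_nst r -> Permutation (acts r v s) (profiles (game_of r) s)).
  { intros s Hs. apply NoDup_Permutation; [now apply nodup_acts|now apply nodup_profiles|].
    intros a. rewrite (in_acts r v Hsh Hselok s a Hs). split; [tauto|]. intros Ha. split; [exact Ha|].
    destruct (W5 s a Hs Ha) as (d & Hd & _). eauto. }
  assert (HE : forall e s y, s < r_nst r -> nth_error (r_tr r) e = Some y -> selected r e s y ->
    In (snd (fst y)) (profiles (game_of r) s) /\ first_entry r e s (snd (fst y)) /\ fst y = (s, snd (fst y)) /\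
    trans_lookup (game_of r) s (snd (fst y)) = Some (map rat_of (snd y))).
  { intros e s y Hs Hy Hse. apply selected_iff in Hse as (E & H1 & H2); trivial.
    assert (Hk : fst y = (s, snd (fst y))) by (destruct (fst y); simpl in *; congruence).
    repeat split; trivial. apply lookup_iff. eauto 7. }
  assert (HM : forall e s y, s < r_nst r -> nth_error (r_tr r) e = Some y ->
    vM v e s = 0%R \/ selected r e s y).
  { intros e s y Hs Hy. destruct (select_at r v Hsh Hselok e s y Hs Hy); tauto. }
  assert (HW5 : forall e s y, s < r_nst r -> nth_error (r_tr r) e = Some y -> selected r e s y ->
    length (snd y) = r_nst r /\ List.Forall (fun q => (0 <= q)%Q) (map rat_of (snd y)) /\
    (fold_right Qplus 0%Q (map rat_of (snd y)) == 1)%Q).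
  { intros e s y Hs Hy Hse. destruct (HE e s y Hs Hy Hse) as (H1 & _ & _ & H2).
    destruct (W5 s _ Hs H1) as (d & Hd & Hl & Hpos & Hsum). rewrite H2 in Hd. injection Hd as <-.
    rewrite length_map in Hl. auto. }
  assert (Htg : forall s, is_target (game_of r) s = true <-> targeted r s) by (intros; apply is_target_iff).
  assert (Htn : forall s, is_target (game_of r) s = false <-> ~ targeted r s).
  { intros s. rewrite <- Htg. destruct (is_target (game_of r) s); split; congruence. }
  unfold game_spec. split; [|split; [|split; [|split; [|split; [|split; [|split; [|split; [|split; [|split]]]]]]]]].
  - destruct Hcan as [C1 C2]. split.
    + apply rat_ok_iff. auto.
    + intros e y Hy i q Hq. apply rat_ok_iff. split; [eapply C2; eassumption|apply VD].
  - now apply shape_iff.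
  - exact Hselok.
  - split; apply all_states_iff; trivial.
    + intros p s Hp Hs. destruct (Hb p s Hp Hs). now apply VL.
    + intros _ s _ Hs. transitivity (INR (length (profiles (game_of r) s))).
      * rewrite <- (count_profiles r Hsh s), <- prodi_fst. apply prodi_ext. intros p lp Hp.
        destruct (av_bounds N r p lp HN Hp). apply VL; auto.
      * symmetry. apply acts_perm; auto.
  - apply all_states_iff; trivial. intros _ s _ Hs e y Hy.
    destruct (HM e s y Hs Hy) as [H|H]; [now left|right].
    destruct (HW5 e s y Hs Hy H) as (H1 & H2 & H3). repeat split; trivial.
    + intros i q Hq. rewrite VD. rewrite Forall_forall in H2.
      rewrite <- Q2R_0. apply Qle_Rle, H2, in_map. eapply nth_error_In; eassumption.
    + rewrite <- Q2R_1, <- (Qeq_eqR _ _ H3), Q2R_sum, <- sumi_snd. apply sumi_ext. auto.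
  - split.
    + intros i t Ht. rewrite Forall_forall in W6. apply W6. eapply nth_error_In; eassumption.
    + apply all_states_iff; trivial. intros _ s _ Hs e y Hy.
      destruct (HM e s y Hs Hy) as [H|H]; [now left|right].
      destruct (classic (targeted r s)) as [HT|HT]; [right|now left]. intros s' q Hq.
      destruct (classic (targeted r s')) as [HT'|HT']; [now left|right].
      destruct (HE e s y Hs Hy H) as (H1 & H2 & H3 & _). destruct (HW5 e s y Hs Hy H) as (H4 & _).
      rewrite VD. etransitivity; [symmetry; exact (delta_entry r s _ e y s' q Hy H3 H2 Hq)|].
      apply W7; trivial; [now apply Htg| |now apply Htn]. rewrite <- H4. eapply nth_error_lt; eassumption.
  - destruct (cert_lam _ _ _ _ Hc). rewrite <- Vlam in *. repeat split; trivial; rewrite VD.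
    + rewrite <- Q2R_0. now apply Qle_Rle.
    + rewrite <- Q2R_1. now apply Qle_Rle.
  - apply all_states_iff; trivial. intros p s Hp Hs. destruct (Hb p s Hp Hs) as [B1 B2].
    destruct (Nat.eq_dec p (r_team r)) as [|Hne]; [now left|right].
    destruct (cert_team _ _ _ _ Hc s Hs p) as [H1 H2]; [simpl; lia|]. split.
    + intros i a Ha. rewrite VX by assumption. apply H1. eapply nth_error_In; eassumption.
    + rewrite <- H2, <- sumi_snd. apply sumi_ext. auto.
  - apply all_states_iff; trivial. intros _ s _ Hs. rewrite VW, VD by auto. repeat split.
    + apply (cert_pos _ _ _ _ Hc s Hs).
    + destruct (classic (targeted r s)) as [HT|HT]; [right|now left].
      apply (cert_target _ _ _ _ Hc s Hs). now apply Htg.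
    + destruct (Nat.eq_dec s (r_init r)) as [->|]; [right|now left]. apply (cert_init _ _ _ _ Hc).
  - intros p lp Hp. destruct (Nat.eq_dec p (r_team r)) as [->|]; [right|now left]. intros s l Hs.
    assert (Hs' : s < r_nst r) by (rewrite <- (proj2 Hsz _ _ Hp); eapply nth_error_lt; eassumption).
    destruct (classic (targeted r s)) as [HT|HT]; [now left|right]. intros i b Hi. split.
    + intros e y Hy p' a Ha. destruct (entry_bounds N r e y HN Hy) as (_ & B & _). specialize (B p' a Ha).
      rewrite VY, VX by auto. unfold point.
      destruct (Nat.eqb_spec p' (r_team r)); [left|right]; split; trivial.
      destruct (Nat.eqb_spec a b); [left|right]; auto.
    + rewrite (step_sum r v Hsh Hselok s b (vW v) (fun p a => vY v p a s b) (fun p => x p s)); trivial.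
      * rewrite VW, Vlam by auto.
        rewrite (expect_ext_f _ _ _ (vW v) w) by (intros; apply VW; auto).
        apply (cert_step _ _ _ _ Hc s b Hs'); [now apply Htn|].
        simpl. rewrite (av_nth r _ _ _ _ Hp Hs). eapply nth_error_In; eassumption.
      * intros e y Hy Hse. now apply (HW5 e s y).
      * now apply HP.
      * intros e y Hy p' a Ha. destruct (entry_bounds N r e y HN Hy) as (_ & B & _). apply VY; eauto.
  - exact I.
Qed.

Theorem theorem3 : in_ExistsR threshold_lang.
Proof.
  apply (reduction game_sch game_formula threshold_lang);
    [reflexivity|reflexivity|apply game_formula_wt|apply game_formula_names|].
  intros w. split.
  - intros (g & Hw & Hg & Hy). destruct (game_of_surj g) as (r & Hr & <-).
    rewrite (tr_game_of r Hr) in Hw.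
    destruct (proj2 (game_sch_raw (tr_raw r)) (ex_intro _ r eq_refl)) as [x Hx].
    exists x, (tr_raw r). split; [exact Hx|]. split; [exact Hw|].
    apply (threshold_certificate _ Hg) in Hy as (y & u & lam & Hc).
    destruct (game_spec_complete r (length w) y u lam Hr) as [rho Hrho]; trivial; [rewrite Hw; lia|].
    exists rho. exact (proj2 (game_formula_spec rho (length w) r) Hrho).
  (* The sentence vouches for canonical rationals and for well-formedness, so the word encodes a
     game although the machine has checked only the grammar. *)
  - intros (x & t & Hx & Hw & rho & Hrho).
    destruct (proj1 (game_sch_raw t) (ex_intro _ x Hx)) as [r ->].
    apply (proj1 (game_formula_spec rho (length w) r)), game_spec_sound in Hrho as (Hr & Hg & Hc).
    exists (game_of r). split; [now rewrite tr_game_of|]. split; [exact Hg|].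
    apply threshold_certificate; [exact Hg|]. eauto.
Qed.
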